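(* Assume the standing setup, either Setting A or Setting B, and the Gibbs-measure and observable conventions and complex-perturbation quantities below. Assume: (a) $\operatorname{ess\,sup}_\omega E_\omega<\infty$; (b) in Setting A, additionally $\tilde H_\omega\le\gamma_{\theta\omega}^\alpha-1$ $\mathbb P$-a.s.; (c) for some $p>8$, $\bar D_\omega\in L^{2p}(\mathbb P)$ and $K_\omega$, $M_\omega$, $\sup|\tilde u_\omega|$ belong to $L^p(\mathbb P)$; (d) there is a constant $\sigma>0$ with $\sigma^2=\lim_n\frac1n\sigma^2_{\omega,n}$ for $\mathbb P$-a.e. $\omega$. Let $(a_n)$ be positive with $a_nn^{-\max(6/p,1/2)}\to\infty$ and $a_n=o(n^{1-8/p})$. Then for $\mathbb P$-a.e. $\omega$ and every Borel set $\Gamma\subset\mathbb R$, $$-\inf_{x\in\Gamma^{o}}\frac{x^2}{2\sigma^2}\le\liminf_{n\to\infty}\frac{n}{a_n^2}\ln\mu_\omega\Big(\frac{S^\omega_n\tilde u}{a_n}\in\Gamma\Big)\le\limsup_{n\to\infty}\frac{n}{a_n^2}\ln\mu_\omega\Big(\frac{S^\omega_n\tilde u}{a_n}\in\Gamma\Big)\le-\inf_{x\in\overline\Gamma}\frac{x^2}{2\sigma^2},$$ where $\Gamma^o$ and $\overline\Gamma$ are the interior and closure of $\Gamma$ and $S^\omega_n\tilde u=\sum_{j=0}^{n-1}\tilde u_{\theta^j\omega}\circ T^j_\omega$.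
   Context: Standing setup. $(\Omega,\mathcal F,\mathbb P)$ is a probability space and $\theta:\Omega\to\Omega$ is invertible, measurable, $\mathbb P$-preserving and ergodic. $(\mathcal X,d)$ is a compact metric space with $\operatorname{diam}\mathcal X\le1$; $\mathcal E\subset\Omega\times\mathcal X$ is $\mathcal F\otimes\mathcal B(\mathcal X)$-measurable with compact fibres $\mathcal E_\omega=\{x:(\omega,x)\in\mathcal E\}$; $T_\omega:\mathcal E_\omega\to\mathcal E_{\theta\omega}$ are maps with $(\omega,x)\mapsto T_\omega x$ measurable, and $T^n_\omega=T_{\theta^{n-1}\omega}\circ\cdots\circ T_\omega$. ''Random variable'' means a measurable function of $\omega$. An exponent $\alpha\in(0,1]$ is fixed. For $g:\mathcal E_\omega\to\mathbb C$ let $v(g)=\sup_{x\ne x'}|g(x)-g(x')|/d(x,x')^\alpha$ and $\|g\|=\sup|g|+v(g)$; $\mathcal H_\omega$ is the space of real functions $g$ on $\mathcal E_\omega$ with $\|g\|<\infty$, and $\mathbf 1$ is the constant function $1$. A measurable potential $\phi:\mathcal E\to\mathbb R$ is given with $\phi_\omega=\phi(\omega,\cdot)$ bounded. The transfer operator is $\mathcal L_\omega g(x)=\sum_{y\in T_\omega^{-1}\{x\}}e^{\phi_\omega(y)}g(y)$, $x\in\mathcal E_{\theta\omega}$, and $\mathcal L^n_\omega=\mathcal L_{\theta^{n-1}\omega}\circ\cdots\circ\mathcal L_\omega$. Write $\rho_{\omega,n}=\prod_{j=0}^{n-1}\rho(\theta^j\omega)$ and $\lambda_{\omega,n}=\prod_{j=0}^{n-1}\lambda_{\theta^j\omega}$.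 Setting A (properly expanding maps). There are random variables $\gamma_\omega>1$, $H_\omega\ge0$, $D_\omega<\infty$ such that $\mathbb P$-a.s.: for every $x\in\mathcal E_{\theta\omega}$ the preimages are listed as $T_\omega^{-1}\{x\}=\{y_{i,\omega}(x):i\in I_\omega\}$ (index set $I_\omega$ finite or countable, independent of $x$, $i\mapsto y_{i,\omega}(x)$ bijective), and for all $x,x'\in\mathcal E_{\theta\omega}$ and $i\in I_\omega$: $d(y_{i,\omega}(x),y_{i,\omega}(x'))\le\gamma_\omega^{-1}d(x,x')$ and $|\phi_\omega(y_{i,\omega}(x))-\phi_\omega(y_{i,\omega}(x'))|\le H_\omega d(x,x')^\alpha$; moreover $H_\omega\le\gamma_{\theta\omega}^\alpha-1$ and $\sup_{x\in\mathcal E_{\theta\omega}}\sum_{y\in T_\omega^{-1}\{x\}}e^{\phi_\omega(y)}\le D_\omega$. In Setting A put $q(\omega)=(H_\omega+1)\gamma_{\theta\omega}^{-\alpha}$, $D(\omega)=\gamma_{\theta\omega}^\alpha+2\ln\frac{1+q(\omega)}{1-q(\omega)}$, $\rho(\omega)=\tanh(D(\omega)/4)$ (with $\rho(\omega)=1$ if $q(\omega)=1$), $B_\omega=24e^{4\gamma_\omega^\alpha}(1+\gamma_\omega^\alpha)^2$, $B_{\omega,1}=e^{\gamma_\omega^\alpha}$, $K_\omega=(1+\gamma_\omega^\alpha)e^{\gamma_\omega^\alpha}$, $M_\omega=8(1-e^{-\gamma_\omega^\alpha})^{-2}$, and $\mathcal C_\omega=\{g\in\mathcal H_\omega:g\ge0,\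 g(x)\le e^{\gamma_\omega^\alpha d(x,x')^\alpha}g(x')\ \forall x,x'\in\mathcal E_\omega\}$. Setting B (partially expanding maps). There are random variables $l_\omega\ge1$, $\sigma_\omega>1$ and positive integer valued $q_\omega<d_\omega$ such that $\mathbb P$-a.s. every $x\in\mathcal E_{\theta\omega}$ has exactly $d_\omega$ preimages, listed as $T_\omega^{-1}\{x\}=\{y_{1,\omega}(x),\dots,y_{d_\omega,\omega}(x)\}$, and for all $x,x'\in\mathcal E_{\theta\omega}$: $d(y_{i,\omega}(x),y_{i,\omega}(x'))\le l_\omega d(x,x')$ for $i\le q_\omega$ and $d(y_{i,\omega}(x),y_{i,\omega}(x'))\le\sigma_\omega^{-1}d(x,x')$ for $q_\omega<i\le d_\omega$. Let $a_\omega=(q_\omega l_\omega^\alpha+(d_\omega-q_\omega)\sigma_\omega^{-\alpha})/d_\omega$, $\varepsilon_\omega=\sup\phi_\omega-\inf\phi_\omega$, $H_\omega=\max_{i\le d_\omega}v(\phi_\omega\circ y_{i,\omega})$ (assumed finite), and assume $s_\omega:=e^{\varepsilon_\omega}a_\omega<1$ and $e^{\varepsilon_\omega}H_\omega\le(s_{\theta\omega}^{-1}-1)/(1+s_\omega^{-1})$. In Setting B put $\zeta_\omega=s_{\theta\omega}\big(1+(1+s_\omega^{-1})e^{\varepsilon_\omega}H_\omega\big)$, $D(\omega)=2\ln\frac{1+\zeta_\omega}{1-\zeta_\omega}+2\ln(1+\zeta_\omega s_\omega^{-1})$, $\rho(\omega)=\tanh(D(\omega)/4)$ (with $\rho(\omega)=1$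 if $\zeta_\omega=1$), $B_\omega=12(1+2s_\omega^{-1})^4$, $B_{\omega,1}=1+s_\omega^{-1}$, $K_\omega=1+2s_\omega^{-1}$, $M_\omega=6s_\omega^{-1}$, $D_\omega=d_\omega e^{\sup|\phi_\omega|}$, and $\mathcal C_\omega=\{g\in\mathcal H_\omega:g>0,\ v(g)\le s_\omega^{-1}\inf g\}$. Gibbs measures. In either setting, $\mathbb P$-a.s. the limits $\nu_\omega(g)=\lim_n\mathcal L^n_\omega g(x_n)/\mathcal L^n_\omega\mathbf 1(x_n)$ ($g\in\mathcal H_\omega$, any $x_n\in\mathcal E_{\theta^n\omega}$), $\lambda_\omega=\nu_{\theta\omega}(\mathcal L_\omega\mathbf 1)$ and $h_\omega=\lim_n\mathcal L^n_{\theta^{-n}\omega}\mathbf 1/\lambda_{\theta^{-n}\omega,n}$ exist, $\nu_\omega$ is a Borel probability measure, and $\mu_\omega:=h_\omega\nu_\omega$ is the random Gibbs measure; it satisfies $(T_\omega)_*\mu_\omega=\mu_{\theta\omega}$. Observables. $u:\mathcal E\to\mathbb R$ is measurable with $u_\omega=u(\omega,\cdot)\in\mathcal H_\omega$; $\tilde u_\omega=u_\omega-\mu_\omega(u_\omega)$; $S^\omega_nu=\sum_{j=0}^{n-1}u_{\theta^j\omega}\circ T^j_\omega$, viewed as a random variable on $(\mathcal E_\omega,\mu_\omega)$; $\sigma^2_{\omega,n}=\mathrm{Var}_{\mu_\omega}(S^\omega_nu)$. Complex-perturbation quantities. In Setting A: $\tilde H_\omega=\gamma_\omega^{-\alpha}v(u_\omega)+H_\omega$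 and $c_0(\omega)=3\sup|\tilde u_\omega|+\tilde H_\omega/(\gamma_{\theta\omega}^\alpha-1-\tilde H_\omega)$. In Setting B: $\tilde H_\omega=H_\omega$ and $c_0(\omega)=32s_{\theta\omega}(1+2s_\omega^{-1})e^{\sup|\tilde u_\omega|+2\sup|\phi_\omega|}\|\tilde u_\omega\|(1+H_\omega)/(1-\zeta_\omega)$. In both settings: $E_\omega=c_0(\omega)\big(1+\cosh(7D(\omega)/2)\big)$ and $\bar D_\omega=16e^{\sup|\tilde u_\omega|}(1+v(u_\omega))(1+\tilde H_\omega)D_\omega$. *)

(* Defs.v *)
From HB Require Import structures.
From mathcomp Require Import all_boot all_order all_algebra.
From mathcomp Require Import all_classical all_reals all_analysis.
From mathcomp Require Import ess_sup_inf.
Set Implicit Arguments. Unset Strict Implicit. Unset Printing Implicit Defensive.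
Import Order.TTheory GRing.Theory Num.Theory.
Import numFieldNormedType.Exports.
Local Open Scope classical_set_scope.
Local Open Scope ring_scope.

Section Metric.
Variables (R : realType) (X : Type) (dist : X -> X -> R).

Definition is_metric : Prop :=
  [/\ forall x y, 0 <= dist x y,
      forall x y, dist x y = 0 <-> x = y,
      forall x y, dist x y = dist y x &
      forall x y z, dist x z <= dist x y + dist y z].

Definition dball (x : X) (r : R) : set X := [set y | dist x y < r].

Definition dopen : set (set X) :=
  [set A | forall x, A x -> exists2 r : R, 0 < r & dball x r `<=` A].

Definition dcompact (K : set X) : Prop :=
  forall F : set (set X), F `<=` dopen -> K `<=` \bigcup_(A in F) A ->
  exists G : set (set X),
    [/\ finite_set G, G `<=` F & K `<=` \bigcup_(A in G) A].

End Metric.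

Section Holder.
Variables (R : realType) (X : Type) (dist : X -> X -> R) (alpha : R).

Definition supn (A : set X) (g : X -> R) : R :=
  fine (ereal_sup [set (g x)%:E | x in A]).
Definition infn (A : set X) (g : X -> R) : R :=
  fine (ereal_inf [set (g x)%:E | x in A]).

(* v(g) = sup_{x <> x'} |g x - g x'| / d(x,x')^alpha  (0 if A has < 2 points) *)
Definition hsemi (A : set X) (g : X -> R) : \bar R :=
  ereal_sup ([set 0%E] `|`
    [set (`|g z.1 - g z.2| / (dist z.1 z.2) `^ alpha)%:E
       | z in [set z : X * X | [/\ A z.1, A z.2 & z.1 <> z.2]]]).
Definition hv (A : set X) (g : X -> R) : R := fine (hsemi A g).

Definition holder_fun (A : set X) (g : X -> R) : Prop :=
  (exists M : R, forall x, A x -> `|g x| <= M) /\ (hsemi A g < +oo)%E.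

End Holder.

Definition coshR (R : realType) (x : R) : R := (expR x + expR (- x)) / 2.

Definition elog (R : realType) (e : \bar R) : \bar R :=
  match e with
  | EFin r => if 0 < r then (ln r)%:E else -oo%E
  | EPInf => +oo%E
  | ENInf => -oo%E
  end.

Definition Eform (R : realType) (c0 D : \bar R) : \bar R :=
  match c0, D with
  | EFin r, EFin s => (r * (1 + coshR (7 * s / 2)))%:E
  | _, _ => +oo%E
  end.

Definition inLp (R : realType) d (T : measurableType d)
    (P : {measure set T -> \bar R}) (p : R) (f : T -> R) : Prop :=
  measurable_fun setT f /\ (\int[P]_x ((`|f x| `^ p)%:E) < +oo)%E.

Section RDS.
Variables (R : realType) (dO dX : measure_display)
  (Omega : measurableType dO) (X : measurableType dX)
  (dist : X -> X -> R) (alpha : R)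
  (theta thetainv : Omega -> Omega)
  (E : Omega -> set X) (T : Omega -> X -> X) (phi : Omega -> X -> R)
  (nu : Omega -> {measure set X -> \bar R}) (u : Omega -> X -> R).

Definition thn (n : nat) (w : Omega) : Omega := iter n theta w.
Definition thmn (n : nat) (w : Omega) : Omega := iter n thetainv w.

Definition preim (w : Omega) (x : X) : set X := [set y | E w y /\ T w y = x].

(* transfer operator L_omega g (x) = sum_{y in T^{-1}x} e^{phi(y)} g(y),
   an (absolutely convergent) unordered sum, split in positive/negative parts *)
Definition Lop (w : Omega) (g : X -> R) (x : X) : R :=
  fine (\esum_(y in preim w x) (Num.max (expR (phi w y) * g y) 0)%:E)
  - fine (\esum_(y in preim w x) (Num.max (- (expR (phi w y) * g y)) 0)%:E).

Fixpoint Ln (w : Omega) (n : nat) (g : X -> R) : X -> R :=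
  match n with
  | 0 => g
  | m.+1 => Lop (thn m w) (Ln w m g)
  end.

Fixpoint Tn (w : Omega) (n : nat) (x : X) : X :=
  match n with
  | 0 => x
  | m.+1 => T (thn m w) (Tn w m x)
  end.

Definition Sn (f : Omega -> X -> R) (w : Omega) (n : nat) (x : X) : R :=
  \sum_(j < n) f (thn j w) (Tn w j x).

Definition one : X -> R := fun _ => 1.

Definition conformal_nu (w : Omega) : Prop :=
  nu w (E w) = 1%E /\
  forall g : X -> R, holder_fun dist alpha (E w) g ->
  forall xs : nat -> X, (forall n, E (thn n w) (xs n)) ->
    (fun n => Ln w n g (xs n) / Ln w n one (xs n)) @ \oo -->
      fine (\int[nu w]_(x in E w) (g x)%:E).

Definition lam (w : Omega) : R :=
  fine (\int[nu (theta w)]_(x in E (theta w)) (Lop w one x)%:E).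
Definition lamn (w : Omega) (n : nat) : R := \prod_(j < n) lam (thn j w).

Definition hdens (w : Omega) (x : X) : R :=
  limn (fun n => Ln (thmn n w) n one x / lamn (thmn n w) n).

Definition muint (w : Omega) (f : X -> R) : R :=
  fine (\int[nu w]_(x in E w) (hdens w x * f x)%:E).
Definition mumeas (w : Omega) (A : set X) : \bar R :=
  \int[nu w]_(x in E w `&` A) (hdens w x)%:E.

Definition ut (w : Omega) (x : X) : R := u w x - muint w (u w).
Definition sigma2n (w : Omega) (n : nat) : R :=
  muint w (fun x => (Sn u w n x - muint w (Sn u w n)) ^+ 2).

Definition supu (w : Omega) : R := supn (E w) (fun x => `|ut w x|).
Definition vu (w : Omega) : R := hv dist alpha (E w) (u w).

Section SettingA.
Variables (P : {measure set Omega -> \bar R}) (gam HA DA : Omega -> R).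

Definition settingA : Prop :=
  [/\ measurable_fun setT gam, measurable_fun setT HA, measurable_fun setT DA &
  {ae P, forall w,
    [/\ 1 < gam w, 0 <= HA w,
     (exists (I : set nat) (y : nat -> X -> X),
       (forall x, E (theta w) x ->
          [/\ forall i, I i -> preim w x (y i x),
              forall z, preim w x z -> exists2 i, I i & y i x = z &
              forall i j, I i -> I j -> y i x = y j x -> i = j]) /\
       (forall x x', E (theta w) x -> E (theta w) x' -> forall i, I i ->
          dist (y i x) (y i x') <= (gam w)^-1 * dist x x' /\
          `|phi w (y i x) - phi w (y i x')| <= HA w * (dist x x') `^ alpha)),
     HA w <= (gam (theta w)) `^ alpha - 1 &
     forall x, E (theta w) x ->
       (\esum_(y in preim w x) (expR (phi w y))%:E <= (DA w)%:E)%E]}].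

Definition qA (w : Omega) : R := (HA w + 1) * (gam (theta w)) `^ (- alpha).
Definition DfA (w : Omega) : \bar R :=
  if qA w < 1 then
    ((gam (theta w)) `^ alpha + 2 * ln ((1 + qA w) / (1 - qA w)))%:E
  else +oo%E.
Definition KA (w : Omega) : R := (1 + gam w `^ alpha) * expR (gam w `^ alpha).
Definition MA (w : Omega) : R := 8 * (1 - expR (- gam w `^ alpha)) ^-2.
Definition HtA (w : Omega) : R := (gam w) `^ (- alpha) * vu w + HA w.
Definition c0A (w : Omega) : \bar R :=
  if 0 < gam (theta w) `^ alpha - 1 - HtA w then
    (3 * supu w + HtA w / (gam (theta w) `^ alpha - 1 - HtA w))%:E
  else +oo%E.
Definition EA (w : Omega) : \bar R := Eform (c0A w) (DfA w).
Definition DbarA (w : Omega) : R :=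
  16 * expR (supu w) * (1 + vu w) * (1 + HtA w) * DA w.

Definition condA (p : R) : Prop :=
  [/\ (ess_sup P EA < +oo)%E,
      {ae P, forall w, HtA w <= gam (theta w) `^ alpha - 1} &
      [/\ inLp P (2 * p) DbarA, inLp P p KA, inLp P p MA & inLp P p supu]].
End SettingA.

Section SettingB.
Variables (P : {measure set Omega -> \bar R}) (l sig : Omega -> R)
  (qB dB : Omega -> nat) (yB : Omega -> nat -> X -> X).

Definition aB (w : Omega) : R :=
  ((qB w)%:R * l w `^ alpha + ((dB w)%:R - (qB w)%:R) * sig w `^ (- alpha))
  / (dB w)%:R.
Definition epsB (w : Omega) : R := supn (E w) (phi w) - infn (E w) (phi w).
Definition HB (w : Omega) : R :=
  \big[Num.max/0]_(i < dB w) hv dist alpha (E (theta w)) (phi w \o yB w i.+1).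
Definition sB (w : Omega) : R := expR (epsB w) * aB w.

Definition settingB : Prop :=
  [/\ measurable_fun setT l, measurable_fun setT sig,
      measurable_fun setT (fun w => (qB w)%:R : R),
      measurable_fun setT (fun w => (dB w)%:R : R) &
  {ae P, forall w,
    [/\ [/\ 1 <= l w, 1 < sig w, (0 < qB w)%N & (qB w < dB w)%N],
     forall x, E (theta w) x ->
       [/\ forall i, (1 <= i <= dB w)%N -> preim w x (yB w i x),
           forall z, preim w x z -> exists2 i, (1 <= i <= dB w)%N & yB w i x = z &
           forall i j, (1 <= i <= dB w)%N -> (1 <= j <= dB w)%N ->
             yB w i x = yB w j x -> i = j],
     forall x x', E (theta w) x -> E (theta w) x' ->
       (forall i, (1 <= i <= qB w)%N ->
          dist (yB w i x) (yB w i x') <= l w * dist x x') /\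
       (forall i, (qB w < i <= dB w)%N ->
          dist (yB w i x) (yB w i x') <= (sig w)^-1 * dist x x'),
     forall i, (1 <= i <= dB w)%N ->
       (hsemi dist alpha (E (theta w)) (phi w \o yB w i) < +oo)%E &
     sB w < 1 /\
     expR (epsB w) * HB w <= ((sB (theta w))^-1 - 1) / (1 + (sB w)^-1)]}].

Definition zetaB (w : Omega) : R :=
  sB (theta w) * (1 + (1 + (sB w)^-1) * expR (epsB w) * HB w).
Definition DfB (w : Omega) : \bar R :=
  if zetaB w < 1 then
    (2 * ln ((1 + zetaB w) / (1 - zetaB w))
     + 2 * ln (1 + zetaB w * (sB w)^-1))%:E
  else +oo%E.
Definition KB (w : Omega) : R := 1 + 2 * (sB w)^-1.
Definition MB (w : Omega) : R := 6 * (sB w)^-1.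
Definition DcB (w : Omega) : R :=
  (dB w)%:R * expR (supn (E w) (fun x => `|phi w x|)).
Definition normut (w : Omega) : R := supu w + hv dist alpha (E w) (ut w).
Definition c0B (w : Omega) : \bar R :=
  if zetaB w < 1 then
    (32 * sB (theta w) * (1 + 2 * (sB w)^-1)
     * expR (supu w + 2 * supn (E w) (fun x => `|phi w x|))
     * normut w * (1 + HB w) / (1 - zetaB w))%:E
  else +oo%E.
Definition EB (w : Omega) : \bar R := Eform (c0B w) (DfB w).
Definition DbarB (w : Omega) : R :=
  16 * expR (supu w) * (1 + vu w) * (1 + HB w) * DcB w.

Definition condB (p : R) : Prop :=
  [/\ (ess_sup P EB < +oo)%E,
      inLp P (2 * p) DbarB,
      inLp P p KB, inLp P p MB & inLp P p supu].
End SettingB.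

Definition mdp_seq (a : nat -> R) (G : set R) (w : Omega) (n : nat) : \bar R :=
  let ev := [set x | G (Sn ut w n x / a n)] in
  ((n%:R / a n ^+ 2)%:E * elog (mumeas w ev))%E.

End RDS.

(* Main.v *)
Require Import Defs.
From HB Require Import structures.
From mathcomp Require Import all_boot all_order all_algebra.
From mathcomp Require Import all_classical all_reals all_analysis.
From mathcomp Require Import ess_sup_inf measurable_realfun.
From mathcomp Require Import ring lra.

(** Everything rests on real cones. If f and g lie in the cone C_w and int L g <= int L f, then (1 - de) L f - de L g is again in the cone, with de_w > 0 explicit; hence oscillations relative to h contract by the factor 1 - de_w under the normalized operator. If cc_w dominates the size and the Hoelder constant of the centered observable v appropriately, then L maps (cc +- v) f and (cc +- v) (cc +- v) f back into the cone, and the bound on E_w gives cc <= kap * de, where kap_w is a multiple of K_(theta w)^2. So the correctors X and Y, which solve the first and second order equations along the orbit, are bounded by multiples of k h and k^2 h with k = max_(j < n) kap_(theta^j w), and multiplying h exp (s X / h + ..) by exp (s v) and applying L reproduces the same expression one fibre further up to a factor exp (O((|s| k)^3)). This yields ln E exp (s S_n) = s^2 Var(S_n) / 2 + O(|s| k + n (|s| k)^3). By Borel-Cantelli k = O(n^(2/p)), so with s = t a_n / n the scaled cumulants converge to t^2 sigma^2 / 2 and the quadratic Gaertner-Ellis argument applies.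

The existence and regularity of h only needs de_w to be bounded below infinitely often in the past. Ergodicity provides this on a set where sup |v| is bounded below, which has positive measure because sigma > 0. *)

Set Implicit Arguments. Unset Strict Implicit. Unset Printing Implicit Defensive.
Import Order.TTheory GRing.Theory Num.Theory.
Import numFieldNormedType.Exports.
Local Open Scope classical_set_scope.
Local Open Scope ring_scope.

(** * Bounded measurable functions and counting sums *)

(** The rate [de] has no positive lower bound along an orbit, so no geometric series is available
    for the correctors. A balance replaces it: one step multiplies an oscillation r by 1 - de and
    adds a source of size at most 2 cc <= 2 k de, so r <= 2 k is never violated, however small [de]
    gets. This explains why E_w is a product: c_0 controls the observable, and the hyperbolic cosine
    of a multiple of D supplies 1 / de in setting A; in setting B part of 1 / de is paid for by the
    other factors of c_0 and by K_(theta w)^2.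

    The second obstacle is a circle. The density h is a backward limit whose convergence rests on
    recurrence, recurrence rests on v not vanishing, and this is deduced from sigma > 0, whose
    definition already contains h. The non-degeneracy of v is therefore proved with h taken as a
    bare nonnegative function, neither measurable nor normalized as far as is known at that point.

    Almost sure hypotheses are turned into hypotheses at every point of a theta-invariant set, so
    that the main estimates concern one orbit and no measurability in w enters them. *)

Section bounded_measurable.
Context d {T : measurableType d} {R : realType}.
Implicit Types (D : set T) (f g : T -> R).

(** Bounded measurable functions on a fibre form the working class: it is preserved by the algebra
    operations and by transfer operators, and on a finite measure it consists of integrable
    functions, which disposes of the side conditions on integrals. *)
Definition bmf D f :=
  measurable_fun D f /\ exists M : R, forall x, D x -> `|f x| <= M.

Lemma bmf_cst D c : bmf D (fun=> c).
Proof. by split; [exact: measurable_cst | exists `|c|]. Qed.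

Lemma bmfD D f g : bmf D f -> bmf D g -> bmf D (fun x => f x + g x).
Proof.
move=> [mf [M fM]] [mg [N gN]]; split; first exact: measurable_funD.
by exists (M + N) => x Dx; rewrite (le_trans (ler_normD _ _))// lerD ?fM ?gN.
Qed.

Lemma bmfM D f g : bmf D f -> bmf D g -> bmf D (fun x => f x * g x).
Proof.
move=> [mf [M fM]] [mg [N gN]]; split; first exact: measurable_funM.
by exists (M * N) => x Dx; rewrite normrM ler_pM ?fM ?gN.
Qed.

Lemma bmfN D f : bmf D f -> bmf D (fun x => - f x).
Proof.
move=> [mf [M fM]]; split; first exact: measurableT_comp.
by exists M => x Dx; rewrite normrN fM.
Qed.

Lemma bmfB D f g : bmf D f -> bmf D g -> bmf D (fun x => f x - g x).
Proof. by move=> bf bg; apply: bmfD => //; exact: bmfN. Qed.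

Lemma bmfZ D c f : bmf D f -> bmf D (fun x => c * f x).
Proof. by move=> bf; apply: bmfM => //; exact: bmf_cst. Qed.

Lemma bmf_expR D f : bmf D f -> bmf D (fun x => expR (f x)).
Proof.
move=> [mf [M fM]]; split; first exact: measurableT_comp.
exists (expR M) => x Dx; rewrite ger0_norm ?expR_ge0// ler_expR.
by rewrite (le_trans (ler_norm _))// fM.
Qed.

Lemma eq_bmf D f g : (forall x, D x -> f x = g x) -> bmf D f -> bmf D g.
Proof.
move=> fg [mf [M fM]]; split.
  by apply: eq_measurable_fun mf => x; rewrite inE; exact: fg.
by exists M => x Dx; rewrite -fg ?fM.
Qed.

Lemma bmf_sum D n (f : nat -> T -> R) : (forall i, (i < n)%N -> bmf D (f i)) ->
  bmf D (fun x => \sum_(i < n) f i x).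
Proof.
elim: n => [|n ih] h.
  by apply: eq_bmf (bmf_cst D 0) => x _; rewrite big_ord0.
apply: (@eq_bmf _ (fun x => \sum_(i < n) f i x + f n x)).
  by move=> x _; rewrite big_ord_recr.
by apply: bmfD; [apply: ih => i ni; apply: h; exact: ltnW | exact: h].
Qed.

Lemma bmf_indic D (A : set T) : measurable A -> bmf D (\1_A : T -> R).
Proof.
move=> mA; split; first exact: measurable_indic.
by exists 1 => x _; rewrite indicE; case: (_ \in _); rewrite ?normr1 ?normr0.
Qed.

Section integral.
Variable mu : {measure set T -> \bar R}.
Variable D : set T.
Hypotheses (mD : measurable D) (muD : (mu D < +oo)%E).

Lemma bmf_integrable f : bmf D f -> mu.-integrable D (EFin \o f).
Proof.
move=> [mf [M fM]]; apply: measurable_bounded_integrable => //.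
exists `|M|; split; first by rewrite num_real.
move=> y My x Dx /=; rewrite (le_trans (fM _ Dx))// (le_trans (ler_norm _))//.
exact: ltW.
Qed.

Lemma RintD f g : bmf D f -> bmf D g ->
  \int[mu]_(x in D) (f x + g x) = \int[mu]_(x in D) f x + \int[mu]_(x in D) g x.
Proof. by move=> bf bg; rewrite RintegralD//; exact: bmf_integrable. Qed.

Lemma RintB f g : bmf D f -> bmf D g ->
  \int[mu]_(x in D) (f x - g x) = \int[mu]_(x in D) f x - \int[mu]_(x in D) g x.
Proof. by move=> bf bg; rewrite RintegralB//; exact: bmf_integrable. Qed.

Lemma RintZ c f : bmf D f ->
  \int[mu]_(x in D) (c * f x) = c * \int[mu]_(x in D) f x.
Proof. by move=> bf; rewrite RintegralZl//; exact: bmf_integrable. Qed.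

Lemma le_Rint f g : bmf D f -> bmf D g -> (forall x, D x -> f x <= g x) ->
  \int[mu]_(x in D) f x <= \int[mu]_(x in D) g x.
Proof. by move=> bf bg fg; apply: le_Rintegral => //; exact: bmf_integrable. Qed.

Lemma eq_Rint f g : (forall x, D x -> f x = g x) ->
  \int[mu]_(x in D) f x = \int[mu]_(x in D) g x.
Proof. by move=> fg; apply: eq_Rintegral => x; rewrite inE; exact: fg. Qed.

Lemma Rint_dct (f : nat -> T -> R) g (M : R) : (forall n, measurable_fun D (f n)) ->
  (forall n x, D x -> `|f n x| <= M) ->
  (forall x, D x -> f^~ x @ \oo --> g x) ->
  [/\ bmf D g &
      (fun n => \int[mu]_(x in D) f n x) @ \oo --> \int[mu]_(x in D) g x].
Proof.
move=> mf fM fg.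
have mg : measurable_fun D g by apply: (measurable_fun_cvg mf).
have gM : forall x, D x -> `|g x| <= M.
  move=> x Dx; have h : (fun n => `|f n x|) @ \oo --> `|g x| by apply: cvg_norm; exact: fg.
  rewrite -(cvg_lim (@Rhausdorff R) h); apply: limr_le.
    by apply/cvg_ex; eexists; exact: h.
  by near=> n; exact: fM.
have bg : bmf D g by split => //; exists M.
split=> //.
have H : (fun n => (\int[mu]_(x in D) (f n x)%:E)%E) @ \oo -->
         (\int[mu]_(x in D) (g x)%:E)%E.
  apply: (@dominated_cvg _ _ _ mu D mD (fun n x => (f n x)%:E) (fun x => (g x)%:E)
    (fun=> M%:E)) => //.
  - by move=> n; apply/measurable_EFinP.
  - by move=> x Dx; apply: cvg_EFin; [exact: nearW | exact: fg].
  - by apply: (@bmf_integrable (fun=> M)); exact: bmf_cst.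
have fin : (\int[mu]_(x in D) (g x)%:E)%E \is a fin_num.
  exact: integrable_fin_num (bmf_integrable bg).
by apply: fine_cvg; rewrite (fineK fin).
Unshelve. all: by end_near. Qed.

End integral.
End bounded_measurable.

(** * Signed sums over countably many branches *)

Section counting_sums.
Context {R : realType}.
Implicit Types (I : set nat) (F G : nat -> R).

(** Sums over branches are integrals against counting measure, so linearity, monotonicity and
    dominated convergence come from integration theory, for signed terms and infinitely many
    branches alike. *)
Definition csum I F : R := \int[@counting nat R]_(i in I) F i.

Definition csummable I F := (@counting nat R).-integrable I (EFin \o F).

Lemma integral_counting_esum I (f : nat -> \bar R) :
  (forall i, I i -> 0 <= f i)%E ->
  (\int[@counting nat R]_(i in I) f i = \esum_(i in I) f i)%E.
Proof.
move=> f0; have f0' k : (0 <= (f \_ I) k)%E.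
  by rewrite patchE; case: ifPn => // /set_mem; exact: f0.
rewrite integral_mkcond ge0_integral_count// nneseries_esumT//.
by rewrite [RHS]esum_mkcond.
Qed.

Lemma csummable_dom I (w F : nat -> R) (M D : R) :
  (\esum_(i in I) (w i)%:E <= D%:E)%E -> (forall i, I i -> 0 <= w i) ->
  (forall i, I i -> `|F i| <= M * w i) -> csummable I F.
Proof.
move=> wD w0 FM; apply/integrableP; split; first by [].
rewrite integral_counting_esum; last by move=> i _; exact: abse_ge0.
apply: (@le_lt_trans _ _ (\esum_(i in I) (`|M| * w i)%:E)%E).
  apply: le_esum => i Ii /=; rewrite lee_fin (le_trans (FM i Ii))//.
  by rewrite ler_wpM2r ?w0// ler_norm.
apply: (@le_lt_trans _ _ (`|M|%:E * D%:E)%E); last by rewrite -EFinM ltry.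
rewrite -integral_counting_esum; last first.
  by move=> i Ii; rewrite lee_fin mulr_ge0 ?w0.
under eq_integral do rewrite EFinM.
rewrite ge0_integralZl// lee_pmul ?lee_fin//.
  by apply: integral_ge0 => i Ii; rewrite lee_fin w0.
by rewrite integral_counting_esum// => i Ii; rewrite lee_fin w0.
Qed.

Lemma csumD I F G : csummable I F -> csummable I G ->
  csum I (fun i => F i + G i) = csum I F + csum I G.
Proof. by move=> sF sG; rewrite /csum RintegralD. Qed.

Lemma csumB I F G : csummable I F -> csummable I G ->
  csum I (fun i => F i - G i) = csum I F - csum I G.
Proof. by move=> sF sG; rewrite /csum RintegralB. Qed.

Lemma csumZ I (c : R) F : csummable I F ->
  csum I (fun i => c * F i) = c * csum I F.
Proof. by move=> sF; rewrite /csum RintegralZl. Qed.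

Lemma le_csum I F G : csummable I F -> csummable I G ->
  (forall i, I i -> F i <= G i) -> csum I F <= csum I G.
Proof. by move=> sF sG FG; apply: le_Rintegral. Qed.

Lemma eq_csum I F G : (forall i, I i -> F i = G i) -> csum I F = csum I G.
Proof. by move=> FG; apply: eq_Rintegral => i; rewrite inE; exact: FG. Qed.

Lemma csum_ge0 I F : (forall i, I i -> 0 <= F i) -> 0 <= csum I F.
Proof. by move=> F0; exact: Rintegral_ge0. Qed.

(** The right-hand side is the shape in which the transfer operator is defined; for absolutely
    summable terms it collapses to one signed sum, from which linearity follows. *)
Lemma csum_posneg I F : csummable I F ->
  csum I F = fine (\esum_(i in I) (Num.max (F i) 0)%:E)
           - fine (\esum_(i in I) (Num.max (- F i) 0)%:E).
Proof.
move=> sF; rewrite -!integral_counting_esum; try by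
  move=> i _; rewrite lee_fin le_max lexx orbT.
have [sp sn] : csummable I (fun i => Num.max (F i) 0) /\
               csummable I (fun i => Num.max (- F i) 0).
  split; apply: (le_integrable _ _ _ sF) => // i Ii /=; rewrite lee_fin.
    by case: (leP (F i) 0) => h; rewrite ?normr0.
  by case: (leP (- F i) 0) => h; rewrite ?normr0 ?normrN.
rewrite -[X in _ = X - _]/(csum I (fun i => Num.max (F i) 0)).
rewrite -[X in _ = _ - X]/(csum I (fun i => Num.max (- F i) 0)).
rewrite -csumB//; apply: eq_csum => i _.
by rewrite !maxEle; case: ifPn; case: ifPn; rewrite -?ltNge; lra.
Qed.

Lemma csum_weights_le I (w : nat -> R) (D : R) :
  (\esum_(i in I) (w i)%:E <= D%:E)%E -> (forall i, I i -> 0 <= w i) ->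
  csum I w <= D.
Proof.
move=> wD w0; rewrite /csum /Rintegral integral_counting_esum; last first.
  by move=> i Ii; rewrite lee_fin w0.
have h : (\esum_(i in I) (w i)%:E \is a fin_num)%E.
  rewrite ge0_fin_numE ?(le_lt_trans wD) ?ltry//.
  by apply: esum_ge0 => i Ii; rewrite lee_fin w0.
by rewrite -lee_fin fineK.
Qed.

Lemma csum_le_dom I (w F : nat -> R) (M D : R) :
  (\esum_(i in I) (w i)%:E <= D%:E)%E -> (forall i, I i -> 0 <= w i) ->
  0 <= M -> (forall i, I i -> `|F i| <= M * w i) -> `|csum I F| <= M * D.
Proof.
move=> wD w0 M0 FM.
have sF := csummable_dom wD w0 FM.
have sw : csummable I w.
  by apply: (csummable_dom (M := 1) wD w0) => i Ii; rewrite mul1r ger0_norm ?w0.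
rewrite (le_trans (le_normr_Rintegral _ sF))//.
apply: (@le_trans _ _ (M * csum I w)); last first.
  by rewrite ler_wpM2l// (csum_weights_le wD w0).
rewrite -csumZ//; apply: le_Rintegral => //.
- by apply: (csummable_dom (M := M) wD w0) => i Ii; rewrite normr_id FM.
- by apply: (csummable_dom (M := M) wD w0) => i Ii; rewrite ger0_norm// mulr_ge0 ?w0.
Qed.

Lemma csum_dct I (w : nat -> R) (F : nat -> nat -> R) (G : nat -> R) (M D : R) :
  (\esum_(i in I) (w i)%:E <= D%:E)%E -> (forall i, I i -> 0 <= w i) ->
  (forall n i, I i -> `|F n i| <= M * w i) ->
  (forall i, I i -> F^~ i @ \oo --> G i) ->
  (fun n => csum I (F n)) @ \oo --> csum I G.
Proof.
move=> wD w0 FM FG.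
have GM i : I i -> `|G i| <= M * w i.
  move=> Ii; have h : (fun n => `|F n i|) @ \oo --> `|G i|.
    by apply: cvg_norm; exact: FG.
  rewrite -(cvg_lim (@Rhausdorff R) h); apply: limr_le.
    by apply/cvg_ex; eexists; exact: h.
  by near=> n; exact: FM.
have sG := csummable_dom wD w0 GM.
have H : (fun n => (\int[@counting nat R]_(x in I) (F n x)%:E)%E) @ \oo -->
         (\int[@counting nat R]_(x in I) (G x)%:E)%E.
  apply: (@dominated_cvg _ _ _ (@counting nat R) I _ (fun n x => (F n x)%:E)
    (fun x => (G x)%:E) (fun i => (M * w i)%:E)) => //.
  - by move=> i Ii; apply: cvg_EFin; [exact: nearW | exact: FG].
  - apply: (csummable_dom (M := `|M|) wD w0) => i Ii.
    by rewrite normrM (ger0_norm (w0 _ Ii)).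
have fin : (\int[@counting nat R]_(x in I) (G x)%:E)%E \is a fin_num.
  exact: integrable_fin_num sG.
by apply: fine_cvg; rewrite (fineK fin).
Unshelve. all: by end_near. Qed.

Lemma csum_delta I (n : nat) (c : R) :
  csum I (fun i => if i == n then c else 0) = if n \in I then c else 0.
Proof.
have -> : csum I (fun i => if i == n then c else 0) =
    \int[@counting nat R]_(i in I `&` [set n]) (fun=> c) i.
  rewrite /csum Rintegral_mkcondr; apply: eq_Rintegral => i _.
  rewrite patchE; case: eqP => [->|ni]; first by rewrite mem_set.
  by rewrite memNset.
rewrite Rintegral_cst//; case: ifPn => nI.
  have -> : I `&` [set n] = [set n].
    by apply/seteqP; split=> [x []//|x ->]; split => //; exact: set_mem.
  by rewrite /= /counting asboolT//= fset_set1 finmap.cardfs1 mulr1.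
have -> : I `&` [set n] = set0.
  by apply/seteqP; split=> // x [Ix xn]; move: nI; rewrite notin_setE; rewrite -xn.
by rewrite measure0 mulr0.
Qed.

(** Turns a truncated branch sum into a finite one. With [csum_dct] it exhibits L g as a pointwise
    limit of finite sums, and for finitely many branches it gives L g itself. *)
Lemma csum_trunc I F n : csummable I F ->
  csum I (fun i => if (i < n)%N then F i else 0) =
  \sum_(i < n) (if (i : nat) \in I then F i else 0).
Proof.
move=> sF; elim: n => [|n ih].
  rewrite big_ord0 (_ : csum I _ = csum I (fun=> 0 * 0)).
    by rewrite mul0r /csum /Rintegral integral0.
  by apply: eq_csum => i _; rewrite mulr0.
rewrite big_ord_recr/= -ih -csum_delta -csumD.
- apply: eq_csum => i _; rewrite ltnS leq_eqVlt.
  case: eqP => [->|_] /=; first by rewrite ltnn add0r.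
  by rewrite addr0.
- apply: (le_integrable _ _ _ sF) => // i Ii /=.
  by rewrite lee_fin; case: ifPn => //; rewrite normr0.
- apply: (le_integrable _ _ _ sF) => // i Ii /=.
  by rewrite lee_fin; case: eqP => [->//|]; rewrite normr0.
Qed.

End counting_sums.

(** * Hoelder functions and transfer operators *)

Lemma powR_le1 (R : realType) (x a : R) : 0 <= x -> x <= 1 -> 0 <= a -> x `^ a <= 1.
Proof.
move=> x0 x1 a0; have h : 1 `^ a = 1 :> R by rewrite powR1.
by rewrite -h ge0_ler_powR ?nnegrE.
Qed.

(** * Measurability in a metric space *)

Section metric_measurability.
Context d {X : measurableType d} {R : realType}.
Variables (dist : X -> X -> R) (alpha : R).
Hypothesis dist_metric : is_metric dist.
Hypothesis borel : forall A : set X, measurable A <-> <<s dopen dist >> A.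
Hypothesis alpha_gt0 : 0 < alpha.

Let dist_ge0 x y : 0 <= dist x y. Proof. by case: dist_metric. Qed.
Let dist_xx x : dist x x = 0. Proof. by case: dist_metric => _ h _ _; apply/h. Qed.
Let dist_tri x y z : dist x z <= dist x y + dist y z.
Proof. by case: dist_metric. Qed.

Lemma dopen_measurable (A : set X) : dopen dist A -> measurable A.
Proof. by move=> oA; apply/borel; exact: sub_sigma_algebra. Qed.

Lemma dball_open x r : dopen dist (dball dist x r).
Proof.
move=> y xy; exists (r - dist x y); first by rewrite subr_gt0.
move=> z yz; rewrite /dball/= (le_lt_trans (dist_tri x y z))//.
by move: yz; rewrite /dball/=; lra.
Qed.

(** A fibre need not be open, so only relative openness is available. The union V of all balls whose
    trace on D lies in A is open, whatever their number, and A is the trace of V. *)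
Lemma rel_open_measurable (D A : set X) : measurable D -> A `<=` D ->
  (forall x, A x -> exists2 r : R, 0 < r & D `&` dball dist x r `<=` A) ->
  measurable A.
Proof.
move=> mD AD opA.
pose V := [set z | exists x r, [/\ D `&` dball dist x r `<=` A &
                                  dball dist x r z]].
have -> : A = D `&` V.
  apply/seteqP; split=> x.
    move=> Ax; split; first exact: AD.
    have [r r0 h] := opA x Ax; exists x, r; split => //.
    by rewrite /dball/= dist_xx.
  by move=> [Dx [y [r [h yx]]]]; apply: h.
apply: measurableI => //; apply: dopen_measurable => z [x [r [h xz]]].
have [e e0 he] := @dball_open x r z xz.
by exists e => // t zt; exists x, r; split => //; exact: he.
Qed.

Lemma Rmeasurable_continuous (D : set X) (f : X -> R) : measurable D ->
  (forall x e, D x -> 0 < e -> exists2 r : R, 0 < r &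
     forall x', D x' -> dist x x' < r -> `|f x - f x'| < e) ->
  measurable_fun D f.
Proof.
move=> mD cf; apply: (measurability _ (RGenOInfty.measurableE R)) => //.
move=> _ [_ [a ->] <-].
apply: (rel_open_measurable mD); first exact: subIsetl.
move=> x [Dx]; rewrite /= in_itv/= andbT => ax.
have [r r0 hr] := cf x (f x - a) Dx ltac:(rewrite subr_gt0//).
exists r => // z [Dz xz]; split => //=; rewrite in_itv/= andbT.
by have := hr z Dz xz; rewrite ltr_norml => /andP[_]; lra.
Qed.

Lemma Xmeasurable_lipschitz (D : set X) (f : X -> X) (l : R) : measurable D ->
  (forall x x', D x -> D x' -> dist (f x) (f x') <= l * dist x x') ->
  measurable_fun D f.
Proof.
move=> mD lf; apply: (measurability (dopen dist)).
  by apply/seteqP; split => A /borel.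
move=> _ [A oA <-]; apply: (rel_open_measurable mD); first exact: subIsetl.
move=> x [Dx Afx]; have [e e0 he] := oA _ Afx.
exists (e / (`|l| + 1)); first by rewrite divr_gt0// ltr_wpDl.
move=> z [Dz xz]; split => //; apply: he; rewrite /dball/=.
apply: le_lt_trans (lf x z Dx Dz) _.
apply: (@le_lt_trans _ _ (`|l| * dist x z)).
  by rewrite ler_wpM2r// ler_norm.
move: xz; rewrite /dball/= ltr_pdivlMr ?ltr_wpDl//; apply: le_lt_trans.
by rewrite mulrC ler_wpM2l// lerDl.
Qed.

Lemma powR_lt_inv (x e : R) : 0 <= x -> 0 < e ->
  x < e `^ alpha^-1 -> x `^ alpha < e.
Proof.
move=> x0 e0 xe; rewrite -[ltRHS](powRr1 (ltW e0)).
rewrite -(mulVf (lt0r_neq0 alpha_gt0)) powRrM.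
by rewrite gt0_ltr_powR// nnegrE ?powR_ge0.
Qed.

Lemma holder_measurable (D : set X) (f : X -> R) (C : R) : measurable D ->
  (forall x x', D x -> D x' -> `|f x - f x'| <= C * dist x x' `^ alpha) ->
  measurable_fun D f.
Proof.
move=> mD hf; apply: Rmeasurable_continuous => // x e Dx e0.
have C0 : 0 < `|C| + 1 by rewrite ltr_wpDl.
exists ((e / (`|C| + 1)) `^ alpha^-1); first by rewrite powR_gt0 ?divr_gt0.
move=> z Dz /(powR_lt_inv (dist_ge0 x z)); rewrite divr_gt0// => /(_ isT).
rewrite ltr_pdivlMr// => h; apply: le_lt_trans (hf _ _ Dx Dz) _.
apply: le_lt_trans h; rewrite mulrC ler_wpM2l ?powR_ge0//.
by rewrite (le_trans (ler_norm _))// lerDl.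
Qed.

Lemma hsemi_ge0 (A : set X) (g : X -> R) : (0 <= hsemi dist alpha A g)%E.
Proof. by apply: ereal_sup_ubound; left. Qed.

Lemma hv_ge0 (A : set X) (g : X -> R) : 0 <= hv dist alpha A g.
Proof. by rewrite /hv fine_ge0// hsemi_ge0. Qed.

Lemma hvP (A : set X) (g : X -> R) : (hsemi dist alpha A g < +oo)%E ->
  forall x x', A x -> A x' ->
    `|g x - g x'| <= hv dist alpha A g * dist x x' `^ alpha.
Proof.
move=> gfin x x' Ax Ax'; have [->|xx'] := pselect (x = x').
  by rewrite subrr normr0 mulr_ge0 ?powR_ge0 ?hv_ge0.
have d0 : 0 < dist x x'.
  rewrite lt_def dist_ge0 andbT; apply/eqP => h; apply: xx'.
  by case: dist_metric => _ h' _ _; apply/h'.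
rewrite -ler_pdivrMr ?powR_gt0// -lee_fin /hv fineK; last first.
  by rewrite ge0_fin_numE// hsemi_ge0.
by apply: ereal_sup_ubound; right; exists (x, x').
Qed.

Lemma hsemi_le (A : set X) (g : X -> R) (C : R) : 0 <= C ->
  (forall x x', A x -> A x' -> `|g x - g x'| <= C * dist x x' `^ alpha) ->
  (hsemi dist alpha A g <= C%:E)%E.
Proof.
move=> C0 hC; apply: ge_ereal_sup => _ [->|[[x x'] /= [Ax Ax' xx'] <-]].
  by rewrite lee_fin.
have d0 : 0 < dist x x'.
  rewrite lt_def dist_ge0 andbT; apply/eqP => h; apply: xx'.
  by case: dist_metric => _ h' _ _; apply/h'.
by rewrite lee_fin ler_pdivrMr ?powR_gt0// hC.
Qed.

Lemma holder_funP (A : set X) (g : X -> R) : holder_fun dist alpha A g <->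
  (exists M : R, forall x, A x -> `|g x| <= M) /\
  (exists2 C : R, 0 <= C & forall x x', A x -> A x' ->
      `|g x - g x'| <= C * dist x x' `^ alpha).
Proof.
split=> -[bg hg]; split => //.
  by exists (hv dist alpha A g); [exact: hv_ge0 | exact: hvP].
by case: hg => C C0 hC; apply: le_lt_trans (hsemi_le C0 hC) (ltry _).
Qed.

Lemma holder_bmf (A : set X) (g : X -> R) : measurable A ->
  holder_fun dist alpha A g -> bmf A g.
Proof.
move=> mA /holder_funP[bg [C _ hC]]; split => //.
exact: holder_measurable hC.
Qed.

End metric_measurability.

(** * Transfer operators on one fibre *)

Section transfer_operator.
Context d {X : measurableType d} {R : realType}.

(** One-fibre version of [Lop], convertible to it when [pre] is [preim E T w] and [wt] is exp phi_w,
    so that lemmas about a single step apply to the cocycle as they stand. *)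
Definition top (pre : X -> set X) (wt g : X -> R) (x : X) : R :=
  fine (\esum_(y in pre x) (Num.max (wt y * g y) 0)%:E)
  - fine (\esum_(y in pre x) (Num.max (- (wt y * g y)) 0)%:E).

Variables (dist : X -> X -> R) (alpha : R).
Hypothesis dist_metric : is_metric dist.
Hypothesis dist_le1 : forall x y, dist x y <= 1.
Hypothesis borel : forall A : set X, measurable A <-> <<s dopen dist >> A.
Hypothesis alpha_gt0 : 0 < alpha.

(** Common part of the two settings. The Lipschitz constant [l] of the inverse branches may exceed
    1, as in setting B: the structure serves the measurability and regularity of L g, and
    contraction enters only with the cones. *)
Definition branches (E E' : set X) (pre : X -> set X) (ph : X -> R)
    (I : set nat) (y : nat -> X -> X) (l H Dw : R) :=
  [/\ forall x z, E' x -> pre x z -> E z,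
      forall x, E' x -> [/\ forall i, I i -> pre x (y i x),
          forall z, pre x z -> exists2 i, I i & y i x = z &
          forall i j, I i -> I j -> y i x = y j x -> i = j],
      forall x x', E' x -> E' x' -> forall i, I i ->
          dist (y i x) (y i x') <= l * dist x x' /\
          `|ph (y i x) - ph (y i x')| <= H * dist x x' `^ alpha &
      forall x, E' x -> (\esum_(z in pre x) (expR (ph z))%:E <= Dw%:E)%E].

Variables (E E' : set X) (pre : X -> set X) (ph : X -> R)
    (I : set nat) (y : nat -> X -> X) (l H Dw : R).
Hypothesis br : branches E E' pre ph I y l H Dw.
Hypotheses (mE : measurable E) (mE' : measurable E').

Let wt z := expR (ph z).
Local Notation L := (top pre wt).
Local Notation term g x := (fun i => wt (y i x) * g (y i x)).

Definition bdd (g : X -> R) := exists M : R, forall x, E x -> `|g x| <= M.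

Lemma branch_E x i : E' x -> I i -> E (y i x).
Proof. by case: br => h1 h2 _ _ E'x Ii; apply: (h1 x) => //; case: (h2 x E'x) => h _ _; exact: h. Qed.

Lemma branch_reindex x (a : X -> \bar R) : E' x ->
  (\esum_(z in pre x) a z = \esum_(i in I) a (y i x))%E.
Proof.
move=> E'x; case: br => _ /(_ _ E'x)[h1 h2 h3] _ _.
rewrite (reindex_esum I (pre x) (fun i => y i x))//; split.
- by move=> i Ii; exact: h1.
- by move=> i j /set_mem Ii /set_mem Ij; exact: h3.
- by move=> z /h2[i Ii <-]; exists i.
Qed.

Lemma branch_weights x : E' x ->
  (\esum_(i in I) (wt (y i x))%:E <= Dw%:E)%E.
Proof.
by move=> E'x; rewrite -(branch_reindex (fun z => (wt z)%:E))//; case: br => _ _ _; exact.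
Qed.

Lemma wt_ge0 z : 0 <= wt z. Proof. exact: expR_ge0. Qed.

Lemma term_le g x (M : R) : E' x -> (forall x, E x -> `|g x| <= M) ->
  forall i, I i -> `|term g x i| <= M * wt (y i x).
Proof.
move=> E'x gM i Ii; rewrite normrM ger0_norm ?wt_ge0// mulrC ler_wpM2r ?wt_ge0//.
exact/gM/branch_E.
Qed.

Lemma term_summable g x : E' x -> bdd g -> csummable I (term g x).
Proof.
move=> E'x [M gM]; apply: (csummable_dom (branch_weights E'x)) => [i _|].
  exact: wt_ge0.
exact: term_le gM.
Qed.

Lemma topE g x : E' x -> bdd g -> L g x = csum I (term g x).
Proof.
move=> E'x bg; rewrite csum_posneg; last exact: term_summable.
rewrite /top.
rewrite (branch_reindex (fun z => (Num.max (wt z * g z) 0)%:E))//.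
by rewrite (branch_reindex (fun z => (Num.max (- (wt z * g z)) 0)%:E)).
Qed.

Lemma eq_top f g x : E' x -> (forall z, E z -> f z = g z) -> L f x = L g x.
Proof.
move=> E'x fg; rewrite /top.
have h z : pre x z -> f z = g z.
  by move=> xz; apply: fg; case: br => h _ _ _; exact: (h x).
by congr (fine _ - fine _); apply: eq_esum => z /h ->.
Qed.

Lemma bddD f g : bdd f -> bdd g -> bdd (fun x => f x + g x).
Proof.
move=> [M fM] [N gN]; exists (M + N) => x Ex.
by rewrite (le_trans (ler_normD _ _))// lerD ?fM ?gN.
Qed.

Lemma bddZ c f : bdd f -> bdd (fun x => c * f x).
Proof.
move=> [M fM]; exists (`|c| * M) => x Ex.
by rewrite normrM ler_wpM2l ?fM.
Qed.

Lemma bmf_bdd f : bmf E f -> bdd f. Proof. by case. Qed.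

Lemma topD f g x : E' x -> bdd f -> bdd g ->
  L (fun z => f z + g z) x = L f x + L g x.
Proof.
move=> E'x bf bg; rewrite !topE//; last exact: bddD.
rewrite -csumD; try exact: term_summable.
by apply: eq_csum => i _; rewrite mulrDr.
Qed.

Lemma topZ c f x : E' x -> bdd f -> L (fun z => c * f z) x = c * L f x.
Proof.
move=> E'x bf; rewrite !topE//; last exact: bddZ.
rewrite -csumZ; last exact: term_summable.
by apply: eq_csum => i _; rewrite mulrCA.
Qed.

Lemma topB f g x : E' x -> bdd f -> bdd g ->
  L (fun z => f z - g z) x = L f x - L g x.
Proof.
move=> E'x bf bg; rewrite -[in RHS]mulN1r -topZ// -topD//; last exact: bddZ.
by apply: eq_top => // z _; rewrite mulN1r.
Qed.

Lemma top_ge0 f x : E' x -> bdd f -> (forall z, E z -> 0 <= f z) -> 0 <= L f x.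
Proof.
move=> E'x bf f0; rewrite topE//; apply: csum_ge0 => i Ii.
by rewrite mulr_ge0 ?wt_ge0 ?f0//; exact: branch_E.
Qed.

Lemma le_top f g x : E' x -> bdd f -> bdd g ->
  (forall z, E z -> f z <= g z) -> L f x <= L g x.
Proof.
move=> E'x bf bg fg; rewrite !topE//; apply: le_csum; try exact: term_summable.
by move=> i Ii; rewrite ler_wpM2l ?wt_ge0 ?fg//; exact: branch_E.
Qed.

Lemma top_norm_le f x (M : R) : E' x -> 0 <= M ->
  (forall z, E z -> `|f z| <= M) -> `|L f x| <= M * Dw.
Proof.
move=> E'x M0 fM; rewrite topE//; last by exists M.
apply: (csum_le_dom (branch_weights E'x)) => // [i _|]; first exact: wt_ge0.
exact: term_le.
Qed.

Lemma top_comp (T : X -> X) k f x : E' x -> (forall z, pre x z -> T z = x) ->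
  bdd f -> L (fun z => k (T z) * f z) x = k x * L f x.
Proof.
move=> E'x Tx bf; rewrite -topZ//.
have h z : pre x z -> k (T z) = k x by move=> /Tx ->.
by rewrite /top; congr (fine _ - fine _); apply: eq_esum => z /h ->.
Qed.

Lemma top_dct (f : nat -> X -> R) g (M : R) x : E' x ->
  (forall n z, E z -> `|f n z| <= M) ->
  (forall z, E z -> f^~ z @ \oo --> g z) -> bdd g ->
  (fun n => L (f n) x) @ \oo --> L g x.
Proof.
move=> E'x fM fg bg; rewrite topE//.
have -> : (fun n => L (f n) x) = (fun n => csum I (term (f n) x)).
  by apply/funext => n; rewrite topE//; exists M => z; exact: fM.
apply: (csum_dct (branch_weights E'x)) => [i _|n i Ii|i Ii].
- exact: wt_ge0.
- exact: term_le (fM n) i Ii.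
- by apply: cvgMr; apply: fg; exact: branch_E.
Qed.

Lemma measurable_branch i : I i -> measurable_fun E' (y i).
Proof.
move=> Ii; apply: (Xmeasurable_lipschitz dist_metric borel mE' (l := l)).
by move=> x x' E'x E'x'; case: br => _ _ /(_ x x' E'x E'x' i Ii)[].
Qed.

Lemma measurable_branch_weight i : I i -> measurable_fun E' (fun x => wt (y i x)).
Proof.
move=> Ii; apply: (measurableT_comp (f := expR) (g := fun x => ph (y i x))) => //.
apply: (holder_measurable dist_metric borel alpha_gt0 mE' (C := H)).
by move=> x x' E'x E'x'; case: br => _ _ /(_ x x' E'x E'x' i Ii)[].
Qed.

(** Each branch is Lipschitz and each weight Hoelder along it, so every term is measurable in x; the
    sum is a limit of finite partial sums, dominated by the weights. *)
Lemma bmf_top g : bmf E g -> bmf E' (L g).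
Proof.
move=> [mg bg]; split; last first.
  case: bg => M gM; exists (`|M| * Dw) => x E'x; apply: top_norm_le => // z Ez.
  exact: le_trans (gM z Ez) (ler_norm _).
pose S n x := \sum_(i < n) (if (i : nat) \in I then term g x i else 0).
apply: (@measurable_fun_cvg _ _ _ _ S) => // [n|x E'x].
  apply: (measurable_sum _ (h := fun (i : 'I_n) x => if (i : nat) \in I then term g x i else 0)) => i.
  case: (boolP ((i : nat) \in I)) => [/set_mem Ii|_]; last exact: measurable_cst.
  apply: measurable_funM; first exact: measurable_branch_weight.
  apply: (measurable_comp mE _ mg); last exact: measurable_branch.
  by move=> _ [x E'x <-]; exact: branch_E.
rewrite topE//.
have -> : S^~ x = fun n => csum I (fun i => if (i < n)%N then term g x i else 0).
  by apply/funext => n; rewrite csum_trunc//; exact: term_summable.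
case: bg => M gM; apply: (csum_dct (branch_weights E'x) (M := `|M|)) => [i _|n i Ii|i Ii].
- exact: wt_ge0.
- case: ifPn => _; last by rewrite normr0 mulr_ge0 ?wt_ge0.
  apply: (term_le (g := g)) => // z Ez; exact: le_trans (gM z Ez) (ler_norm _).
- apply: cvg_near_cst; exists i.+1 => // n /= ni.
  by rewrite ni.
Qed.

Lemma expR_diff_le (a b t : R) : `|a - b| <= t -> `|expR a - expR b| <= expR b * (t * expR t).
Proof.
move=> ab; have t0 : 0 <= t by exact: le_trans (normr_ge0 _) ab.
have -> : expR a - expR b = expR b * (expR (a - b) - 1).
  by rewrite mulrBr mulr1 -expRD (addrC b) subrK.
rewrite normrM (ger0_norm (expR_ge0 _)) ler_wpM2l ?expR_ge0//.
move: ab; rewrite ler_norml => /andP[h1 h2].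
have e1 := expR_ge1Dx (a - b).
have e2 : expR (a - b) <= expR t by rewrite ler_expR.
have e3 : expR t - 1 <= t * expR t.
  have := expR_ge1Dx (- t); rewrite expRN => h.
  have := ler_wpM2r (expR_ge0 t) h.
  by rewrite mulVf ?gt_eqF ?expR_gt0//; lra.
have e4 : t <= t * expR t.
  by rewrite ler_peMr// -expR0 ler_expR.
rewrite ler_norml; apply/andP; split; lra.
Qed.

Lemma holder_top g : holder_fun dist alpha E g -> holder_fun dist alpha E' (L g).
Proof.
move=> hg; have bg := bmf_bdd (holder_bmf dist_metric borel alpha_gt0 mE hg).
have [_ bLg] := bmf_top (holder_bmf dist_metric borel alpha_gt0 mE hg).
move: hg => /(holder_funP alpha dist_metric)[[M gM] [C C0 hC]].
apply/(holder_funP alpha dist_metric); split => //.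
(* [branches] does not fix the signs of [H] and [l], nor does the bound on g fix that of [M];
   absolute values make the constants below nonnegative. *)
pose H' : R := `|H|; pose M' : R := `|M|; pose K : R := `|l| `^ alpha.
have H0 : 0 <= H' := normr_ge0 _.
have M0 : 0 <= M' := normr_ge0 _.
have K0 : 0 <= K by exact: powR_ge0.
have gM' z : E z -> `|g z| <= M' by move=> /gM h; exact: le_trans h (ler_norm _).
exists (`|(H' * expR H' * M' + C * K * expR H') * Dw|) => // x x' E'x E'x'.
set r := dist x x' `^ alpha.
have d0 : 0 <= dist x x' by case: dist_metric.
have r0 : 0 <= r by exact: powR_ge0.
have r1 : r <= 1.
  by apply: powR_le1 => //; exact: ltW.
rewrite !topE// -csumB; try exact: term_summable.
apply: (@le_trans _ _ (((H' * expR H' * M' + C * K * expR H') * r) * Dw)); last first.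
  by rewrite mulrAC ler_wpM2r// ler_norm.
apply: (csum_le_dom (branch_weights E'x')) => [i _||i Ii].
- exact: wt_ge0.
- by rewrite !mulr_ge0// addr_ge0// !mulr_ge0 ?expR_ge0.
have [hl hH] : dist (y i x) (y i x') <= l * dist x x' /\
    `|ph (y i x) - ph (y i x')| <= H * r by case: br => _ _ /(_ x x' E'x E'x' i Ii).
have hH' : `|ph (y i x) - ph (y i x')| <= H' * r.
  by apply: le_trans hH _; rewrite ler_wpM2r// ler_norm.
have w1 := expR_diff_le hH'.
have eHr : expR (H' * r) <= expR H' by rewrite ler_expR ler_piMr.
have g1 : `|g (y i x) - g (y i x')| <= C * K * r.
  apply: le_trans (hC _ _ (branch_E E'x Ii) (branch_E E'x' Ii)) _.
  rewrite -mulrA ler_wpM2l// -powRM// ge0_ler_powR ?(ltW alpha_gt0)// ?nnegrE.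
  - by case: dist_metric.
  - by rewrite mulr_ge0.
  - by apply: le_trans hl _; rewrite ler_wpM2r// ler_norm.
have w2 : wt (y i x) <= wt (y i x') * expR H'.
  rewrite /wt -expRD ler_expR; move: hH'; rewrite ler_norml => /andP[_ h].
  have : H' * r <= H' by rewrite ler_piMr.
  lra.
have -> : wt (y i x) * g (y i x) - wt (y i x') * g (y i x') =
  (wt (y i x) - wt (y i x')) * g (y i x') + wt (y i x) * (g (y i x) - g (y i x')).
  by ring.
apply: le_trans (ler_normD _ _) _; rewrite !normrM.
have a1 : `|wt (y i x) - wt (y i x')| * `|g (y i x')| <=
    (wt (y i x') * (H' * r * expR H')) * M'.
  apply: ler_pM => //; last exact/gM'/branch_E.
  apply: le_trans w1 _; rewrite ler_wpM2l ?expR_ge0//.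
  by rewrite ler_wpM2l// mulr_ge0.
have a2 : `|wt (y i x)| * `|g (y i x) - g (y i x')| <=
    (wt (y i x') * expR H') * (C * K * r).
  by apply: ler_pM => //; rewrite ger0_norm ?wt_ge0.
apply: le_trans (lerD a1 a2) _.
by rewrite le_eqVlt; apply/orP; left; apply/eqP; ring.
Qed.

End transfer_operator.

Import HBNNSimple.

(** * Functional monotone class theorem *)

Section functional_monotone_class.
Context d {X : measurableType d} {R : realType}.
Variables (dist : X -> X -> R) (alpha : R).
Hypothesis dist_metric : is_metric dist.
Hypothesis dist_le1 : forall x y, dist x y <= 1.
Hypothesis borel : forall A : set X, measurable A <-> <<s dopen dist >> A.
Hypothesis alpha_gt0 : 0 < alpha.
Hypothesis alpha_le1 : alpha <= 1.

Variables (E : set X) (K : (X -> R) -> Prop).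
Hypothesis mE : measurable E.
Hypothesis KH : forall g, holder_fun dist alpha E g -> K g.
Hypothesis KD : forall f g, bmf E f -> bmf E g -> K f -> K g ->
  K (fun x => f x + g x).
Hypothesis KZ : forall c f, bmf E f -> K f -> K (fun x => c * f x).
Hypothesis Klim : forall (f : nat -> X -> R) (g : X -> R) (M : R), (forall n, bmf E (f n)) ->
  (forall n x, E x -> `|f n x| <= M) -> (forall x, E x -> f^~ x @ \oo --> g x) ->
  (forall n, K (f n)) -> K g.

(** [Klim] along a constant sequence: limits are tested on E only, so membership in K depends only
    on values on E. *)
Lemma monotone_class_eq f g : bmf E f -> (forall x, E x -> f x = g x) -> K f -> K g.
Proof.
move=> bf fg Kf; have [_ [M fM]] := bf.
apply: (Klim (f := fun=> f) (M := M)) => // x Ex.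
by rewrite fg//; exact: cvg_cst.
Qed.

Lemma monotone_class_cst c : K (fun=> c).
Proof.
apply: KH; apply/(holder_funP alpha dist_metric); split; first by exists `|c|.
by exists 0 => // x x' _ _; rewrite subrr normr0 mul0r.
Qed.

Let dist_ge0 x y : 0 <= dist x y. Proof. by case: dist_metric. Qed.

Let gap (U : set X) x := inf [set dist x z | z in ~` U].

Let gap_lip U x x' : (~` U) !=set0 -> gap U x <= gap U x' + dist x x'.
Proof.
move=> [z0 Uz0]; rewrite -lerBlDr; apply: lb_le_inf.
  by exists (dist x' z0); exists z0.
move=> _ [z Uz <-]; rewrite lerBlDr addrC.
apply: le_trans (_ : dist x z <= _).
  by apply: ge_inf; [exists 0 => _ [t _ <-] | exists z].
by case: dist_metric => _ _ _; apply.
Qed.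

Let gap_ge0 U x : (~` U) !=set0 -> 0 <= gap U x.
Proof.
move=> [z0 Uz0]; apply: lb_le_inf; first by exists (dist x z0); exists z0.
by move=> _ [z _ <-].
Qed.

(** With [gap] the distance to the complement, the functions min (1, n gap) are Lipschitz and
    increase to the indicator of U. They are Hoelder because distances are at most 1 and alpha <= 1.
    If the complement is empty the indicator is the constant 1. *)
Lemma monotone_class_open U : dopen dist U -> K (\1_U).
Proof.
move=> oU; have mU := dopen_measurable borel oU.
have [[z0 Uz0]|] := pselect ((~` U) !=set0); last first.
  move=> /set0P/negP; rewrite negbK => /eqP UT.
  apply: (monotone_class_eq (f := fun=> 1)); [exact: bmf_cst| |exact: monotone_class_cst].
  move=> x _; rewrite indicE mem_set//; apply: contrapT => Ux.
  by have : (~` U) x by []; rewrite UT.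
pose f n x := Num.min 1 (n%:R * gap U x).
have U0 : ~` U !=set0 by exists z0.
have f0 n x : 0 <= f n x by rewrite /f le_min ler01 mulr_ge0// gap_ge0.
have f1 n x : f n x <= 1 by rewrite /f ge_min lexx.
have flip n x x' : f n x <= f n x' + n%:R * dist x x'.
  rewrite /f addrC -lerBlDl le_min !lerBlDl; apply/andP; split.
    by rewrite ge_min; apply/orP; left; rewrite lerDr mulr_ge0.
  rewrite ge_min; apply/orP; right.
  by rewrite addrC -mulrDr ler_wpM2l// gap_lip.
have fH n : holder_fun dist alpha E (f n).
  apply/(holder_funP alpha dist_metric); split.
    by exists 1 => x _; rewrite ger0_norm.
  exists n%:R => // x x' _ _.
  apply: (@le_trans _ _ (n%:R * dist x x')).
    have h1 := flip n x x'; have h2 := flip n x' x.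
    have ds : dist x' x = dist x x' by case: dist_metric.
    by rewrite ds in h2; rewrite ler_norml; apply/andP; split; lra.
  rewrite ler_wpM2l//; have [->|dn0] := eqVneq (dist x x') 0.
    by rewrite powR_ge0.
  rewrite -[leLHS](powRr1 (dist_ge0 _ _)).
  by apply: ger_powR => //; rewrite lt_def dn0 dist_ge0 dist_le1.
apply: (Klim (f := f) (M := 1)) => [n|n x _|x Ex|n].
- exact: holder_bmf (fH n).
- by rewrite ger0_norm.
- rewrite indicE; have [/set_mem Ux|/negP Ux] := boolP (x \in U).
    have [r r0 hr] := oU x Ux.
    have gr : r <= gap U x.
      apply: lb_le_inf; first by exists (dist x z0); exists z0.
      move=> _ [z Uz <-]; rewrite leNgt; apply/negP => xz.
      by apply: Uz; apply: hr.
    apply: cvg_near_cst; exists (Num.truncn r^-1).+1 => // n /= nr.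
    rewrite /f; apply/min_idPl.
    have h : r^-1 <= n%:R.
      apply: le_trans (ltW (truncnS_gt _)) _; by rewrite ler_nat.
    apply: le_trans (ler_pM _ _ h gr); rewrite ?invr_ge0 ?(ltW r0)//.
    by rewrite mulVf ?gt_eqF.
  have -> : f^~ x = fun=> 0.
    apply/funext => n; rewrite /f.
    have -> : gap U x = 0.
      apply/eqP; rewrite eq_le gap_ge0// andbT.
      have dx : dist x x = 0 by case: dist_metric => _ h _ _; apply/h.
      rewrite -[leRHS]dx; apply: ge_inf; first by exists 0 => _ [t _ <-].
      by exists x => // Ux'; apply: Ux; rewrite mem_set.
    by rewrite mulr0; apply/min_idPr.
  exact: cvg_cst.
- exact: KH.
Qed.

Lemma monotone_class_indic A : measurable A -> K (\1_A).
Proof.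
have borelE : measurable = <<s dopen dist >> :> set (set X).
  by apply/seteqP; split => B /borel.
move=> /borel; apply: (dynkin_induction (P := fun A => K (\1_A))) => //.
- move=> A1 A2 o1 o2 x [x1 x2].
  have [r1 r10 h1] := o1 x x1; have [r2 r20 h2] := o2 x x2.
  exists (Num.min r1 r2); first by rewrite lt_min r10.
  move=> z; rewrite /dball/= lt_min => /andP[z1 z2].
  by split; [apply: h1 | apply: h2].
- apply: (monotone_class_eq (f := fun=> 1)); [exact: bmf_cst| |exact: monotone_class_cst].
  by move=> x _; rewrite indicT.
- by move=> U; exact: monotone_class_open.
- move=> S mS KS.
  apply: (monotone_class_eq (f := fun x => 1 + (-1) * \1_S x)).
  + apply: bmfD; [exact: bmf_cst|apply: bmfZ; exact: bmf_indic].
  + move=> x _; rewrite !indicE in_setC; case: (x \in S) => /=; lra.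
  + apply: KD; [exact: bmf_cst|apply: bmfZ; exact: bmf_indic|exact: monotone_class_cst|].
    by apply: KZ => //; exact: bmf_indic.
move=> F mF tF KF.
pose B n := \bigcup_(i in `I_n) F i.
have mA n : measurable (B n) by apply: bigcup_measurable.
apply: (Klim (f := fun n => \1_(B n)) (M := 1)) => [n|n x _|x _|n].
- exact: bmf_indic.
- by rewrite indicE; case: (_ \in _); rewrite ?normr1 ?normr0.
- rewrite indicE; have [/set_mem[k _ Fk]|/negP h] := boolP (x \in \bigcup_k F k).
    apply: cvg_near_cst; exists k.+1 => // n /= kn.
    by rewrite indicE mem_set//; exists k.
  have -> : (fun n => \1_(B n) x) = fun=> 0 :> R.
    apply/funext => n; rewrite indicE memNset// => -[k _ Fk].
    by apply: h; rewrite mem_set//; exists k.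
  exact: cvg_cst.
- elim: n => [|n ih].
    apply: (monotone_class_eq (f := fun=> 0)); [exact: bmf_cst| |exact: monotone_class_cst].
    by move=> x _; rewrite indicE memNset// => -[].
  apply: (monotone_class_eq (f := fun x => \1_(B n) x + \1_(F n) x)).
  + by apply: bmfD; exact: bmf_indic.
  + move=> x _; rewrite !indicE.
    have -> : B n.+1 = B n `|` F n.
      apply/seteqP; split=> z.
        move=> [k /=]; rewrite ltnS leq_eqVlt => /orP[/eqP ->|kn] Fk; first by right.
        by left; exists k.
      by move=> [[k /= kn Fk]|Fn]; [exists k => //=; exact: ltnW | exists n => /=].
    rewrite in_setU; case: (boolP (x \in B n)) => [/set_mem[k /= kn Fk]|_] /=.
      rewrite memNset ?addr0// => Fn.
      have : (F k `&` F n) !=set0 by exists x.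
      by move/(tF k n I I) => kE; move: kn; rewrite kE ltnn.
    by rewrite add0r.
  + apply: KD => //; exact: bmf_indic.
Qed.

(** Open sets form a pi-system generating the Borel sets, so a Dynkin argument gives all indicators,
    linearity the simple functions, and monotone approximation the rest. This is how the duality of
    L and nu, known for Hoelder functions, reaches bounded measurable ones. *)
Lemma monotone_class_bmf g : bmf E g -> K g.
Proof.
move=> bg; have [mg [M gM]] := bg.
(* The shift makes g nonnegative on E, as the approximation by nonnegative simple functions
   requires. *)
pose g1 x := g x + `|M|.
have bg1 : bmf E g1 by apply: bmfD => //; exact: bmf_cst.
have g10 x : E x -> 0 <= g1 x.
  move=> Ex; have := gM x Ex; have := ler_norm M; rewrite /g1 ler_norml.
  by move=> ? /andP[]; lra.
have g12 x : E x -> g1 x <= `|M| + `|M|.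
  move=> Ex; have := gM x Ex; have := ler_norm M; rewrite /g1 ler_norml.
  by move=> ? /andP[]; lra.
suff Kg1 : K g1.
  apply: (monotone_class_eq (f := fun x => g1 x + (fun=> - `|M|) x)).
  - by apply: bmfD => //; exact: bmf_cst.
  - by move=> x _; rewrite /g1 addrK.
  - by apply: KD => //; [exact: bmf_cst | exact: monotone_class_cst].
have mg1 : measurable_fun E (EFin \o g1) by apply/measurable_EFinP; case: bg1.
have [a [andec acvg]] := approximation mE mg1 (fun x Ex => g10 x Ex).
have acvg' x : E x -> (fun n => a n x) @ \oo --> g1 x.
  by move=> /acvg /fine_cvgP[].
have a0 n x : 0 <= a n x by [].
have ale n x : E x -> a n x <= g1 x.
  move=> Ex; rewrite -(cvg_lim (@Rhausdorff R) (acvg' x Ex)).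
  apply: nondecreasing_cvgn_le.
    by move=> i j ij; have /lefP/(_ x) := andec _ _ ij.
  by apply/cvg_ex; eexists; exact: acvg'.
have aM n x : E x -> `|a n x| <= `|M| + `|M|.
  by move=> Ex; rewrite ger0_norm// (le_trans (ale n x Ex))// g12.
apply: (Klim (f := fun n x => a n x) (M := `|M| + `|M|)) => // [n|n].
  split; last by exists (`|M| + `|M|) => x; exact: aM.
  exact: measurable_funTS.
have mpre r : measurable (a n @^-1` [set r]) by exact: measurable_sfunP.
have H (s : seq R) : bmf E (fun x => \sum_(r <- s) r * \1_(a n @^-1` [set r]) x) /\
    K (fun x => \sum_(r <- s) r * \1_(a n @^-1` [set r]) x).
  elim: s => [|r s [ihb ih]].
    have b0 : bmf E (fun=> 0 : R) by exact: bmf_cst.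
    split; first by apply: eq_bmf b0 => x _; rewrite big_nil.
    apply: (monotone_class_eq b0) => [x _|]; first by rewrite big_nil.
    exact: monotone_class_cst.
  have br : bmf E (\1_(a n @^-1` [set r]) : X -> R) by exact: bmf_indic.
  have bs : bmf E (fun x => r * \1_(a n @^-1` [set r]) x +
      \sum_(r <- s) r * \1_(a n @^-1` [set r]) x).
    by apply: bmfD => //; exact: bmfZ.
  split; first by apply: eq_bmf bs => x _; rewrite big_cons.
  apply: (monotone_class_eq bs) => [x _|]; first by rewrite big_cons.
  apply: KD => //; first exact: bmfZ.
  by apply: KZ => //; exact: monotone_class_indic.
have [Hb HK] := H (finmap.enum_fset (fset_set (range (a n)))).
apply: (monotone_class_eq Hb) => // x _.
by rewrite [RHS]fimfunE fsbig_finite.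
Qed.

End functional_monotone_class.

(** * The quadratic deviation principle from cumulants *)

Lemma cauchy_cvgn (R : realType) (u : nat -> R) :
  (forall e : R, 0 < e -> exists N, forall n m, (N <= n)%N -> (N <= m)%N ->
     `|u n - u m| <= e) -> u @ \oo --> limn u.
Proof.
move=> h; apply: cauchy_cvg; apply/cauchy_ballP => e e0.
have [N hN] := h (e / 2) ltac:(lra).
pose A : set R := u @` [set n | (N <= n)%N].
exists (A, A) => /=; first by split; exists N => // n nN; exists n.
move=> [_ _] [/= [n nN <-] [m mN <-]]; rewrite /ball/= /ball_/=.
by apply: le_lt_trans (hN n m nN mN) _; lra.
Qed.

Lemma prod_ge0_le1 (R : realType) (F : nat -> R) n : (forall k, 0 <= F k <= 1) ->
  0 <= \prod_(j < n) F j <= 1.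
Proof.
move=> h; elim: n => [|n /andP[i0 i1]]; first by rewrite big_ord0 ler01 lexx.
by rewrite big_ord_recr/=; have /andP[f0 f1] := h n; rewrite mulr_ge0// mulr_ile1.
Qed.

(** Every index with d >= r costs a factor 1 - r and the others at most 1, so infinitely many such
    indices drive the product to 0. The returned N itself satisfies r <= d N, because the first
    contraction step, taken at that time, costs a factor 1 / d N. *)
Lemma backward_product (R : realType) (d : nat -> R) (r e : R) :
  (forall k, 0 <= d k <= 1) -> 0 < r ->
  (forall m, exists2 k, (m <= k)%N & r <= d k) -> 0 < e ->
  exists N, r <= d N /\ \prod_(j < N) (1 - d j) <= e.
Proof.
move=> dk r0 hr e0.
have dk' k : 0 <= 1 - d k <= 1 by have := dk k; lra.
have r1 : 0 <= 1 - r by have [k _ hk] := hr 0%N; have := dk k; lra.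
have H k : exists N, r <= d N /\ \prod_(j < N) (1 - d j) <= (1 - r) ^+ k.
  elim: k => [|k [N [hN1 hN2]]].
    have [N _ hN] := hr 0%N; exists N; split => //.
    by rewrite expr0; case/andP: (prod_ge0_le1 N dk').
  have [M NM hM] := hr N.+1; exists M; split => //.
  rewrite -(subnKC NM) big_split_ord/= big_ord_recr/= exprS.
  have /andP[p0 p1] := prod_ge0_le1 (M - N.+1) (fun j => dk' (N.+1 + j)%N).
  have /andP[q0 q1] := prod_ge0_le1 N dk'.
  have /andP[s0 s1] := dk' N.
  apply: (@le_trans _ _ (\prod_(i < N) (1 - d i) * (1 - d N))).
    by rewrite ler_piMr// mulr_ge0.
  by rewrite mulrC; apply: ler_pM => //; lra.
have : (fun k => (1 - r) ^+ k) @ \oo --> (0 : R).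
  by apply: cvg_expr; rewrite ger0_norm//; lra.
move=> /(cvgr_lt 0)/(_ e e0) [k _ hk]; have [N [h1 h2]] := H k.
by exists N; split => //; apply: le_trans h2 (ltW (hk k _)) => /=.
Qed.

Lemma limr_ge_cst (R : realType) (u : nat -> R) (l c : R) :
  u @ \oo --> l -> (forall n, c <= u n) -> c <= l.
Proof.
move=> ul uc; rewrite -(cvg_lim (@Rhausdorff R) ul); apply: limr_ge.
  by apply/cvg_ex; exists l.
exact: nearW.
Qed.

Lemma ler_cvg_seq (R : realType) (u v : nat -> R) (l m : R) :
  u @ \oo --> l -> v @ \oo --> m -> (forall n, u n <= v n) -> l <= m.
Proof.
move=> ul vm uv; rewrite -subr_ge0; apply: (limr_ge_cst (cvgB vm ul)) => n.
by rewrite subr_ge0.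
Qed.

(** The series coefficient of order n + 3 is at most |x|^3 2^-(n+1), so the tail sums to at most
    |x|^3. *)
Lemma expR_taylor2 (R : realType) (x : R) : `|x| <= 1 / 2 ->
  `|expR x - (1 + x + x ^+ 2 / 2)| <= `|x| ^+ 3.
Proof.
move=> x2; set S := series (exp_coeff x).
have x0 : 0 <= `|x| := normr_ge0 x.
have S3 : S 3%N = 1 + x + x ^+ 2 / 2.
  rewrite /S /series/= !big_nat_recr//= big_geq// /exp_coeff/=.
  by rewrite !factS fact0 expr0 expr1 !muln1/=; field.
have H n : `|S (n + 3)%N - S 3%N| <= `|x| ^+ 3 * (1 - 2^-1 ^+ n).
  elim: n => [|n ih]; first by rewrite add0n subrr normr0 expr0 subrr mulr0.
  have -> : S (n.+1 + 3)%N - S 3%N = (S (n + 3)%N - S 3%N) + exp_coeff x (n + 3)%N.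
    by rewrite /S addSn seriesS; ring.
  apply: le_trans (ler_normD _ _) _.
  have h : `|exp_coeff x (n + 3)%N| <= `|x| ^+ 3 * 2^-1 ^+ n.+1.
    rewrite /exp_coeff/= normrM normrX normfV normr_nat exprD mulrC.
    rewrite mulrA [leRHS]mulrC ler_wpM2r ?exprn_ge0//.
    have f2 : 2 <= ((n + 3)`!)%:R :> R.
      rewrite (ler_nat _ 2%N) addnS factS; apply: leq_trans (_ : (n + 2).+1 * 1 <= _)%N.
        by rewrite muln1 addn2.
      by rewrite leq_mul2l fact_gt0 orbT.
    rewrite exprS; apply: ler_pM.
    - by rewrite invr_ge0 ler0n.
    - by rewrite exprn_ge0.
    - by rewrite lef_pV2 ?posrE// (lt_le_trans _ f2).
    - by apply: lerXn2r; rewrite ?nnegrE//; move: x2; rewrite div1r.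
  apply: le_trans (lerD ih h) _; rewrite -mulrDr ler_wpM2l ?exprn_ge0//.
  have /= := exprS (2^-1 : R) n; lra.
have cS : (fun n => `|S (n + 3)%N - S 3%N|) @ \oo --> `|expR x - S 3%N|.
  apply: cvg_norm; apply: cvgB; last exact: cvg_cst.
  rewrite (cvg_shiftn 3 S); exact: is_cvg_series_exp_coeff.
rewrite -S3 -(cvg_lim (@Rhausdorff R) cS); apply: limr_le.
  by apply/cvg_ex; eexists; exact: cS.
near=> n; apply: le_trans (H n) _.
rewrite ler_piMr ?exprn_ge0// lerBlDr lerDl exprn_ge0//.
Unshelve. all: by end_near. Qed.

Lemma sqr_le_of_norm (R : realType) (x a : R) : `|x| <= a -> x ^+ 2 <= a ^+ 2.
Proof.
move=> h; rewrite -[leLHS](ger0_norm (sqr_ge0 x)) normrX.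
by rewrite lerXn2r ?nnegrE// (le_trans (normr_ge0 x)).
Qed.

Lemma cube_norm_le (R : realType) (x a : R) : `|x| <= a -> `|x| ^+ 3 <= a ^+ 3.
Proof. by move=> h; rewrite lerXn2r ?nnegrE// (le_trans (normr_ge0 x)). Qed.

(** Here p is s v, and q, r are the first and second order parts of the ansatz. The bounds 2 t and 7
    t^2 come from |X| <= 2 k h and |Y| <= 5 k^2 h, as 7 = 5 + 2^2 / 2. In units of t^3, 64 is lost
    in the Taylor remainder, 21 in (p + q) r and at most 3/2 in r^2 / 2. *)
Lemma expR_expand_in (R : realType) (t p q r : R) : 0 <= t -> t <= 1 / 20 ->
  `|p| <= t -> `|q| <= 2 * t -> `|r| <= 7 * t ^+ 2 ->
  `|expR (p + q + r) - (1 + p + q + r + (p + q) ^+ 2 / 2)| <= 100 * t ^+ 3.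
Proof.
move=> t0 t1 hp hq hr.
have tt : t ^+ 2 <= t / 20 by rewrite expr2; nra.
have hpq : `|p + q| <= 3 * t by apply: le_trans (ler_normD _ _) _; lra.
have hx : `|p + q + r| <= 4 * t.
  by apply: le_trans (ler_normD _ _) _; lra.
have hT := expR_taylor2 (x := p + q + r) ltac:(lra).
have h3 := cube_norm_le hx.
have h4 : `|(p + q) * r| <= 3 * t * (7 * t ^+ 2) by rewrite normrM ler_pM.
have h5 := sqr_le_of_norm hr.
have e : (p + q + r) ^+ 2 / 2 = (p + q) ^+ 2 / 2 + (p + q) * r + r ^+ 2 / 2 by field.
have r20 : 0 <= r ^+ 2 := sqr_ge0 r.
have h6 : (7 * t ^+ 2) ^+ 2 <= 3 * t ^+ 3.
  have -> : (7 * t ^+ 2) ^+ 2 = 49 * t * t ^+ 3 by ring.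
  by rewrite ler_wpM2r ?exprn_ge0//; lra.
have t3 : (4 * t) ^+ 3 = 64 * t ^+ 3 by ring.
have t4 : 3 * t * (7 * t ^+ 2) = 21 * t ^+ 3 by ring.
have t30 : 0 <= t ^+ 3 by exact: exprn_ge0.
move: hT h4; rewrite e !ler_norml => /andP[a1 a2] /andP[b1 b2].
by apply/andP; split; lra.
Qed.

Lemma expRN_le (R : realType) (c : R) : 0 <= c <= 1 / 2 -> expR (- (2 * c)) <= 1 - c.
Proof.
move=> /andP[c0 c1].
have [->|c2] := eqVneq c (1 / 2).
  rewrite mulrCA divff// mulr1 expRN.
  have h : 2 <= expR 1 :> R by have := expR_ge1Dx (1 : R); lra.
  apply: (@le_trans _ _ 2^-1); first by rewrite lef_pV2 ?posrE ?expR_gt0.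
  lra.
rewrite expRN -[leRHS]invrK lef_pV2 ?posrE ?invr_gt0 ?expR_gt0//; last lra.
apply: le_trans (expR_ge1Dx _); rewrite -div1r ler_pdivrMr; last lra.
nra.
Qed.

(** Here e is s^2 times half a variance increment. As |q + r + e| <= 4 t <= 1/5, the exponential
    stays above 1/2, so the factors exp (+- 800 t^3) change it by at least 200 t^3, which covers the
    100 t^3 to be absorbed together with the remainders of the expansion. *)
Lemma expR_expand_out (R : realType) (t q r e : R) : 0 <= t -> t <= 1 / 20 ->
  `|q| <= 2 * t -> `|r| <= 7 * t ^+ 2 -> `|e| <= 3 * t ^+ 2 ->
  1 + q + r + q ^+ 2 / 2 + e + 100 * t ^+ 3 <= expR (q + r + e + 800 * t ^+ 3) /\
  expR (q + r + e - 800 * t ^+ 3) <= 1 + q + r + q ^+ 2 / 2 + e - 100 * t ^+ 3.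
Proof.
move=> t0 t1 hq hr he.
have tt : t ^+ 2 <= t / 20 by rewrite expr2; nra.
have t30 : 0 <= t ^+ 3 by exact: exprn_ge0.
have hre : `|r + e| <= 10 * t ^+ 2 by apply: le_trans (ler_normD _ _) _; lra.
have hx : `|q + (r + e)| <= 4 * t by apply: le_trans (ler_normD _ _) _; lra.
have hT := expR_taylor2 (x := q + (r + e)) ltac:(lra).
have h3 := cube_norm_le hx.
have h4 : `|q * (r + e)| <= 2 * t * (10 * t ^+ 2) by rewrite normrM ler_pM.
have h5 := sqr_le_of_norm hre.
have ee : (q + (r + e)) ^+ 2 / 2 = q ^+ 2 / 2 + q * (r + e) + (r + e) ^+ 2 / 2 by field.
have r20 : 0 <= (r + e) ^+ 2 := sqr_ge0 _.
have h6 : (10 * t ^+ 2) ^+ 2 <= 5 * t ^+ 3.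
  have -> : (10 * t ^+ 2) ^+ 2 = 100 * t * t ^+ 3 by ring.
  by rewrite ler_wpM2r ?exprn_ge0//; lra.
have t3 : (4 * t) ^+ 3 = 64 * t ^+ 3 by ring.
have t4 : 2 * t * (10 * t ^+ 2) = 20 * t ^+ 3 by ring.
have tt3 : t ^+ 3 <= 1 / 8000.
  have -> : 1 / 8000 = (1 / 20) ^+ 3 :> R by field.
  by rewrite lerXn2r ?nnegrE//; lra.
have eY : q + (r + e) = q + r + e by ring.
set Y := q + (r + e) in hx hT ee h3 eY.
have hx' : - (4 * t) <= Y <= 4 * t by rewrite -ler_norml.
have Ylow : 1 / 2 <= expR Y.
  apply: le_trans (expR_ge1Dx Y).
  by have /andP[hx1 _] := hx'; clear -hx1 t1; lra.
rewrite -eY.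
move: hT h4; rewrite ee !ler_norml => /andP[a1 a2] /andP[b1 b2].
split.
  rewrite expRD; apply: (@le_trans _ _ (expR Y * (1 + 800 * t ^+ 3))).
    have pr : 1 / 2 * (800 * t ^+ 3) <= expR Y * (800 * t ^+ 3).
      exact: (ler_wpM2r (mulr_ge0 (ler0n R 800) t30) Ylow).
    by rewrite mulrDr mulr1; lra.
  by rewrite ler_wpM2l ?expR_ge0// expR_ge1Dx.
have k : expR (- (800 * t ^+ 3)) <= 1 - 400 * t ^+ 3.
  have -> : 800 * t ^+ 3 = 2 * (400 * t ^+ 3) by ring.
  by apply: expRN_le; clear -t30 tt3; lra.
rewrite expRD; apply: (@le_trans _ _ (expR Y * (1 - 400 * t ^+ 3))).
  by rewrite ler_wpM2l ?expR_ge0.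
have pr : 1 / 2 * (400 * t ^+ 3) <= expR Y * (400 * t ^+ 3).
  exact: (ler_wpM2r (mulr_ge0 (ler0n R 400) t30) Ylow).
by rewrite mulrBr mulr1; lra.
Qed.

(** Only the existence of the two constants is used afterwards; hiding the numerals keeps the
    induction along the orbit symbolic. *)
Lemma expR_expand (R : realType) : exists K1 K2 : R, 
  (forall t p q r : R, 0 <= t -> t <= 1 / 20 ->
    `|p| <= t -> `|q| <= 2 * t -> `|r| <= 7 * t ^+ 2 ->
    `|expR (p + q + r) - (1 + p + q + r + (p + q) ^+ 2 / 2)| <= K1 * t ^+ 3) /\
  (forall t q r e : R, 0 <= t -> t <= 1 / 20 ->
    `|q| <= 2 * t -> `|r| <= 7 * t ^+ 2 -> `|e| <= 3 * t ^+ 2 ->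
    1 + q + r + q ^+ 2 / 2 + e + K1 * t ^+ 3 <= expR (q + r + e + K2 * t ^+ 3) /\
    expR (q + r + e - K2 * t ^+ 3) <= 1 + q + r + q ^+ 2 / 2 + e - K1 * t ^+ 3).
Proof.
exists 100, 800; split.
- by move=> t p q r; exact: expR_expand_in.
- by move=> t q r e; exact: expR_expand_out.
Qed.

Lemma cvg_near_itv (R : realType) (u : nat -> R) (l e : R) : u @ \oo --> l ->
  0 < e -> \forall n \near \oo, l - e < u n < l + e.
Proof.
move=> ul e0; near=> n; apply/andP; split; near: n.
  by apply: (cvgr_gt l ul); lra.
by apply: (cvgr_lt l ul); lra.
Unshelve. all: by end_near. Qed.

Section elog_estimates.
Context {R : realType}.

Lemma elog_le (p z : R) : p <= expR z -> (elog p%:E <= z%:E)%E.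
Proof.
rewrite /elog; case: ifPn => [p0 pz|_ _]; last exact: leNye.
by rewrite lee_fin -[leRHS]expRK ler_ln ?posrE ?expR_gt0.
Qed.

Lemma elog_ge (p z : R) : expR z <= p -> (z%:E <= elog p%:E)%E.
Proof.
move=> pz; have p0 : 0 < p := lt_le_trans (expR_gt0 z) pz.
by rewrite /elog p0 lee_fin -[leLHS]expRK ler_ln ?posrE ?expR_gt0.
Qed.

Lemma limn_esup_le (u : nat -> \bar R) (l : R) :
  (forall e : R, 0 < e -> \forall n \near \oo, (u n <= (l + e)%:E)%E) ->
  (limn_esup u <= l%:E)%E.
Proof.
move=> h; apply/lee_addgt0Pr => e e0; have he := h e e0.
apply: (@le_trans _ _ (ereal_sup (u @` [set n | (u n <= (l + e)%:E)%E]))).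
  by apply: ereal_inf_lbound; exists [set n | (u n <= (l + e)%:E)%E].
by apply: ge_ereal_sup => _ [n /= un <-].
Qed.

Lemma limn_einf_ge (u : nat -> \bar R) (l : R) :
  (forall e : R, 0 < e -> \forall n \near \oo, ((l - e)%:E <= u n)%E) ->
  (l%:E <= limn_einf u)%E.
Proof.
move=> h; rewrite /limn_einf leeNr -EFinN; apply: limn_esup_le => e e0.
by apply: filterS (h e e0) => n; rewrite leeNl -EFinN opprD opprK.
Qed.

End elog_estimates.

(** This and the next two are linear steps of the lower deviation bound, stated with plain variables
    in place of the products with V n. *)
Lemma le_of_gap2 (R : realType) (a l p q : R) : l <= p -> 0 <= q ->
  a <= - (l + l) + (a + (p + p) + q).
Proof. by lra. Qed.

Lemma le_of_halves (R : realType) (a m b c : R) : a <= m -> m <= b + c ->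
  c <= 2^-1 * a -> 2^-1 * a <= b.
Proof. by lra. Qed.

Lemma le_of_gap3 (R : realType) (a b l p q r : R) : 0 <= r -> l <= r -> p <= r -> q <= r ->
  a - b + (p + q - 4 * r) <= - b + (- l + a).
Proof. by lra. Qed.

(** * Gaertner-Ellis bounds for a quadratic limit *)

Section gartner_ellis_quadratic.
Context d {T : measurableType d} {R : realType}.
Variables (mu : {measure set T -> \bar R}) (D : set T) (h : T -> R).
Hypotheses (mD : measurable D) (muD : (mu D < +oo)%E).
Hypotheses (bh : bmf D h) (h0 : forall x, D x -> 0 <= h x).
Let Ex f := \int[mu]_(x in D) (h x * f x).
Hypothesis h1 : Ex (fun=> 1) = 1.
Variables (V : nat -> R) (y : nat -> T -> R) (sigma : R).
Hypothesis sigma_gt0 : 0 < sigma.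
Hypothesis V_gt0 : \forall n \near \oo, 0 < V n.
Hypothesis V_infty : (fun n => (V n)^-1) @ \oo --> 0.
Hypothesis by_ : forall n, bmf D (y n).
Hypothesis cumulant : forall t,
  (fun n => (V n)^-1 * ln (Ex (fun x => expR (t * V n * y n x)))) @ \oo -->
  t ^+ 2 * sigma ^+ 2 / 2.

Let le_Ex f g : bmf D f -> bmf D g -> (forall x, D x -> f x <= g x) -> Ex f <= Ex g.
Proof.
move=> bf bg fg; apply: (le_Rint mD muD); [exact: bmfM | exact: bmfM |].
by move=> x Dx; rewrite ler_wpM2l ?h0 ?fg.
Qed.

Let ExD f g : bmf D f -> bmf D g -> Ex (fun x => f x + g x) = Ex f + Ex g.
Proof.
move=> bf bg; rewrite /Ex -RintD//; try exact: bmfM.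
by apply: eq_Rint => x _; rewrite mulrDr.
Qed.

Let ExZ c f : bmf D f -> Ex (fun x => c * f x) = c * Ex f.
Proof.
move=> bf; rewrite /Ex -RintZ//; last exact: bmfM.
by apply: eq_Rint => x _; rewrite mulrCA.
Qed.

Let M n t := Ex (fun x => expR (t * V n * y n x)).

Let bexp n t : bmf D (fun x => expR (t * V n * y n x)).
Proof. by apply: bmf_expR; apply: bmfZ. Qed.

(** The bound on exp (- t V y) keeps exp (t V y) away from 0. Without positivity [ln] would return a
    default value and the cumulant hypothesis would say nothing about M. *)
Let M_gt0 n t : 0 < M n t.
Proof.
have [_ [B yB]] := bexp n (- t).
have [x0 Dx0] : D !=set0.
  apply/set0P/eqP => D0; move: h1; rewrite /Ex D0 Rintegral_set0 => /eqP.
  by rewrite eq_sym oner_eq0.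
have B0 : 0 < B.
  by apply: lt_le_trans (yB x0 Dx0); rewrite normr_gt0 gt_eqF ?expR_gt0.
have : Ex (fun=> 1) <= Ex (fun x => B * expR (t * V n * y n x)).
  apply: le_Ex; [exact: bmf_cst | exact: bmfZ |] => x Dx.
  have := yB x Dx; rewrite ger0_norm ?expR_ge0// 2!mulNr expRN.
  by rewrite -ler_pdivrMr ?expR_gt0// div1r.
rewrite h1 ExZ// -/(M n t) => hB.
have : 0 < B * M n t by apply: lt_le_trans hB.
by rewrite pmulr_rgt0.
Qed.

Let M_near (t e : R) : 0 < e -> \forall n \near \oo,
  expR (V n * (t ^+ 2 * sigma ^+ 2 / 2 - e)) <= M n t <=
  expR (V n * (t ^+ 2 * sigma ^+ 2 / 2 + e)).
Proof.
move=> e0; have H := cvg_near_itv (@cumulant t) e0.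
near=> n.
have v0 : 0 < V n by near: n.
have /andP[a1 a2] : t ^+ 2 * sigma ^+ 2 / 2 - e < (V n)^-1 * ln (M n t) <
   t ^+ 2 * sigma ^+ 2 / 2 + e by near: n.
have -> : M n t = expR (V n * ((V n)^-1 * ln (M n t))).
  by rewrite mulVKf ?gt_eqF// lnK ?posrE.
by rewrite !ler_expR !ler_pM2l// (ltW a1) (ltW a2).
Unshelve. all: by end_near. Qed.

Let Pr (A : set R) n := Ex (fun x => \1_A (y n x)).

Let bA A n : measurable A -> bmf D (fun x => \1_A (y n x) : R).
Proof.
move=> mA; split; last first.
  by exists 1 => x _; rewrite indicE; case: (_ \in _); rewrite ?normr1 ?normr0.
apply: (measurableT_comp (f := \1_A : R -> R)); first exact: measurable_indic.
by case: (by_ n).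
Qed.

(* Exponential Chebyshev inequality under the tilt by t; eta is the additional tilt, of either sign. *)
Let chebyshev t eta c n (A : set R) : measurable A ->
  0 < V n -> (forall z, A z -> c <= eta * z) ->
  Ex (fun x => expR (t * V n * y n x) * \1_A (y n x)) <=
  expR (- (V n * c)) * M n (t + eta).
Proof.
move=> mA v0 hA; rewrite -ExZ//; apply: le_Ex.
- by apply: bmfM => //; exact: bA.
- exact: bmfZ.
move=> x _; rewrite indicE; case: (boolP (y n x \in A)) => [/set_mem Ax|_].
  rewrite mulr1 -expRD ler_expR.
  have := ler_wpM2l (ltW v0) (hA _ Ax); nra.
by rewrite mulr0 mulr_ge0 ?expR_ge0.
Qed.

Let Pr_le1 A n : measurable A -> Pr A n <= 1.
Proof.
move=> mA; rewrite -h1; apply: le_Ex; [exact: bA | exact: bmf_cst |].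
by move=> x _; rewrite indicE; case: (_ \in _).
Qed.

Let ln2_near (e : R) : 0 < e -> \forall n \near \oo, ln 2 <= V n * e.
Proof.
move=> e0; have l2 : 0 < ln 2 :> R by rewrite ln_gt0// ltr1n.
have e1 : 0 < e / ln 2 by rewrite divr_gt0.
near=> n.
have v0 : 0 < V n by near: n.
have /andP[_ a] : 0 - e / ln 2 < (V n)^-1 < 0 + e / ln 2.
  by near: n; exact: cvg_near_itv.
move: a; rewrite add0r ltr_pdivlMr// mulrC ltr_pdivrMr// mulrC.
exact: ltW.
Unshelve. all: by end_near. Qed.

(** The tilts +t and -t with t = r / sigma^2 minimize t^2 sigma^2 / 2 - t r, one for each half-line;
    the resulting factor 2 is absorbed by half of e. *)
Let tail_bound (r e : R) : 0 <= r -> 0 < e -> \forall n \near \oo,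
  Pr [set z | r <= `|z|] n <= expR (V n * (- (r ^+ 2 / (2 * sigma ^+ 2)) + e)).
Proof.
move=> r0 e0; have e2 : 0 < e / 2 by lra.
pose t := r / sigma ^+ 2.
have s20 : 0 < sigma ^+ 2 by rewrite exprn_gt0.
have t0 : 0 <= t by rewrite divr_ge0// ltW.
near=> n.
have v0 : 0 < V n by near: n.
have l2 : ln 2 <= V n * (e / 2) by near: n; exact: ln2_near.
have /andP[_ u1] : expR (V n * (t ^+ 2 * sigma ^+ 2 / 2 - e / 2)) <= M n t <=
  expR (V n * (t ^+ 2 * sigma ^+ 2 / 2 + e / 2)) by near: n; exact: M_near.
have /andP[_ u2] : expR (V n * ((- t) ^+ 2 * sigma ^+ 2 / 2 - e / 2)) <= M n (- t) <=
  expR (V n * ((- t) ^+ 2 * sigma ^+ 2 / 2 + e / 2)) by near: n; exact: M_near.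
rewrite sqrrN in u2.
have mp : measurable [set z : R | r <= z].
  by have := measurable_itv `[r, +oo[; congr measurable; apply/seteqP; split => z /=; rewrite in_itv/= andbT.
have mn : measurable [set z : R | r <= - z].
  have := measurable_itv `]-oo, (- r)]; congr measurable.
  by apply/seteqP; split => z /=; rewrite in_itv/= lerNr.
have ma : measurable [set z : R | r <= `|z|].
  have -> : [set z : R | r <= `|z|] = [set z | r <= z] `|` [set z | r <= - z].
    by apply/seteqP; split => z /=; rewrite ler_normr => /orP.
  exact: measurableU.
have cp := chebyshev 0 (eta := t) (c := t * r) mp v0 (fun z (hz : r <= z) => ler_wpM2l t0 hz).
have cn : Ex (fun x => expR (0 * V n * y n x) * \1_[set z | r <= - z] (y n x)) <=
    expR (- (V n * (t * r))) * M n (0 + - t).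
  apply: chebyshev => // z /= hz; rewrite mulNr -mulrN.
  by rewrite ler_wpM2l.
have : Pr [set z | r <= `|z|] n <=
   Ex (fun x => expR (0 * V n * y n x) * \1_[set z | r <= z] (y n x)) +
   Ex (fun x => expR (0 * V n * y n x) * \1_[set z | r <= - z] (y n x)).
  have b0 A : measurable A -> bmf D (fun x => expR (0 * V n * y n x) * \1_A (y n x)).
    by move=> mA; apply: bmfM; [exact: bexp | exact: bA].
  rewrite -ExD; [|exact: b0|exact: b0].
  apply: le_Ex; [exact: bA | apply: bmfD; exact: b0 |].
  move=> x _; rewrite !mul0r expR0 !mul1r !indicE.
  case: (boolP (y n x \in [set z | r <= `|z|])) => [/set_mem/=|_]; last first.
    by rewrite addr_ge0.
  rewrite ler_normr => /orP[a|a].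
    have -> : y n x \in [set z | r <= z] by rewrite inE.
    by rewrite lerDl.
  have -> : y n x \in [set z | r <= - z] by rewrite inE.
  by rewrite lerDr.
move=> /le_trans; apply; rewrite !add0r in cp cn.
apply: le_trans (lerD cp cn) _.
rewrite -mulrDr; apply: (@le_trans _ _ (expR (- (V n * (t * r))) *
  (2 * expR (V n * (t ^+ 2 * sigma ^+ 2 / 2 + e / 2))))).
  have e2x (z : R) : 2 * z = z + z by ring.
  by rewrite e2x ler_wpM2l ?expR_ge0// lerD.
rewrite [X in _ * (X * _) <= _](_ : 2 = expR (ln 2)); last by rewrite lnK ?posrE.
rewrite -!expRD ler_expR.
have -> : r ^+ 2 / (2 * sigma ^+ 2) = t * r - t ^+ 2 * sigma ^+ 2 / 2.
  by rewrite /t; field; rewrite gt_eqF.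
have -> : V n * (- (t * r - t ^+ 2 * sigma ^+ 2 / 2) + e) =
  - (V n * (t * r)) + (V n * (e / 2) + V n * (t ^+ 2 * sigma ^+ 2 / 2 + e / 2)) by field.
by rewrite lerD2l lerD2r.
Unshelve. all: by end_near. Qed.

(** Change of measure. Tilting by t = x0 / sigma^2 moves the mean to x0; an additional tilt by dl /
    sigma^2 in either direction shows that both half-lines beyond distance dl carry an exponentially
    small share of the tilted mass, so the ball keeps at least half of it. Undoing the tilt on a
    ball of radius dl costs |t| dl, at most e / 4. *)
Let ball_bound (x0 r e : R) : 0 < r -> 0 < e -> \forall n \near \oo,
  expR (V n * (- (x0 ^+ 2 / (2 * sigma ^+ 2)) - e)) <= Pr [set z | `|z - x0| < r] n.
Proof.
move=> r0 e0; have s20 : 0 < sigma ^+ 2 by rewrite exprn_gt0.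
pose t := x0 / sigma ^+ 2.
pose dl := Num.min r (e / (4 * (`|t| + 1))).
have t1 : 0 < `|t| + 1 by rewrite ltr_wpDl.
have dl0 : 0 < dl by rewrite lt_min r0 divr_gt0// mulr_gt0.
have dlr : dl <= r by rewrite ge_min lexx.
have dle : `|t| * dl <= e / 4.
  apply: (@le_trans _ _ ((`|t| + 1) * (e / (4 * (`|t| + 1))))).
    by apply: ler_pM => //; [exact: ltW | rewrite lerDl | rewrite ge_min lexx orbT].
  by rewrite le_eqVlt; apply/orP; left; apply/eqP; field; rewrite gt_eqF.
pose kp := dl ^+ 2 / (2 * sigma ^+ 2).
have kp0 : 0 < kp by rewrite divr_gt0 ?exprn_gt0// mulr_gt0.
(* [kp] is the decay rate of the tilted mass outside the ball. The precision e1 of the cumulants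
   must leave kp - 2 e1 above the kp / 2 spent on a factor 4, and be small against e. *)
pose e1 := Num.min (kp / 8) (e / 4).
have e10 : 0 < e1 by rewrite lt_min; apply/andP; split; apply: divr_gt0.
have e1k : e1 <= kp / 8 by rewrite ge_min lexx.
have e1e : e1 <= e / 4 by rewrite ge_min lexx orbT.
have kpe : 0 <= kp / 2 - 2 * e1 by lra.
pose eta := dl / sigma ^+ 2.
have eta0 : 0 < eta by rewrite divr_gt0.
pose L := t ^+ 2 * sigma ^+ 2 / 2.
near=> n.
have v0 : 0 < V n by near: n.
have l2k : ln 2 <= V n * (kp / 4) by near: n; apply: ln2_near; rewrite divr_gt0.
have l2e : ln 2 <= V n * (e / 4) by near: n; apply: ln2_near; rewrite divr_gt0.
have /andP[u0 _] : expR (V n * (t ^+ 2 * sigma ^+ 2 / 2 - e1)) <= M n t <=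
  expR (V n * (t ^+ 2 * sigma ^+ 2 / 2 + e1)) by near: n; exact: M_near.
have /andP[_ u1] : expR (V n * ((t + eta) ^+ 2 * sigma ^+ 2 / 2 - e1)) <= M n (t + eta) <=
  expR (V n * ((t + eta) ^+ 2 * sigma ^+ 2 / 2 + e1)) by near: n; exact: M_near.
have /andP[_ u2] : expR (V n * ((t + - eta) ^+ 2 * sigma ^+ 2 / 2 - e1)) <= M n (t + - eta) <=
  expR (V n * ((t + - eta) ^+ 2 * sigma ^+ 2 / 2 + e1)) by near: n; exact: M_near.
pose Ap := [set z : R | x0 + dl <= z]; pose An := [set z : R | z <= x0 - dl].
pose B := [set z : R | `|z - x0| < dl]; pose Br := [set z : R | `|z - x0| < r].
have mp : measurable Ap.
  have -> : Ap = [set` `[(x0 + dl), +oo[].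
    by apply/seteqP; split => z; rewrite /Ap/= in_itv/= andbT.
  exact: measurable_itv.
have mn : measurable An.
  have -> : An = [set` `]-oo, (x0 - dl)]].
    by apply/seteqP; split => z; rewrite /An/= in_itv.
  exact: measurable_itv.
have mball rr : measurable [set z : R | `|z - x0| < rr].
  have := measurable_itv `](x0 - rr), (x0 + rr)[; congr measurable.
  by apply/seteqP; split => z /=; rewrite in_itv/= ltr_distl.
have bt A : measurable A -> bmf D (fun x => expR (t * V n * y n x) * \1_A (y n x)).
  by move=> mA; apply: bmfM; [exact: bexp | exact: bA].
have cp : Ex (fun x => expR (t * V n * y n x) * \1_Ap (y n x)) <=
    expR (V n * (L - kp + e1)).
  have hp z : Ap z -> eta * (x0 + dl) <= eta * z by move=> hz; rewrite ler_wpM2l ?(ltW eta0).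
  apply: le_trans (chebyshev t mp v0 hp) _.
  apply: le_trans (ler_wpM2l (expR_ge0 _) u1) _.
  rewrite -expRD ler_expR le_eqVlt; apply/orP; left; apply/eqP.
  by rewrite /L /kp /t /eta; field; rewrite gt_eqF.
have cn : Ex (fun x => expR (t * V n * y n x) * \1_An (y n x)) <=
    expR (V n * (L - kp + e1)).
  have hn z : An z -> - eta * (x0 - dl) <= - eta * z.
    by move=> hz; rewrite !mulNr lerN2 ler_wpM2l ?(ltW eta0).
  apply: le_trans (chebyshev t mn v0 hn) _.
  apply: le_trans (ler_wpM2l (expR_ge0 _) u2) _.
  rewrite -expRD ler_expR le_eqVlt; apply/orP; left; apply/eqP.
  by rewrite /L /kp /t /eta; field; rewrite gt_eqF.
have split3 : M n t <= Ex (fun x => expR (t * V n * y n x) * \1_B (y n x)) +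
    (Ex (fun x => expR (t * V n * y n x) * \1_Ap (y n x)) +
     Ex (fun x => expR (t * V n * y n x) * \1_An (y n x))).
  rewrite -ExD; [|exact: bt|exact: bt].
  have bB := bt _ (mball dl).
  rewrite -ExD; [|exact: bB|by apply: bmfD; exact: bt].
  apply: le_Ex; [exact: bexp | by apply: bmfD => //; apply: bmfD; exact: bt |].
  move=> x _; rewrite -!mulrDr ler_peMr ?expR_ge0// !indicE.
  case: (boolP (y n x \in B)) => [_|/negP hB]; first by rewrite lerDl addr_ge0.
  case: (boolP (y n x \in Ap)) => [_|/negP hAp]; first by rewrite add0r lerDl.
  case: (boolP (y n x \in An)) => [_|/negP hAn]; first by rewrite !add0r.
  exfalso; apply: hB; rewrite inE /B/= ltr_distl; apply/andP; split.
    by rewrite ltNge; apply/negP => hh; apply: hAn; rewrite inE.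
  by rewrite ltNge; apply/negP => hh; apply: hAp; rewrite inE.
have half : expR (V n * (L - kp + e1)) + expR (V n * (L - kp + e1)) <=
    2^-1 * expR (V n * (L - e1)).
  have q1 : expR (V n * (L - kp + e1)) <= 4^-1 * expR (V n * (L - e1)).
    have -> : (4 : R)^-1 = expR (- (ln 2 + ln 2)).
      by rewrite expRN expRD lnK ?posrE// -natrM.
    rewrite -expRD ler_expR.
    have pos : 0 <= V n * (kp / 2 - 2 * e1).
      by apply: mulr_ge0; [exact: ltW | exact: kpe].
    have -> : V n * (L - e1) = V n * (L - kp + e1) + (V n * (kp / 4) + V n * (kp / 4))
        + V n * (kp / 2 - 2 * e1) by field.
    exact: le_of_gap2.
  have e2 (z : R) : 2^-1 * z = 4^-1 * z + 4^-1 * z by field.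
  by rewrite e2 lerD.
have lower : 2^-1 * expR (V n * (L - e1)) <=
    Ex (fun x => expR (t * V n * y n x) * \1_B (y n x)).
  exact: le_of_halves u0 split3 (le_trans (lerD cp cn) half).
have upper : Ex (fun x => expR (t * V n * y n x) * \1_B (y n x)) <=
    expR (V n * (t * x0 + `|t| * dl)) * Pr Br n.
  rewrite -ExZ; last exact: (bA _ (mball r)).
  apply: le_Ex; [exact: (bt _ (mball dl)) | apply: bmfZ; exact: (bA _ (mball r)) |].
  move=> x _; rewrite !indicE; case: (boolP (y n x \in B)) => [/set_mem hB|_]; last first.
    by rewrite mulr0 mulr_ge0 ?expR_ge0.
  have -> : y n x \in Br by rewrite inE; exact: lt_le_trans dlr.
  rewrite !mulr1 ler_expR mulrAC mulrC ler_wpM2l ?(ltW v0)//.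
  have -> : t * y n x = t * x0 + t * (y n x - x0) by ring.
  rewrite lerD2l; apply: le_trans (ler_norm _) _; rewrite normrM ler_wpM2l//.
  exact: ltW.
have := le_trans lower upper.
rewrite -ler_pdivrMl ?expR_gt0// -expRN; apply: le_trans.
have -> : (2 : R)^-1 = expR (- ln 2) by rewrite expRN lnK ?posrE.
rewrite -!expRD ler_expR.
have -> : x0 ^+ 2 / (2 * sigma ^+ 2) = t * x0 - L by rewrite /L /t; field; rewrite gt_eqF.
have h1' := ler_wpM2l (ltW v0) e1e; have h2' := ler_wpM2l (ltW v0) dle.
have -> : V n * (- (t * x0 - L) - e) = V n * (L - e1) - V n * (t * x0 + `|t| * dl)
   + (V n * e1 + V n * (`|t| * dl) - 4 * (V n * (e / 4))) by field.
have r4 : 0 <= V n * (e / 4) by apply: mulr_ge0; [exact: ltW | rewrite divr_ge0 ?(ltW e0)].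
exact: le_of_gap3.
Unshelve. all: by end_near. Qed.

Variable s : nat -> \bar R.
Variable G : set R.
Hypothesis mG : measurable G.
Hypothesis sE : \forall n \near \oo, s n = ((V n)^-1%:E * elog (Pr G n)%:E)%E.

(** The rate increases with |z|: for c below the infimum, G lies in the set |z| >= r with r^2 = 2 c
    sigma^2, and the two-sided tail bound applies. If the closure of G is empty the infimum is +oo
    and every c >= 0 is admissible. *)
Lemma quadratic_ldp_upper :
  (limn_esup s <= - ereal_inf [set (x ^+ 2 / (2 * sigma ^+ 2))%:E | x in closure G])%E.
Proof.
set S := [set _ | _ in _]; have s20 : 0 < sigma ^+ 2 by rewrite exprn_gt0.
have I0 : (0 <= ereal_inf S)%E.
  apply: le_ereal_inf_tmp => _ [x _ <-]; rewrite lee_fin.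
  by apply: divr_ge0; [exact: sqr_ge0 | apply: mulr_ge0; [exact: ler0n | exact: ltW]].
have step : forall c : R, 0 <= c -> (c%:E <= ereal_inf S)%E -> (limn_esup s <= - c%:E)%E.
  move=> c c0 cS; rewrite -EFinN; apply: limn_esup_le => e e0.
  pose r := sigma * Num.sqrt (2 * c).
  have r0 : 0 <= r by rewrite mulr_ge0 ?sqrtr_ge0// ltW.
  have r2 : r ^+ 2 / (2 * sigma ^+ 2) = c.
    by rewrite /r exprMn sqr_sqrtr ?mulr_ge0//; field; rewrite gt_eqF.
  near=> n.
  have -> : s n = ((V n)^-1%:E * elog (Pr G n)%:E)%E by near: n.
  have v0 : 0 < V n by near: n.
  have : Pr [set z | r <= `|z|] n <= expR (V n * (- (r ^+ 2 / (2 * sigma ^+ 2)) + e)).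
    by near: n; exact: tail_bound.
  rewrite r2 => hp.
  have : Pr G n <= Pr [set z | r <= `|z|] n.
    have bE B : measurable B -> bmf D (fun x => \1_B (y n x) : R) by exact: bA.
    apply: le_Ex; [exact: bE | apply: bE |].
      have -> : [set z : R | r <= `|z|] = ~` [set` `](- r), r[].
        apply/seteqP; split => z /=; rewrite in_itv/= -ltr_norml.
          by rewrite leNgt => /negP.
        by move=> /negP; rewrite -leNgt.
      by apply: measurableC; exact: measurable_itv.
    move=> x _; rewrite !indicE; case: (boolP (y n x \in G)) => [/set_mem Gx|_]; last first.
      by rewrite ler0n.
    rewrite mem_set//=.
    have : (c%:E <= (y n x ^+ 2 / (2 * sigma ^+ 2))%:E)%E.
      apply: le_trans cS _; apply: ereal_inf_lbound; exists (y n x) => //.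
      exact: subset_closure.
    rewrite lee_fin -r2 ler_pM2r ?invr_gt0 ?mulr_gt0//.
    by rewrite -(real_normK (num_real (y n x))) ler_pXn2r ?nnegrE.
  move=> /le_trans/(_ hp)/elog_le hl.
  apply: le_trans (lee_wpmul2l _ hl) _; first by rewrite lee_fin invr_ge0 ltW.
  by rewrite -EFinM lee_fin mulKf// gt_eqF.
  Unshelve. all: try by end_near.
move: I0 step; case: (ereal_inf S) => [c| |]//.
  by rewrite lee_fin => c0 /(_ c c0 (lexx _)).
move=> _; case: (limn_esup s) => [z| |] step //=.
  have := step (`|z| + 1) (addr_ge0 (normr_ge0 _) ler01) (leey _).
  rewrite -EFinN lee_fin => hz; exfalso.
  by have := ler_norm (- z); rewrite normrN; lra.
by have := step 0 (lexx _) (leey _).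
Qed.

Lemma quadratic_ldp_lower :
  (- ereal_inf [set (x ^+ 2 / (2 * sigma ^+ 2))%:E | x in interior G] <= limn_einf s)%E.
Proof.
rewrite leeNl; apply: le_ereal_inf_tmp => _ [x Gx <-].
rewrite leeNl -EFinN; apply: limn_einf_ge => e e0.
have /nbhs_ballP[r /= r0 hr] := Gx.
near=> n.
have -> : s n = ((V n)^-1%:E * elog (Pr G n)%:E)%E by near: n.
have v0 : 0 < V n by near: n.
have hp : expR (V n * (- (x ^+ 2 / (2 * sigma ^+ 2)) - e)) <= Pr [set z | `|z - x| < r] n.
  by near: n; exact: ball_bound.
have : Pr [set z | `|z - x| < r] n <= Pr G n.
  apply: le_Ex; [apply: bA | exact: bA |].
    have -> : [set z : R | `|z - x| < r] = [set` `](x - r), (x + r)[].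
      by apply/seteqP; split => z; rewrite /= in_itv/= ltr_distl.
    exact: measurable_itv.
  move=> z _; rewrite !indicE; case: (boolP (y n z \in [set z0 | `|z0 - x| < r])) => [/set_mem/= hz|_].
    have -> : y n z \in G by rewrite inE; apply: hr; rewrite /ball/= distrC.
    by [].
  by rewrite ler0n.
move=> /(le_trans hp)/elog_ge hl.
apply: le_trans (lee_wpmul2l _ hl); last by rewrite lee_fin invr_ge0 ltW.
by rewrite -EFinM lee_fin mulKf// gt_eqF.
Unshelve. all: by end_near. Qed.

End gartner_ellis_quadratic.

(** * Duality and contraction of cones along the orbit *)

Lemma cvg_succ (R : realType) (u : nat -> R) (l : R) :
  u @ \oo --> l -> (fun n => u n.+1) @ \oo --> l.
Proof. by move=> ul; rewrite (cvg_shiftS u). Qed.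

Section cocycle.
Context {R : realType} {dO dX : measure_display}.
Context {Omega : measurableType dO} {X : measurableType dX}.
Variables (theta thetainv : Omega -> Omega) (dist : X -> X -> R) (alpha : R).
Variables (E : Omega -> set X) (T : Omega -> X -> X) (phi : Omega -> X -> R).
Variable nu : Omega -> probability X R.
Local Notation nu' := (fun w => nu w : {measure set X -> \bar R}).

Hypothesis dist_metric : is_metric dist.
Hypothesis dist_le1 : forall x y, dist x y <= 1.
Hypothesis borel : forall A : set X, measurable A <-> <<s dopen dist >> A.
Hypothesis alpha_gt0 : 0 < alpha.
Hypothesis alpha_le1 : alpha <= 1.
Hypothesis mE : forall w, measurable (E w).
Hypothesis TE : forall w x, E w x -> E (theta w) (T w x).
Hypothesis mT : forall w, measurable_fun (E w) (T w).

(** A forward invariant set of base points at which the almost sure hypotheses hold without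
    exception; statements proved for w in [gd] then apply along its whole orbit. *)
Variable gd : set Omega.
Hypothesis gd_theta : forall w, gd w -> gd (theta w).
Hypothesis gd_branches : forall w, gd w -> exists I y l H D,
  branches dist alpha (E w) (E (theta w)) (Defs.preim E T w) (phi w) I y l H D.
Hypothesis gd_nuE : forall w, gd w -> nu w (E w) = 1%E.
Hypothesis gd_conformal : forall w, gd w ->
  conformal_nu dist alpha theta E T phi nu' w.

Local Notation L := (Lop E T phi).
Local Notation one1 := (@Defs.one R dX X).
Local Notation thn := (thn theta).
Local Notation lam := (lam theta E T phi nu').
Local Notation lamn := (lamn theta E T phi nu').
Local Notation Ln := (Ln theta E T phi).

Definition nuI w (f : X -> R) := \int[nu w]_(x in E w) f x.

Lemma nuE_fin w : (nu w (E w) < +oo)%E.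
Proof. by apply: le_lt_trans (probability_le1 _ (mE w)) _; rewrite ltry. Qed.

Lemma nuI_D w f g : bmf (E w) f -> bmf (E w) g ->
  nuI w (fun x => f x + g x) = nuI w f + nuI w g.
Proof. exact: (RintD (mE w) (nuE_fin w)). Qed.

Lemma nuI_B w f g : bmf (E w) f -> bmf (E w) g ->
  nuI w (fun x => f x - g x) = nuI w f - nuI w g.
Proof. exact: (RintB (mE w) (nuE_fin w)). Qed.

Lemma nuI_Z w c f : bmf (E w) f -> nuI w (fun x => c * f x) = c * nuI w f.
Proof. exact: (RintZ (mE w) (nuE_fin w)). Qed.

Lemma le_nuI w f g : bmf (E w) f -> bmf (E w) g ->
  (forall x, E w x -> f x <= g x) -> nuI w f <= nuI w g.
Proof. exact: (le_Rint (mE w) (nuE_fin w)). Qed.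

Lemma eq_nuI w f g : (forall x, E w x -> f x = g x) -> nuI w f = nuI w g.
Proof. exact: eq_Rint. Qed.

Lemma nuI_cst w c : gd w -> nuI w (fun=> c) = c.
Proof. move=> gw; rewrite /nuI Rintegral_cst//.
by rewrite -[X in fine X]/(nu w (E w)) gd_nuE// mulr1. Qed.

Lemma E_neq0 w : gd w -> E w !=set0.
Proof.
move=> gw; apply/set0P/eqP => E0.
by have := gd_nuE gw; rewrite E0 measure0 => /eqP; rewrite eqe eq_sym oner_eq0.
Qed.

Lemma thn_theta n w : thn n (theta w) = thn n.+1 w.
Proof. by rewrite /Defs.thn iterSr. Qed.

Lemma thnD m n w : thn n (thn m w) = thn (m + n) w.
Proof. by rewrite /Defs.thn addnC iterD. Qed.

Lemma gd_thn n w : gd w -> gd (thn n w).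
Proof. by move=> gw; elim: n => //= n; exact: gd_theta. Qed.

Section one_step.
Variable w : Omega.
Hypothesis gw : gd w.
Implicit Types f g : X -> R.

Lemma LD f g x : E (theta w) x -> bmf (E w) f -> bmf (E w) g ->
  L w (fun z => f z + g z) x = L w f x + L w g x.
Proof.
case: (gd_branches gw) => I [y [l [H [D br]]]] Ex [_ bf] [_ bg].
exact: (topD br Ex bf bg).
Qed.

Lemma LB f g x : E (theta w) x -> bmf (E w) f -> bmf (E w) g ->
  L w (fun z => f z - g z) x = L w f x - L w g x.
Proof.
case: (gd_branches gw) => I [y [l [H [D br]]]] Ex [_ bf] [_ bg].
exact: (topB br Ex bf bg).
Qed.

Lemma LZ c f x : E (theta w) x -> bmf (E w) f ->
  L w (fun z => c * f z) x = c * L w f x.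
Proof.
case: (gd_branches gw) => I [y [l [H [D br]]]] Ex [_ bf].
exact: (topZ br c Ex bf).
Qed.

Lemma L_bmf f : bmf (E w) f -> bmf (E (theta w)) (L w f).
Proof.
case: (gd_branches gw) => I [y [l [H [D br]]]] bf.
exact: (bmf_top dist_metric borel alpha_gt0 br (mE _) (mE _) bf).
Qed.

Lemma L_holder f : holder_fun dist alpha (E w) f ->
  holder_fun dist alpha (E (theta w)) (L w f).
Proof.
case: (gd_branches gw) => I [y [l [H [D br]]]] bf.
exact: (holder_top dist_metric dist_le1 borel alpha_gt0 br (mE _) (mE _) bf).
Qed.

Lemma le_L f g x : E (theta w) x -> bmf (E w) f -> bmf (E w) g ->
  (forall z, E w z -> f z <= g z) -> L w f x <= L w g x.
Proof.
case: (gd_branches gw) => I [y [l [H [D br]]]] Ex [_ bf] [_ bg].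
exact: (le_top br Ex bf bg).
Qed.

Lemma eq_L f g x : E (theta w) x -> (forall z, E w z -> f z = g z) ->
  L w f x = L w g x.
Proof.
case: (gd_branches gw) => I [y [l [H [D br]]]] Ex fg.
exact: (eq_top br Ex fg).
Qed.

Lemma L_comp k f x : E (theta w) x -> bmf (E w) f ->
  L w (fun z => k (T w z) * f z) x = k x * L w f x.
Proof.
case: (gd_branches gw) => I [y [l [H [D br]]]] Ex [_ bf].
by apply: (top_comp br) => // z [].
Qed.

Lemma L_dct (f : nat -> X -> R) g (M : R) x : E (theta w) x ->
  (forall n z, E w z -> `|f n z| <= M) ->
  (forall z, E w z -> f^~ z @ \oo --> g z) -> bmf (E w) g ->
  (fun n => L w (f n) x) @ \oo --> L w g x.
Proof.
case: (gd_branches gw) => I [y [l [H [D br]]]] Ex fM fg [_ bg].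
exact: (top_dct br Ex fM fg bg).
Qed.

End one_step.

Lemma Ln_theta n w g : Ln (theta w) n (L w g) = Ln w n.+1 g.
Proof. by elim: n => [//|n ih] /=; rewrite ih thn_theta. Qed.

Lemma Ln_bmf n w f : gd w -> bmf (E w) f -> bmf (E (thn n w)) (Ln w n f).
Proof.
by move=> gw bf; elim: n => //= n ih; apply: L_bmf => //; exact: gd_thn.
Qed.

Lemma eq_Ln n w f g : gd w -> (forall x, E w x -> f x = g x) ->
  forall x, E (thn n w) x -> Ln w n f x = Ln w n g x.
Proof.
move=> gw fg; elim: n => [|n ih] x Ex /=; first exact: fg.
by apply: eq_L => //; exact: gd_thn.
Qed.

Lemma holder_one A : holder_fun dist alpha A one1.
Proof.
apply/(holder_funP alpha dist_metric); split.
  by exists 1 => x _; rewrite normr1.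
by exists 0 => // x x' _ _; rewrite subrr normr0 mul0r.
Qed.

Lemma bmf_one A : bmf A one1. Proof. exact: bmf_cst. Qed.

Lemma lamE w : lam w = nuI (theta w) (L w one1).
Proof. by []. Qed.

(** * Duality of transfer operators and conformal measures *)

Section duality.
Variable w : Omega.
Hypothesis gw : gd w.

Let xs n := xget point (E (thn n w)).
Let xsE n : E (thn n w) (xs n).
Proof. by have /E_neq0 [x Ex] := gd_thn n gw; exact: (xgetI point Ex). Qed.

Let a n g := Ln w n g (xs n).
Let b n := Ln w n one1 (xs n).
Let d n := Ln (theta w) n one1 (xs n.+1).

Let ab g : holder_fun dist alpha (E w) g ->
  (fun n => a n g / b n) @ \oo --> nuI w g.
Proof. by move=> hg; case: (gd_conformal gw) => _; apply. Qed.

Let ad g : holder_fun dist alpha (E w) g ->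
  (fun n => a n.+1 g / d n) @ \oo --> nuI (theta w) (L w g).
Proof.
move=> hg; case: (gd_conformal (gd_theta gw)) => _ /(_ (L w g) (L_holder gw hg)).
move=> /(_ (fun n => xs n.+1)); under eq_fun do rewrite Ln_theta.
by apply => n; rewrite thn_theta.
Qed.

(** The iterates of g at x_(n+1) can be normalized in two ways: divided by the iterates of 1 from w
    they tend to nu_w g, divided by those of 1 from theta w they tend to nu_(theta w) (L g). For g =
    1 the second limit is lam, the limiting ratio of the two normalizations. *)
Lemma dual_holder g : holder_fun dist alpha (E w) g ->
  nuI (theta w) (L w g) = lam w * nuI w g.
Proof.
move=> hg; rewrite mulrC.
have h1 := ab hg; have h2 := ad hg.
have h3 := ad (holder_one (E w)); have h4 := ab (holder_one (E w)).
have h1' : (fun n => a n.+1 g / b n.+1) @ \oo --> nuI w g.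
  exact: (cvg_succ h1).
(* For g = 1 the conformal ratio is b / b, which tends to 1, while division by zero yields 0; hence
   b is eventually nonzero. *)
have bn0 : \forall n \near \oo, b n.+1 != 0.
  move: h4; rewrite nuI_cst// => h4.
  have h4' : (fun n => b n.+1 / b n.+1) @ \oo --> (1 : R).
    exact: (cvg_succ h4).
  have : \forall n \near \oo, b n.+1 / b n.+1 > 1 / 2.
    by apply: (cvgr_gt 1) => //; lra.
  apply: filterS => n; apply: contraTneq => ->.
  by rewrite mul0r -leNgt; lra.
apply: (cvg_unique _ h2) => //.
apply: cvg_trans (cvgM h1' h3); apply: near_eq_cvg.
near=> n.
have bn : b n.+1 != 0 by near: n.
by rewrite /= mulrA -[X in X / _ = _]/(a n.+1 g / b n.+1 * b n.+1) divfK.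
Unshelve. all: by end_near. Qed.

(** Otherwise all later iterates of 1 vanish, and the conformal ratio for g = 1 is 0 / 0 = 0 at
    every positive time instead of tending to 1. *)
Lemma L_one_neq0 : exists2 x, E (theta w) x & L w one1 x != 0.
Proof.
apply: contrapT => hn.
have L0 x : E (theta w) x -> L w one1 x = 0 * (fun=> 0) x.
  move=> Ex; rewrite mul0r; apply: contrapT => /eqP h; apply: hn.
  by exists x.
have b0 n : b n.+1 = 0.
  rewrite /b -Ln_theta.
  have H k x : E (thn k (theta w)) x -> Ln (theta w) k (fun=> 0) x = 0.
    elim: k x => [//|k ih] x Ex /=.
    have hk : gd (thn k (theta w)) by exact/gd_thn/gd_theta.
    transitivity (L (thn k (theta w)) (fun z => 0 * one1 z) x).
      by apply: eq_L => // z Ez; rewrite mul0r ih.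
    by rewrite (LZ hk 0 Ex (bmf_one _)) mul0r.
  have Ex : E (thn n (theta w)) (xs n.+1) by rewrite thn_theta.
  transitivity (Ln (theta w) n (fun=> 0) (xs n.+1)); last exact: H.
  apply: eq_Ln => //; first exact: gd_theta.
  by move=> x Ex'; rewrite L0// mul0r.
have := ab (holder_one (E w)); rewrite nuI_cst// => h4.
have h4' : (fun n => b n.+1 / b n.+1) @ \oo --> (1 : R).
  exact: (cvg_succ h4).
have : (fun n => b n.+1 / b n.+1) @ \oo --> (0 : R).
  by under eq_fun do rewrite b0 mul0r; exact: cvg_cst.
move=> /(cvg_unique _ h4')-/(_ (@Rhausdorff R))/eqP.
by rewrite oner_eq0.
Qed.

(** Both sides are linear and continuous under bounded pointwise convergence, so the identity
    extends from Hoelder functions by the monotone class theorem. *)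
Lemma dual g : bmf (E w) g -> nuI (theta w) (L w g) = lam w * nuI w g.
Proof.
have gw' := gd_theta gw.
apply: (monotone_class_bmf dist_metric dist_le1 borel alpha_gt0 alpha_le1
  (K := fun g => nuI (theta w) (L w g) = lam w * nuI w g)) => //.
- exact: dual_holder.
- move=> f h bf bh ef eh.
  rewrite nuI_D// mulrDr -ef -eh -nuI_D; try exact: L_bmf.
  by apply: eq_nuI => x Ex; rewrite LD.
- move=> c f bf ef; rewrite nuI_Z// mulrCA -ef -nuI_Z; last exact: L_bmf.
  by apply: eq_nuI => x Ex; rewrite LZ.
move=> f h M bf fM fh ef.
have [bh c1] := Rint_dct (mE w) (nuE_fin w) (fun n => (bf n).1) fM fh.
have fM' n x : E w x -> `|f n x| <= `|M|.
  by move=> Ex; exact: le_trans (fM n x Ex) (ler_norm _).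
have [D LM] : exists D : R, forall n x, E (theta w) x -> `|L w (f n) x| <= `|M| * D.
  case: (gd_branches gw) => I [y [l [H [D br]]]].
  by exists D => n x Ex; exact: (top_norm_le br Ex (normr_ge0 M) (fM' n)).
have [_ c2] := Rint_dct (mE (theta w)) (nuE_fin (theta w))
  (fun n => (L_bmf gw (bf n)).1) LM (fun x Ex => L_dct gw Ex fM fh bh).
apply: (cvg_unique _ c2) => //.
have -> : (fun n => \int[nu (theta w)]_(x in E (theta w)) L w (f n) x) =
          (fun n => lam w * nuI w (f n)) by apply/funext => n; exact: ef.
by apply: cvgMr.
Qed.

End duality.

(** * Abstract cones and their contraction *)

Variable C : Omega -> set (X -> R).
Variables de CK : Omega -> R.
Hypothesis C_add : forall w f g, gd w -> C w f -> C w g -> C w (fun x => f x + g x).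
Hypothesis C_scale : forall w (c : R) f, gd w -> 0 <= c -> C w f -> C w (fun x => c * f x).
Hypothesis C_one : forall w, gd w -> C w one1.
Hypothesis C_lim : forall w (f : nat -> X -> R) (g : X -> R), gd w -> (forall n, C w (f n)) ->
  (forall x, E w x -> f^~ x @ \oo --> g x) -> C w g.
Hypothesis C_ge0 : forall w f x, gd w -> C w f -> E w x -> 0 <= f x.
Hypothesis C_K : forall w f x y, gd w -> C w f -> E w x -> E w y -> f x <= CK w * f y.
Hypothesis C_holder : forall w f, gd w -> C w f -> holder_fun dist alpha (E w) f.
Hypothesis C_L : forall w f, gd w -> C w f -> C (theta w) (L w f).
Hypothesis de_gt0 : forall w, gd w -> 0 < de w.
Hypothesis de_le : forall w, gd w -> de w <= 1 / 2.
Hypothesis C_contr : forall w f g, gd w -> C w f -> C w g ->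
  nuI (theta w) (L w g) <= nuI (theta w) (L w f) ->
  C (theta w) (fun x => (1 - de w) * L w f x - de w * L w g x).

Lemma C_bmf w f : gd w -> C w f -> bmf (E w) f.
Proof. by move=> gw Cf; exact: (holder_bmf dist_metric borel alpha_gt0 (mE w) (C_holder gw Cf)). Qed.

Lemma eq_C w f g : gd w -> (forall x, E w x -> f x = g x) -> C w f -> C w g.
Proof.
move=> gw fg Cf; apply: (C_lim gw (f := fun=> f)) => // x Ex.
by rewrite fg//; exact: cvg_cst.
Qed.

(** A cone element with zero integral vanishes identically, as its values are comparable; L 1 does
    not. *)
Lemma lam_gt0 w : gd w -> 0 < lam w.
Proof.
move=> gw; have gw' := gd_theta gw.
have CL1 := C_L gw (C_one gw).
have bL1 := C_bmf gw' CL1.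
have l0 : 0 <= lam w.
  rewrite lamE -(nuI_cst 0 gw'); apply: le_nuI => //; first exact: bmf_cst.
  by move=> x Ex; exact: (C_ge0 gw' CL1 Ex).
rewrite lt_def l0 andbT; apply/eqP => le0.
have [x Ex] := L_one_neq0 gw; move/eqP; apply.
apply/eqP; rewrite eq_le (C_ge0 gw' CL1 Ex) andbT.
rewrite -(nuI_cst (L w one1 x) gw').
apply: (@le_trans _ _ (nuI (theta w) (fun y => CK (theta w) * L w one1 y))).
  apply: le_nuI => //; [exact: bmf_cst | exact: bmfZ |].
  by move=> y Ey; exact: (C_K gw' CL1 Ex Ey).
by rewrite nuI_Z// -lamE le0 mulr0.
Qed.

Definition Lh w f : X -> R := fun x => (lam w)^-1 * L w f x.

Section normalized_step.
Variable w : Omega.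
Hypothesis gw : gd w.
Let gw' := gd_theta gw.
Let l0 := lam_gt0 gw.

Lemma nuI_Lh f : bmf (E w) f -> nuI (theta w) (Lh w f) = nuI w f.
Proof.
move=> bf; rewrite nuI_Z; last exact: L_bmf.
by rewrite dual// mulKf// gt_eqF.
Qed.

Lemma Lh_bmf f : bmf (E w) f -> bmf (E (theta w)) (Lh w f).
Proof. by move=> bf; apply: bmfZ; exact: L_bmf. Qed.

Lemma Lh_C f : C w f -> C (theta w) (Lh w f).
Proof. by move=> Cf; apply: C_scale => //; [rewrite invr_ge0 ltW | exact: C_L]. Qed.

Lemma LhD f g x : E (theta w) x -> bmf (E w) f -> bmf (E w) g ->
  Lh w (fun z => f z + g z) x = Lh w f x + Lh w g x.
Proof. by move=> Ex bf bg; rewrite /Lh LD// mulrDr. Qed.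

Lemma LhB f g x : E (theta w) x -> bmf (E w) f -> bmf (E w) g ->
  Lh w (fun z => f z - g z) x = Lh w f x - Lh w g x.
Proof. by move=> Ex bf bg; rewrite /Lh LB// mulrBr. Qed.

Lemma LhZ c f x : E (theta w) x -> bmf (E w) f ->
  Lh w (fun z => c * f z) x = c * Lh w f x.
Proof. by move=> Ex bf; rewrite /Lh LZ// mulrCA. Qed.

Lemma le_Lh f g x : E (theta w) x -> bmf (E w) f -> bmf (E w) g ->
  (forall z, E w z -> f z <= g z) -> Lh w f x <= Lh w g x.
Proof.
move=> Ex bf bg fg; rewrite /Lh ler_wpM2l ?invr_ge0 ?(ltW l0)//.
exact: le_L.
Qed.

Lemma eq_Lh f g x : E (theta w) x -> (forall z, E w z -> f z = g z) ->
  Lh w f x = Lh w g x.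
Proof. by move=> Ex fg; rewrite /Lh (eq_L gw Ex fg). Qed.

Lemma Lh_contr f g : C w f -> C w g -> nuI w g <= nuI w f ->
  C (theta w) (fun x => (1 - de w) * Lh w f x - de w * Lh w g x).
Proof.
move=> Cf Cg fg.
have h : nuI (theta w) (L w g) <= nuI (theta w) (L w f).
  by rewrite !dual ?ler_wpM2l ?(ltW l0)//; exact: C_bmf.
have l0' : 0 <= (lam w)^-1 by rewrite invr_ge0 ltW.
apply: eq_C (C_scale gw' l0' (C_contr gw Cf Cg h)) => // x _.
by rewrite /Lh; ring.
Qed.

End normalized_step.

(* Hopf's oscillation of f / g for the order of the cone C w. *)
Definition osc_le w (g f : X -> R) (r : R) := exists a b : R,
  [/\ b - a <= r, C w (fun x => f x - a * g x) & C w (fun x => b * g x - f x)].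

Lemma osc_le_weaken w g f r r' : r <= r' -> osc_le w g f r -> osc_le w g f r'.
Proof.
by move=> rr' [a [b [h1 h2 h3]]]; exists a, b; split => //; exact: le_trans h1 rr'.
Qed.

Lemma osc_le_add w g f1 f2 r1 r2 : gd w -> osc_le w g f1 r1 -> osc_le w g f2 r2 ->
  osc_le w g (fun x => f1 x + f2 x) (r1 + r2).
Proof.
move=> gw [a1 [b1 [h1 p1 q1]]] [a2 [b2 [h2 p2 q2]]].
exists (a1 + a2), (b1 + b2); split; first lra.
- by apply: eq_C (C_add gw p1 p2) => // x _; ring.
- by apply: eq_C (C_add gw q1 q2) => // x _; ring.
Qed.

Lemma eq_osc_le w g g' f f' r : gd w -> (forall x, E w x -> f x = f' x) ->
  (forall x, E w x -> g x = g' x) -> osc_le w g f r -> osc_le w g' f' r.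
Proof.
move=> gw ff gg [a [b [h p q]]]; exists a, b; split => //.
- by apply: eq_C p => // x Ex; rewrite ff// gg.
- by apply: eq_C q => // x Ex; rewrite ff// gg.
Qed.

Lemma osc_le_shift w g f r c : gd w -> osc_le w g f r ->
  osc_le w g (fun x => f x - c * g x) r.
Proof.
move=> gw [a [b [h p q]]]; exists (a - c), (b - c); split; first lra.
- by apply: eq_C p => // x Ex; ring.
- by apply: eq_C q => // x Ex; ring.
Qed.

(* Of the two cone elements f - a g and b g - f, the one whose image has the larger integral dominates a fixed proportion of the image of their sum (b - a) g; this moves one endpoint. *)
Lemma osc_le_contract w g f r : gd w -> bmf (E w) g -> bmf (E w) f ->
  osc_le w g f r -> osc_le (theta w) (Lh w g) (Lh w f) ((1 - de w) * r).
Proof.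
move=> gw bg bf [a [b [h p q]]]; have gw' := gd_theta gw.
have d1 : de w <= 1 / 2 := de_le gw.
have d0 : 0 < de w := de_gt0 gw.
have pE x : E (theta w) x -> Lh w (fun z => f z - a * g z) x = Lh w f x - a * Lh w g x.
  by move=> Ex; rewrite LhB// ?LhZ//; exact: bmfZ.
have qE x : E (theta w) x -> Lh w (fun z => b * g z - f z) x = b * Lh w g x - Lh w f x.
  by move=> Ex; rewrite LhB// ?LhZ//; exact: bmfZ.
have hr : (1 - de w) * (b - a) <= (1 - de w) * r by rewrite ler_wpM2l//; lra.
have Lp := eq_C gw' pE (Lh_C gw p).
have Lq := eq_C gw' qE (Lh_C gw q).
have [pq|/ltW pq] := leP (nuI w (fun z => b * g z - f z)) (nuI w (fun z => f z - a * g z)).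
  exists (a + de w * (b - a)), b; split => //; first lra.
  apply: eq_C (Lh_contr gw p q pq) => // x Ex.
  by rewrite pE// qE//; ring.
exists a, (b - de w * (b - a)); split => //; first lra.
apply: eq_C (Lh_contr gw q p pq) => // x Ex.
by rewrite pE// qE//; ring.
Qed.

(** Integrating the two cone elements against nu gives a <= 0 <= b, so both endpoints have size at
    most r, and adding nonnegative multiples of g makes the bounds symmetric. *)
Lemma osc_le_center w g f r : gd w -> bmf (E w) g -> bmf (E w) f -> C w g ->
  nuI w g = 1 -> nuI w f = 0 -> osc_le w g f r ->
  C w (fun x => r * g x + f x) /\ C w (fun x => r * g x - f x).
Proof.
move=> gw bg bf Cg g1 f0 [a [b [h p q]]].
have bag c : bmf (E w) (fun x => c * g x) by exact: bmfZ.
have a0 : 0 <= - a.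
  have : nuI w (fun=> 0) <= nuI w (fun x => f x - a * g x).
    apply: le_nuI; [exact: bmf_cst | exact: bmfB |].
    by move=> x Ex; exact: (C_ge0 gw p Ex).
  by rewrite nuI_cst// nuI_B// nuI_Z// g1 f0; lra.
have b0 : 0 <= b.
  have : nuI w (fun=> 0) <= nuI w (fun x => b * g x - f x).
    apply: le_nuI; [exact: bmf_cst | exact: bmfB |].
    by move=> x Ex; exact: (C_ge0 gw q Ex).
  by rewrite nuI_cst// nuI_B// nuI_Z// g1 f0; lra.
have ra : 0 <= r + a by lra.
have rb : 0 <= r - b by lra.
split.
- by apply: eq_C (C_add gw p (C_scale gw ra Cg)) => // x _; ring.
- by apply: eq_C (C_add gw q (C_scale gw rb Cg)) => // x _; ring.
Qed.

Fixpoint Nn w n (f : X -> R) : X -> R :=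
  if n is m.+1 then Lh (thn m w) (Nn w m f) else f.

Lemma NnD w m n f : Nn w (m + n) f = Nn (thn m w) n (Nn w m f).
Proof. by elim: n => [|n ih]; rewrite ?addn0// addnS /= ih thnD. Qed.

Lemma Nn_bmf w n f : gd w -> bmf (E w) f -> bmf (E (thn n w)) (Nn w n f).
Proof. by move=> gw bf; elim: n => //= n ih; apply: Lh_bmf => //; exact: gd_thn. Qed.

Lemma Nn_C w n f : gd w -> C w f -> C (thn n w) (Nn w n f).
Proof. by move=> gw Cf; elim: n => //= n ih; apply: Lh_C => //; exact: gd_thn. Qed.

Lemma nuI_Nn w n f : gd w -> bmf (E w) f -> nuI (thn n w) (Nn w n f) = nuI w f.
Proof.
move=> gw bf; elim: n => //= n ih.
by rewrite -ih; apply: nuI_Lh; [exact: gd_thn | exact: Nn_bmf].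
Qed.

Lemma NnE w n f x : gd w -> bmf (E w) f -> E (thn n w) x ->
  Nn w n f x = Ln w n f x / lamn w n.
Proof.
move=> gw bf; elim: n x => [|n ih] x Ex /=.
  by rewrite /Defs.lamn big_ord0 divr1.
have gn := gd_thn n gw.
rewrite (eq_Lh gn (g := fun z => (lamn w n)^-1 * Ln w n f z))//; last first.
  by move=> z Ez; rewrite ih// mulrC.
rewrite LhZ//; last exact: Ln_bmf.
by rewrite /Lh /Defs.lamn big_ord_recr/= invfM; ring.
Qed.

Lemma osc_le_Nn w n f g r : gd w -> bmf (E w) g -> bmf (E w) f ->
  osc_le w g f r ->
  osc_le (thn n w) (Nn w n g) (Nn w n f) (\prod_(j < n) (1 - de (thn j w)) * r).
Proof.
move=> gw bg bf h; elim: n => [|n ih] /=; first by rewrite big_ord0 mul1r.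
have gn := gd_thn n gw.
have := osc_le_contract gn (Nn_bmf n gw bg) (Nn_bmf n gw bf) ih.
by rewrite big_ord_recr/= mulrA (mulrC (1 - _)).
Qed.

(** Two arbitrary cone elements of equal integral have no a priori bound on their oscillation.
    [C_contr] applied in both orders provides one after a single step, with endpoints de / (1 - de)
    and its inverse. *)
Lemma osc_le_first w f g : gd w -> C w f -> C w g -> nuI w f = nuI w g ->
  osc_le (theta w) (Lh w g) (Lh w f) (de w)^-1.
Proof.
move=> gw Cf Cg fg; have gw' := gd_theta gw.
have d1 : de w <= 1 / 2 := de_le gw.
have d0 : 0 < de w := de_gt0 gw.
have d10 : 0 < 1 - de w by lra.
exists (de w / (1 - de w)), ((1 - de w) / de w); split.
- rewrite lerBlDr; apply: (@le_trans _ _ (de w)^-1); last first.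
    by rewrite lerDl divr_ge0 ?ltW.
  by rewrite -[leRHS]mul1r ler_wpM2r ?invr_ge0 ?(ltW d0)//; lra.
- have h : 0 <= (1 - de w)^-1 by rewrite invr_ge0 ltW.
  have gf : nuI w g <= nuI w f by rewrite fg.
  apply: eq_C (C_scale gw' h (Lh_contr gw Cf Cg gf)) => // x _.
  by field; rewrite gt_eqF.
- have h : 0 <= (de w)^-1 by rewrite invr_ge0 ltW.
  have gf : nuI w f <= nuI w g by rewrite fg.
  apply: eq_C (C_scale gw' h (Lh_contr gw Cg Cf gf)) => // x _.
  by field; rewrite gt_eqF.
Qed.

Lemma osc_le_dist w g f r : gd w -> bmf (E w) g -> bmf (E w) f -> C w g ->
  nuI w g = 1 -> nuI w f = 1 -> osc_le w g f r -> 0 <= r ->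
  forall x, E w x -> `|f x - g x| <= r * CK w.
Proof.
move=> gw bg bf Cg g1 f1 h r0 x Ex.
have bfg : bmf (E w) (fun x => f x - 1 * g x) by apply: bmfB => //; exact: bmfZ.
have fg0 : nuI w (fun x => f x - 1 * g x) = 0.
  by rewrite nuI_B ?nuI_Z//; [rewrite g1 f1; lra | exact: bmfZ].
have [p q] := osc_le_center gw bg bfg Cg g1 fg0 (osc_le_shift 1 gw h).
have gK : g x <= CK w.
  rewrite -(nuI_cst (g x) gw) -[leRHS]mulr1 -g1 -nuI_Z//.
  apply: le_nuI => //; [exact: bmf_cst | exact: bmfZ |].
  by move=> y Ey; exact: (C_K gw Cg Ex Ey).
have h1 := C_ge0 gw p Ex; have h2 := C_ge0 gw q Ex.
have h3 : r * g x <= r * CK w by rewrite ler_wpM2l.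
by rewrite ler_norml; apply/andP; split; lra.
Qed.

(** * The equivariant density *)

Local Notation thmn := (thmn thetainv).
Local Notation hdens := (hdens theta thetainv E T phi nu').
Local Notation muint := (muint theta thetainv E T phi nu').
Hypothesis thK : cancel theta thetainv.
Hypothesis thinvK : cancel thetainv theta.
Hypothesis gd_thetainv : forall w, gd w -> gd (thetainv w).
Hypothesis gd_recurrent : forall w, gd w -> exists2 e : R, 0 < e &
  forall m, exists2 k, (m <= k)%N & e <= de (thmn k w).

Lemma gd_thmn n w : gd w -> gd (thmn n w).
Proof. by move=> gw; elim: n => //= n; exact: gd_thetainv. Qed.

Lemma thn_thmn m n w : thn n (thmn (m + n) w) = thmn m w.
Proof.
elim: n => [|n ih]; first by rewrite addn0.
by rewrite -thn_theta addnS /= thinvK ih.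
Qed.

Lemma thmn_theta n w : thmn n.+1 (theta w) = thmn n w.
Proof. by rewrite /Defs.thmn iterSr thK. Qed.

Let back w n := Nn (thmn n w) n one1.

Lemma thn_thmn0 n w : thn n (thmn n w) = w.
Proof. exact: (thn_thmn 0 n w). Qed.

Lemma back_C w n : gd w -> C w (back w n).
Proof.
move=> gw; have := Nn_C n (gd_thmn n gw) (C_one (gd_thmn n gw)).
by rewrite thn_thmn0.
Qed.

Lemma back_int w n : gd w -> nuI w (back w n) = 1.
Proof.
move=> gw; have := nuI_Nn n (gd_thmn n gw) (bmf_one (E (thmn n w))).
by rewrite thn_thmn0 => ->; rewrite nuI_cst//; exact: gd_thmn.
Qed.

Lemma back_theta w n x : back (theta w) n.+1 x = Lh w (back w n) x.
Proof. by rewrite /back thmn_theta [LHS]/= thn_thmn0. Qed.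

Lemma C_le_nuI w f x : gd w -> C w f -> E w x -> f x <= CK w * nuI w f.
Proof.
move=> gw Cf Ex; have bf := C_bmf gw Cf.
rewrite -(nuI_cst (f x) gw) -nuI_Z//.
apply: le_nuI => //; [exact: bmf_cst | exact: bmfZ |].
by move=> y Ey; exact: (C_K gw Cf Ex Ey).
Qed.

Lemma nuI_le_C w f x : gd w -> C w f -> E w x -> nuI w f <= CK w * f x.
Proof.
move=> gw Cf Ex; have bf := C_bmf gw Cf.
rewrite -(nuI_cst (CK w * f x) gw).
by apply: le_nuI => // [|y Ey]; [exact: bmf_cst | exact: (C_K gw Cf Ey Ex)].
Qed.

(** Both functions are images of cone elements of unit integral on the fibre N + 1 steps in the
    past. The first step from there produces the oscillation bound 1 / de, the other N steps
    contract it, and [CK] converts the cone order into absolute values. *)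
Lemma back_dist w N n m x : gd w -> E w x ->
  `|back w (n + N.+1) x - back w (m + N.+1) x| <=
  \prod_(j < N) (1 - de (thmn j.+1 w)) * (de (thmn N.+1 w))^-1 * CK w.
Proof.
move=> gw Ex; set v := thmn N.+1 w.
have gv : gd v by exact: gd_thmn.
have gv' := gd_theta gv.
have tv : thn N (theta v) = w by rewrite thn_theta thn_thmn0.
pose f k := Nn (thmn (k + N.+1) w) k one1.
have vE k : thn k (thmn (k + N.+1) w) = v by rewrite addnC thn_thmn.
have gk k : gd (thmn (k + N.+1) w) by exact: gd_thmn.
have fC k : C v (f k) by rewrite -(vE k); exact: (Nn_C k (gk k) (C_one (gk k))).
have f1 k : nuI v (f k) = 1.
  by rewrite -(vE k) nuI_Nn ?nuI_cst//; exact: bmf_one.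
have bE k : back w (k + N.+1) = Nn (theta v) N (Lh v (f k)).
  rewrite /back NnD vE -/(f k) -[N.+1]add1n NnD /=.
  by [].
have LC k : C (theta v) (Lh v (f k)) by apply: Lh_C.
have Lb k : bmf (E (theta v)) (Lh v (f k)) by apply: C_bmf.
have := osc_le_Nn N gv' (Lb m) (Lb n) (osc_le_first gv (fC n) (fC m) _).
rewrite !f1 => /(_ erefl); rewrite -!bE tv.
have -> : \prod_(j < N) (1 - de (thn j (theta v))) = \prod_(j < N) (1 - de (thmn j.+1 w)).
  rewrite (reindex_inj rev_ord_inj)/=; apply: eq_bigr => j _.
  rewrite thn_theta; congr (1 - de _).
  have e : N.+1 = (j.+1 + (N - j.+1).+1)%N by rewrite addnS subnKC.
  by rewrite /v [X in thmn X w]e thn_thmn.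
move=> h; apply: (osc_le_dist gw _ _ _ _ _ h) => //.
- exact/C_bmf/back_C.
- exact/C_bmf/back_C.
- exact: back_C.
- exact: back_int.
- exact: back_int.
rewrite mulr_ge0 ?invr_ge0 ?(ltW (de_gt0 gv))//.
apply: prodr_ge0 => j _; have := de_le (gd_thmn j.+1 gw); lra.
Qed.

Lemma back_cauchy w e : gd w -> 0 < e -> exists N, forall n m x, (N <= n)%N ->
  (N <= m)%N -> E w x -> `|back w n x - back w m x| <= e.
Proof.
move=> gw e0; have [r r0 hr] := gd_recurrent gw.
have [x0 Ex0] := E_neq0 gw.
have K0 : 0 <= CK w.
  have := C_K gw (C_one gw) Ex0 Ex0; rewrite /Defs.one; lra.
have dk k : 0 <= de (thmn k.+1 w) <= 1.
  have gk := gd_thmn k.+1 gw; have := de_gt0 gk; have := de_le gk; lra.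
have hr' m : exists2 k, (m <= k)%N & r <= de (thmn k.+1 w).
  by have [[//|k] mk hk] := hr m.+1; exists k.
have [N [hN1 hN2]] : exists N, r <= de (thmn N.+1 w) /\
    \prod_(j < N) (1 - de (thmn j.+1 w)) <= e * r / (CK w + 1).
  apply: (backward_product (d := fun k => de (thmn k.+1 w)) dk r0 hr').
  by rewrite divr_gt0 ?mulr_gt0 ?ltr_wpDl.
exists N.+1 => n m x nN mN Ex.
rewrite -(subnK nN) -(subnK mN); apply: le_trans (back_dist _ _ _ gw Ex) _.
have P0 : 0 <= \prod_(j < N) (1 - de (thmn j.+1 w)).
  by apply: prodr_ge0 => j _; have := dk j; lra.
apply: (@le_trans _ _ (e * r / (CK w + 1) * r^-1 * CK w)).
  rewrite ler_wpM2r//; apply: ler_pM => //.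
    by rewrite invr_ge0; case/andP: (dk N).
  by rewrite lef_pV2// posrE ?(lt_le_trans r0).
have -> : e * r / (CK w + 1) * r^-1 * CK w = e * (CK w / (CK w + 1)).
  by field; rewrite ?gt_eqF ?ltr_wpDl.
by rewrite ger_pMr// ler_pdivrMr ?ltr_wpDl// mul1r lerDl.
Qed.

(** [hdens] is a [limn], so this convergence is what gives it a meaning; [back] is the same quotient
    written with normalized operators. *)
Lemma back_cvg w x : gd w -> E w x -> (fun n => back w n x) @ \oo --> hdens w x.
Proof.
move=> gw Ex.
have -> : hdens w x = limn (fun n => back w n x).
  rewrite /Defs.hdens.
  suff -> : (fun n => back w n x) = (fun n => Ln (thmn n w) n one1 x / lamn (thmn n w) n) by [].
  apply/funext => n; rewrite /back NnE//; [exact: gd_thmn | exact: bmf_one | by rewrite thn_thmn0].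
apply: cauchy_cvgn => e e0; have [N hN] := back_cauchy gw e0.
by exists N => n m nN mN; exact: hN.
Qed.

Lemma hdens_C w : gd w -> C w (hdens w).
Proof.
move=> gw; apply: (C_lim gw (f := back w)) => [n|x Ex]; first exact: back_C.
exact: back_cvg.
Qed.

Lemma hdens_bmf w : gd w -> bmf (E w) (hdens w).
Proof. by move=> gw; apply: C_bmf => //; exact: hdens_C. Qed.

Lemma back_bound w n x : gd w -> E w x -> `|back w n x| <= CK w.
Proof.
move=> gw Ex; rewrite ger0_norm; last exact: (C_ge0 gw (back_C n gw) Ex).
by have := C_le_nuI gw (back_C n gw) Ex; rewrite back_int// mulr1.
Qed.

Lemma nuI_hdens w : gd w -> nuI w (hdens w) = 1.
Proof.
move=> gw; have [_ c] := Rint_dct (mE w) (nuE_fin w)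
  (fun n => (C_bmf gw (back_C n gw)).1) (fun n x Ex => back_bound n gw Ex)
  (fun x Ex => back_cvg gw Ex).
apply: (cvg_unique _ c) => //.
have -> : (fun n => \int[nu w]_(x in E w) back w n x) = fun=> 1.
  by apply/funext => n; exact: back_int.
exact: cvg_cst.
Qed.

Lemma Lh_hdens w x : gd w -> E (theta w) x -> Lh w (hdens w) x = hdens (theta w) x.
Proof.
move=> gw Ex; have gw' := gd_theta gw.
apply/esym/(cvg_unique _ (cvg_succ (back_cvg gw' Ex))) => //.
have -> : (fun n => back (theta w) n.+1 x) = (fun n => Lh w (back w n) x).
  by apply/funext => n; exact: back_theta.
apply: cvgMr; apply: (L_dct gw Ex (M := CK w)).
- by move=> n z Ez; exact: back_bound.
- by move=> z Ez; exact: back_cvg.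
- exact: hdens_bmf.
Qed.

Lemma hdens_lb w x : gd w -> E w x -> 1 <= CK w * hdens w x.
Proof. by move=> gw Ex; rewrite -(nuI_hdens gw); exact: (nuI_le_C gw (hdens_C gw) Ex). Qed.

Lemma hdens_gt0 w x : gd w -> E w x -> 0 < hdens w x.
Proof.
move=> gw Ex; have h0 := C_ge0 gw (hdens_C gw) Ex; have h1 := hdens_lb gw Ex.
rewrite lt_def h0 andbT; apply/eqP => e; move: h1; rewrite e; lra.
Qed.

(** * Expansion of the Laplace transform *)

Variable v : Omega -> X -> R.
Variables cc kap : Omega -> R.
Hypothesis v_bmf : forall w, gd w -> bmf (E w) (v w).
Hypothesis v_int0 : forall w, gd w -> nuI w (fun x => hdens w x * v w x) = 0.
Hypothesis v_le : forall w x, gd w -> E w x -> `|v w x| <= cc w.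
Hypothesis cc_le : forall w, gd w -> cc w <= kap w * de w.
(** The condition s^2 = 1 encodes a sign, so that one hypothesis covers cc + v and cc - v. *)
Hypothesis C_pert1 : forall w (s : R) f, gd w -> s ^+ 2 = 1 -> C w f ->
  C (theta w) (L w (fun x => (cc w + s * v w x) * f x)).
Hypothesis C_pert2 : forall w (s s' : R) f, gd w -> s ^+ 2 = 1 -> s' ^+ 2 = 1 -> C w f ->
  C (theta w) (L w (fun x => (cc w + s * v w x) * ((cc w + s' * v w x) * f x))).

Let m1 : (1 : R) ^+ 2 = 1. Proof. exact: expr1n. Qed.
Let mN1 : (-1 : R) ^+ 2 = 1. Proof. by rewrite sqrrN expr1n. Qed.

Lemma cc_ge0 w : gd w -> 0 <= cc w.
Proof. by move=> gw; have [x Ex] := E_neq0 gw; exact: le_trans (normr_ge0 _) (v_le gw Ex). Qed.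

Lemma Lh_pert1 w s f : gd w -> s ^+ 2 = 1 -> C w f ->
  C (theta w) (Lh w (fun x => (cc w + s * v w x) * f x)).
Proof.
move=> gw s1 Cf; apply: C_scale; [exact: gd_theta| |exact: C_pert1].
by rewrite invr_ge0 ltW// lam_gt0.
Qed.

Lemma Lh_pert2 w s s' f : gd w -> s ^+ 2 = 1 -> s' ^+ 2 = 1 -> C w f ->
  C (theta w) (Lh w (fun x => (cc w + s * v w x) * ((cc w + s' * v w x) * f x))).
Proof.
move=> gw s1 s1' Cf; apply: C_scale; [exact: gd_theta| |exact: C_pert2].
by rewrite invr_ge0 ltW// lam_gt0.
Qed.

Lemma osc_pert_obs w : gd w ->
  osc_le (theta w) (hdens (theta w)) (Lh w (fun x => v w x * hdens w x)) (2 * cc w).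
Proof.
move=> gw; have gw' := gd_theta gw; have bh := hdens_bmf gw; have bv := v_bmf gw.
have bvh : bmf (E w) (fun x => v w x * hdens w x) by exact: bmfM.
have Ch := hdens_C gw.
exists (- cc w), (cc w); split; first lra.
- apply: eq_C (Lh_pert1 gw m1 Ch) => // x Ex.
  rewrite (eq_Lh gw (g := fun z => cc w * hdens w z + v w z * hdens w z))//.
    by rewrite LhD ?LhZ ?Lh_hdens//; [ring | exact: bmfZ].
  by move=> z _; ring.
- apply: eq_C (Lh_pert1 gw mN1 Ch) => // x Ex.
  rewrite (eq_Lh gw (g := fun z => cc w * hdens w z - v w z * hdens w z))//.
    by rewrite LhB ?LhZ ?Lh_hdens//; exact: bmfZ.
  by move=> z _; ring.
Qed.

(* Polarization: 2 v f = (c + v)(B h + f) + (c - v)(B h - f) - 2 c B h. *)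
Lemma osc_pert_mul w f B : gd w -> bmf (E w) f ->
  C w (fun x => B * hdens w x + f x) -> C w (fun x => B * hdens w x - f x) ->
  osc_le (theta w) (hdens (theta w)) (Lh w (fun x => v w x * f x)) (2 * (cc w * B)).
Proof.
move=> gw bf Cp Cm; have gw' := gd_theta gw; have bh := hdens_bmf gw; have bv := v_bmf gw.
have bvf : bmf (E w) (fun x => v w x * f x) by exact: bmfM.
have h2 : 0 <= 1 / 2 :> R by lra.
have bL s g : bmf (E w) g -> bmf (E w) (fun x => (cc w + s * v w x) * g x).
  by move=> bg; apply: bmfM => //; apply: bmfD; [exact: bmf_cst | exact: bmfZ].
have bp : bmf (E w) (fun x => B * hdens w x + f x) by apply: bmfD => //; exact: bmfZ.
have bm : bmf (E w) (fun x => B * hdens w x - f x) by apply: bmfB => //; exact: bmfZ.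
have key s x : E (theta w) x -> 1 / 2 *
   (Lh w (fun x => (cc w + s * v w x) * (B * hdens w x + f x)) x +
    Lh w (fun x => (cc w + (- s) * v w x) * (B * hdens w x - f x)) x) =
   cc w * B * hdens (theta w) x + s * Lh w (fun x => v w x * f x) x.
  move=> Ex; have b1 := bL s _ bp; have b2 := bL (- s) _ bm.
  rewrite -(LhD gw Ex b1 b2) -(LhZ gw (1 / 2) Ex (bmfD b1 b2)).
  rewrite (eq_Lh gw (g := fun z => cc w * B * hdens w z + s * (v w z * f z)))//.
    rewrite LhD ?LhZ ?Lh_hdens//; exact: bmfZ.
  by move=> z _; field.
have sN (s : R) : s ^+ 2 = 1 -> (- s) ^+ 2 = 1 by rewrite sqrrN.
have CC s : s ^+ 2 = 1 -> C (theta w) (fun x => cc w * B * hdens (theta w) x + s * Lh w (fun x => v w x * f x) x).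
  move=> s1; apply: (eq_C gw' (key s)); apply: C_scale => //.
  apply: C_add => //; first exact: Lh_pert1.
  by apply: Lh_pert1 => //; exact: sN.
exists (- (cc w * B)), (cc w * B); split; first lra.
- by apply: eq_C (CC 1 m1) => // x _; ring.
- by apply: eq_C (CC (-1) mN1) => // x _; ring.
Qed.

(** Lower and upper bounds come from (c + v)^2 + (c - v)^2 = 2 c^2 + 2 v^2 and (c + v)(c - v) = c^2
    - v^2. *)
Lemma osc_pert_sqr w : gd w ->
  osc_le (theta w) (hdens (theta w)) (Lh w (fun x => v w x ^+ 2 / 2 * hdens w x)) (cc w ^+ 2).
Proof.
move=> gw; have gw' := gd_theta gw; have bh := hdens_bmf gw; have bv := v_bmf gw.
have Ch := hdens_C gw.
have bvh : bmf (E w) (fun x => v w x * (v w x * hdens w x)).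
  by apply: bmfM => //; exact: bmfM.
have h4 : 0 <= 1 / 4 :> R by lra.
have h2 : 0 <= 1 / 2 :> R by lra.
have bL s g : bmf (E w) g -> bmf (E w) (fun x => (cc w + s * v w x) * g x).
  by move=> bg; apply: bmfM => //; apply: bmfD; [exact: bmf_cst | exact: bmfZ].
have e2 x : E (theta w) x -> Lh w (fun x => v w x ^+ 2 / 2 * hdens w x) x =
    1 / 2 * Lh w (fun x => v w x * (v w x * hdens w x)) x.
  move=> Ex; rewrite -(LhZ gw (1 / 2) Ex bvh).
  by apply: (eq_Lh gw Ex) => z _; field.
exists (- (cc w ^+ 2 / 2)), (cc w ^+ 2 / 2); split; first lra.
- have := C_scale gw' h4 (C_add gw' (Lh_pert2 gw m1 m1 Ch) (Lh_pert2 gw mN1 mN1 Ch)).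
  apply: eq_C => // x Ex; have bb s := bL s _ (bL s _ bh).
  rewrite e2// -(LhD gw Ex (bb 1) (bb (-1))).
  rewrite (eq_Lh gw (g := fun z => 2 * cc w ^+ 2 * hdens w z + 2 * (v w z * (v w z * hdens w z))))//.
    by rewrite LhD ?LhZ ?Lh_hdens//; [field | exact: bmfZ | exact: bmfZ].
  by move=> z _; ring.
- have := C_scale gw' h2 (Lh_pert2 gw m1 mN1 Ch).
  apply: eq_C => // x Ex; rewrite e2//.
  rewrite (eq_Lh gw (g := fun z => cc w ^+ 2 * hdens w z - v w z * (v w z * hdens w z)))//.
    by rewrite LhB ?LhZ ?Lh_hdens//; [field | exact: bmfZ].
  by move=> z _; ring.
Qed.

(* Order by order in s, h + s X + s^2 Y + .. solves the equation f' = exp (- s^2 e) L (exp (s v) f) along the orbit. *)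
Fixpoint Xn w n : X -> R :=
  if n is m.+1 then
    Lh (thn m w) (fun x => v (thn m w) x * hdens (thn m w) x + Xn w m x)
  else fun=> 0.

(** Source of the second order equation. Its integral [en] is subtracted in [Yn] so that Y keeps
    integral 0, and twice the sum of the [en] turns out to be the variance of S_n. *)
Definition Wn w n x :=
  v (thn n w) x * Xn w n x + v (thn n w) x ^+ 2 / 2 * hdens (thn n w) x.

Definition en w n := nuI (thn n w) (Wn w n).

Fixpoint Yn w n : X -> R :=
  if n is m.+1 then fun x =>
    Lh (thn m w) (fun x => Yn w m x + Wn w m x) x - en w m * hdens (thn m.+1 w) x
  else fun=> 0.

(** * Correctors and the variance *)

Section expansion.
Variables (w : Omega) (N : nat) (k : R).
Hypothesis gw : gd w.
Hypothesis kapk : forall j, (j < N)%N -> kap (thn j w) <= k.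
Hypothesis k_ge0 : 0 <= k.
Let gn n : gd (thn n w) := gd_thn n gw.
Local Notation h n := (hdens (thn n w)).
Local Notation vn n := (v (thn n w)).
Local Notation En n := (E (thn n w)).

Lemma cc_lek n : (n < N)%N -> cc (thn n w) <= k * de (thn n w).
Proof.
move=> nN; apply: le_trans (cc_le (gn n)) _.
by rewrite ler_wpM2r ?kapk// ltW// de_gt0.
Qed.

Lemma cc_lek' n : (n < N)%N -> cc (thn n w) <= k.
Proof.
move=> nN; apply: le_trans (cc_lek nN) _; rewrite ler_piMr//.
have := de_le (gn n); lra.
Qed.

Lemma bvh n : bmf (En n) (fun x => vn n x * h n x).
Proof. by apply: bmfM; [exact: v_bmf | exact: hdens_bmf]. Qed.

Lemma Xn_bmf n : bmf (En n) (Xn w n).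
Proof.
elim: n => [|n ih] /=; first exact: bmf_cst.
by apply: Lh_bmf => //; apply: bmfD => //; exact: bvh.
Qed.

Lemma Wn_bmf n : bmf (En n) (Wn w n).
Proof.
have bv := v_bmf (gn n).
apply: bmfD; first by apply: bmfM => //; exact: Xn_bmf.
apply: bmfM; last exact: hdens_bmf.
by apply: (eq_bmf (f := fun x => 1 / 2 * (vn n x * vn n x))) => [x _|]; [field | apply: bmfZ; exact: bmfM].
Qed.

Lemma Yn_bmf n : bmf (En n) (Yn w n).
Proof.
elim: n => [|n ih] /=; first exact: bmf_cst.
apply: bmfB; last by apply: bmfZ; exact: (hdens_bmf (gn n.+1)).
by apply: Lh_bmf => //; apply: bmfD => //; exact: Wn_bmf.
Qed.

Lemma nuI_Xn n : nuI (thn n w) (Xn w n) = 0.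
Proof.
elim: n => [|n ih] /=; first by rewrite nuI_cst.
rewrite -[theta _]/(theta (thn n w)) nuI_Lh//; last first.
  by apply: bmfD; [exact: bvh | exact: Xn_bmf].
rewrite nuI_D; [|exact: bvh|exact: Xn_bmf].
rewrite ih addr0 -(v_int0 (gn n)).
by apply: eq_nuI => x _; rewrite mulrC.
Qed.

Lemma nuI_Yn n : nuI (thn n w) (Yn w n) = 0.
Proof.
elim: n => [|n ih] /=; first by rewrite nuI_cst.
have bYW : bmf (En n) (fun x => Yn w n x + Wn w n x).
  by apply: bmfD; [exact: Yn_bmf | exact: Wn_bmf].
have bh := hdens_bmf (gn n.+1).
rewrite -[theta _]/(theta (thn n w)) nuI_B; [|exact: Lh_bmf|exact: bmfZ].
rewrite nuI_Lh// nuI_D; [|exact: Yn_bmf|exact: Wn_bmf].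
by rewrite nuI_Z// (nuI_hdens (gn n.+1)) ih mulr1 add0r subrr.
Qed.

Lemma osc_Xn n : (n <= N)%N -> osc_le (thn n w) (h n) (Xn w n) (2 * k).
Proof.
elim: n => [|n ih] nN /=.
  exists 0, 0; split; first by rewrite subrr mulr_ge0.
  - by apply: eq_C (C_scale (gn 0) (lexx 0) (C_one (gn 0))) => // x _; ring.
  - by apply: eq_C (C_scale (gn 0) (lexx 0) (C_one (gn 0))) => // x _; ring.
have g1 := gn n.+1.
have h1 := osc_le_contract (gn n) (hdens_bmf (gn n)) (Xn_bmf n) (ih (ltnW nN)).
have h2 := osc_pert_obs (gn n).
have h1' : osc_le (thn n.+1 w) (h n.+1) (Lh (thn n w) (Xn w n)) ((1 - de (thn n w)) * (2 * k)).
  by apply: eq_osc_le h1 => // x Ex; rewrite Lh_hdens.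
have h3 := osc_le_add g1 h2 h1'.
apply: (@osc_le_weaken _ _ _ (2 * cc (thn n w) + (1 - de (thn n w)) * (2 * k))).
  by have := cc_lek nN; lra.
apply: eq_osc_le h3 => // x Ex.
by rewrite LhD//; [exact: bvh | exact: Xn_bmf].
Qed.

Lemma Xn_C n : (n <= N)%N -> C (thn n w) (fun x => 2 * k * h n x + Xn w n x) /\
  C (thn n w) (fun x => 2 * k * h n x - Xn w n x).
Proof.
move=> nN; apply: osc_le_center; [exact: gn|exact: hdens_bmf|exact: Xn_bmf|exact: hdens_C| | |].
- exact: nuI_hdens.
- exact: nuI_Xn.
- exact: osc_Xn.
Qed.

(** The balance at second order: the source oscillates by at most 4 cc k + cc^2 <= 5 k^2 de, which
    is what contraction removes from 5 k^2. *)
Lemma osc_Yn n : (n <= N)%N -> osc_le (thn n w) (h n) (Yn w n) (5 * k ^+ 2).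
Proof.
elim: n => [|n ih] nN /=.
  exists 0, 0; split; first by rewrite subrr mulr_ge0// sqr_ge0.
  - by apply: eq_C (C_scale (gn 0) (lexx 0) (C_one (gn 0))) => // x _; ring.
  - by apply: eq_C (C_scale (gn 0) (lexx 0) (C_one (gn 0))) => // x _; ring.
have g1 := gn n.+1.
have h1 := osc_le_contract (gn n) (hdens_bmf (gn n)) (Yn_bmf n) (ih (ltnW nN)).
have [Cp Cm] := Xn_C (ltnW nN).
have h2 := osc_pert_mul (gn n) (Xn_bmf n) Cp Cm.
have h2' := osc_pert_sqr (gn n).
have h1' : osc_le (thn n.+1 w) (h n.+1) (Lh (thn n w) (Yn w n)) ((1 - de (thn n w)) * (5 * k ^+ 2)).
  by apply: eq_osc_le h1 => // x Ex; rewrite Lh_hdens.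
have h3 := osc_le_shift (en w n) g1 (osc_le_add g1 h1' (osc_le_add g1 h2 h2')).
apply: osc_le_weaken (eq_osc_le g1 _ _ h3) => //; last first.
  move=> x Ex; congr (_ - _).
  have bXv : bmf (En n) (fun x => vn n x * Xn w n x).
    by apply: bmfM; [exact: v_bmf | exact: Xn_bmf].
  have bvv : bmf (En n) (fun x => vn n x ^+ 2 / 2 * h n x).
    apply: (eq_bmf (f := fun x => Wn w n x - vn n x * Xn w n x)).
      by move=> z _; rewrite /Wn; ring.
    by apply: bmfB => //; exact: Wn_bmf.
  rewrite LhD//; [|exact: Yn_bmf|exact: Wn_bmf].
  by rewrite /Wn LhD.
have c1 := cc_lek nN; have c2 := cc_lek' nN; have c0 := cc_ge0 (gn n).
have p1 : cc (thn n w) * k <= k * de (thn n w) * k by rewrite ler_wpM2r.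
have p2 : cc (thn n w) ^+ 2 <= k * de (thn n w) * k by rewrite expr2 ler_pM.
have -> : 2 * (cc (thn n w) * (2 * k)) = 4 * (cc (thn n w) * k) by ring.
rewrite mulrBl mul1r; have -> : de (thn n w) * (5 * k ^+ 2) = 5 * (k * de (thn n w) * k) by ring.
lra.
Qed.

Lemma Xn_le n x : (n <= N)%N -> En n x -> `|Xn w n x| <= 2 * k * h n x.
Proof.
move=> nN Ex; have [p q] := Xn_C nN.
have := C_ge0 (gn n) p Ex; have := C_ge0 (gn n) q Ex.
by rewrite ler_norml => ? ?; apply/andP; split; lra.
Qed.

Lemma Yn_le n x : (n <= N)%N -> En n x -> `|Yn w n x| <= 5 * k ^+ 2 * h n x.
Proof.
move=> nN Ex.
have [p q] := osc_le_center (gn n) (hdens_bmf (gn n)) (Yn_bmf n) (hdens_C (gn n))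
  (nuI_hdens (gn n)) (nuI_Yn n) (osc_Yn nN).
have := C_ge0 (gn n) p Ex; have := C_ge0 (gn n) q Ex.
by rewrite ler_norml => ? ?; apply/andP; split; lra.
Qed.

Lemma en_le n : (n < N)%N -> `|en w n| <= 3 * k ^+ 2.
Proof.
move=> nN; have bW := Wn_bmf n; have bh := hdens_bmf (gn n).
have H x : En n x -> `|Wn w n x| <= 3 * k ^+ 2 * h n x.
  move=> Ex; have h0 := hdens_gt0 (gn n) Ex.
  have v1 : `|vn n x| <= k := le_trans (v_le (gn n) Ex) (cc_lek' nN).
  have X1 := Xn_le (ltnW nN) Ex.
  apply: le_trans (ler_normD _ _) _.
  have a1 : `|vn n x * Xn w n x| <= k * (2 * k * h n x) by rewrite normrM ler_pM.
  have a2 : `|vn n x ^+ 2 / 2 * h n x| <= k ^+ 2 / 2 * h n x.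
    rewrite ger0_norm; last by rewrite mulr_ge0 ?(ltW h0)// divr_ge0// sqr_ge0.
    by rewrite ler_wpM2r ?(ltW h0)// ler_wpM2r ?invr_ge0//; exact: sqr_le_of_norm.
  have a3 : 0 <= k ^+ 2 * h n x by rewrite mulr_ge0 ?sqr_ge0 ?(ltW h0).
  have -> : 3 * k ^+ 2 * h n x = k * (2 * k * h n x) + (k ^+ 2 / 2 * h n x + k ^+ 2 * h n x / 2).
    by field.
  by lra.
have e3 : 3 * k ^+ 2 = nuI (thn n w) (fun x => 3 * k ^+ 2 * h n x).
  by rewrite nuI_Z// nuI_hdens// mulr1.
have b3 : bmf (En n) (fun x => 3 * k ^+ 2 * h n x) by exact: bmfZ.
rewrite /en ler_norml e3; apply/andP; split.
  rewrite -mulN1r -nuI_Z//; apply: le_nuI => //; first exact: bmfZ.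
  by move=> x Ex; have := H x Ex; rewrite ler_norml => /andP[]; lra.
apply: le_nuI => // x Ex.
by have := H x Ex; rewrite ler_norml => /andP[].
Qed.

Local Notation S n := (Sn theta T v w n).
Local Notation Tn n := (Tn theta T w n).

Lemma Tn_E n x : E w x -> En n (Tn n x).
Proof. by move=> Ex; elim: n => //= n ih; exact: TE. Qed.

Lemma Tn_measurable n : measurable_fun (E w) (Tn n).
Proof.
elim: n => [|n ih]; first exact: measurable_id.
have -> : Tn n.+1 = T (thn n w) \o Tn n by [].
apply: (@measurable_comp _ _ _ _ _ _ (En n) (T (thn n w)) (E w) (Tn n)) => //.
by move=> _ [x Ex <-]; exact: Tn_E.
Qed.

Lemma bmf_Tn n (f : X -> R) : bmf (En n) f -> bmf (E w) (fun x => f (Tn n x)).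
Proof.
move=> [mf [M fM]]; split; last by exists M => x Ex; apply: fM; exact: Tn_E.
apply: (@measurable_comp _ _ _ _ _ _ (En n) f (E w) (Tn n)) => //; last exact: Tn_measurable.
by move=> _ [x Ex <-]; exact: Tn_E.
Qed.

Lemma bmf_T w' (f : X -> R) : bmf (E (theta w')) f -> bmf (E w') (fun x => f (T w' x)).
Proof.
move=> [mf [M fM]]; split; last by exists M => x Ex; apply: fM; exact: TE.
apply: (@measurable_comp _ _ _ _ _ _ (E (theta w')) f (E w') (T w')) => //.
by move=> _ [x Ex <-]; exact: TE.
Qed.

Lemma nuI_comp w' (f g : X -> R) : gd w' -> bmf (E w') f -> bmf (E (theta w')) g ->
  nuI w' (fun x => g (T w' x) * f x) = nuI (theta w') (fun x => g x * Lh w' f x).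
Proof.
move=> gw' bf bg; rewrite -nuI_Lh//; last by apply: bmfM => //; exact: bmf_T.
by apply: eq_nuI => x Ex; rewrite /Lh L_comp// mulrCA.
Qed.

Lemma S_bmf n : bmf (E w) (S n).
Proof.
apply: (bmf_sum (f := fun j x => v (thn j w) (Tn j x))) => j _.
by apply: bmf_Tn; exact: v_bmf.
Qed.

Lemma S_recr n x : S n.+1 x = S n x + vn n (Tn n x).
Proof. by rewrite /Sn big_ord_recr. Qed.

Lemma nuI_hdens_comp n (g : X -> R) : bmf (En n) g ->
  nuI w (fun x => hdens w x * g (Tn n x)) = nuI (thn n w) (fun x => g x * h n x).
Proof.
elim: n g => [|n ih] g bg /=; first by apply: eq_nuI => x _; rewrite mulrC.
have bT : bmf (En n) (fun x => g (T (thn n w) x)) by exact: bmf_T.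
rewrite (ih (fun y => g (T (thn n w) y)))// nuI_comp//; last exact: hdens_bmf.
by apply: eq_nuI => x Ex; rewrite Lh_hdens.
Qed.

(** In terms of mu = h nu, Xn / h is the conditional expectation of S_n given T^n; the recursion of
    X is duality applied to the last summand. *)
Lemma nuI_hdens_S_comp n (g : X -> R) : bmf (En n) g ->
  nuI w (fun x => hdens w x * S n x * g (Tn n x)) =
  nuI (thn n w) (fun x => g x * Xn w n x).
Proof.
have bh := hdens_bmf gw.
elim: n g => [|n ih] g bg /=.
  rewrite [LHS](eq_nuI (g := fun=> 0)) ?[RHS](eq_nuI (g := fun=> 0))// => x _.
    by rewrite mulr0.
  by rewrite /Sn big_ord0 mulr0 mul0r.
have bgT : bmf (En n) (fun x => g (T (thn n w) x)) by exact: bmf_T.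
have bvg : bmf (En n) (fun x => vn n x * g (T (thn n w) x)).
  by apply: bmfM => //; exact: v_bmf.
have bX := Xn_bmf n; have bv := v_bmf (gn n).
transitivity (nuI w (fun x => hdens w x * S n x * g (T (thn n w) (Tn n x)) +
    hdens w x * (vn n (Tn n x) * g (T (thn n w) (Tn n x))))).
  by apply: eq_nuI => x Ex; rewrite S_recr; ring.
rewrite nuI_D; first last.
- by apply: bmfM => //; exact: (bmf_Tn bvg).
- by apply: bmfM; [apply: bmfM => //; exact: S_bmf | exact: (bmf_Tn bgT)].
rewrite (ih (fun y => g (T (thn n w) y)))//.
rewrite (nuI_hdens_comp (g := fun y => vn n y * g (T (thn n w) y)))//.
rewrite -nuI_D; first last.
- by apply: bmfM => //; exact: hdens_bmf.
- exact: bmfM.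
rewrite -nuI_comp//; last by apply: bmfD => //; exact: bvh.
by apply: eq_nuI => x Ex; ring.
Qed.

(** The increment of S_n^2 is 2 S_n v(T^n) + v(T^n)^2; the cross term is evaluated by
    [nuI_hdens_S_comp], and together the two terms integrate like twice [Wn]. *)
Lemma nuI_hdens_S_sqr n : nuI w (fun x => hdens w x * S n x ^+ 2) =
  2 * \sum_(j < n) en w j.
Proof.
have bh := hdens_bmf gw.
elim: n => [|n ih].
  rewrite big_ord0 mulr0 (eq_nuI (g := fun=> 0)) ?nuI_cst// => x _.
  by rewrite /Sn big_ord0 expr0n mulr0.
have bv := v_bmf (gn n); have bX := Xn_bmf n; have bS := S_bmf n.
have bvT : bmf (E w) (fun x => vn n (Tn n x)) by exact: bmf_Tn.
have bvv : bmf (En n) (fun x => vn n x * vn n x) by exact: bmfM.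
have b1 : bmf (E w) (fun x => hdens w x * S n x ^+ 2).
  by apply: (eq_bmf (f := fun x => hdens w x * (S n x * S n x))) => [x _|]; [rewrite expr2 | apply: bmfM => //; exact: bmfM].
have b2 : bmf (E w) (fun x => hdens w x * S n x * vn n (Tn n x)).
  by apply: bmfM => //; exact: bmfM.
have b3 : bmf (E w) (fun x => hdens w x * (vn n (Tn n x) * vn n (Tn n x))).
  by apply: bmfM => //; exact: bmfM.
transitivity (nuI w (fun x => hdens w x * S n x ^+ 2 +
   (2 * (hdens w x * S n x * vn n (Tn n x)) + hdens w x * (vn n (Tn n x) * vn n (Tn n x))))).
  by apply: eq_nuI => x Ex; rewrite S_recr; ring.
rewrite nuI_D//; last by apply: bmfD => //; exact: bmfZ.
rewrite nuI_D//; last exact: bmfZ.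
rewrite nuI_Z// ih (nuI_hdens_S_comp bv) (nuI_hdens_comp (g := fun y => vn n y * vn n y))//.
rewrite big_ord_recr/= mulrDr; congr (_ + _).
have bvX : bmf (En n) (fun x => vn n x * Xn w n x) by exact: bmfM.
have bvvh : bmf (En n) (fun x => vn n x * vn n x * h n x).
  by apply: bmfM => //; exact: hdens_bmf.
rewrite -nuI_Z// -nuI_D//; last exact: bmfZ.
rewrite /en -nuI_Z; last exact: Wn_bmf.
by apply: eq_nuI => x _; rewrite /Wn; field.
Qed.

(** * Exponential moments *)

Variable s : R.

(** Density, with respect to nu on the n-th fibre, of the image under T^n of the measure exp (s S_n)
    h nu. Its total mass is the Laplace transform. *)
Fixpoint Fn n : X -> R :=
  if n is m.+1 then
    Lh (thn m w) (fun x => expR (s * vn m x) * Fn m x)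
  else hdens w.

Lemma bmf_expv n (f : X -> R) : bmf (En n) f -> bmf (En n) (fun x => expR (s * vn n x) * f x).
Proof.
move=> bf; apply: bmfM => //; apply: bmf_expR; apply: bmfZ; exact: v_bmf.
Qed.

Lemma Fn_bmf n : bmf (En n) (Fn n).
Proof.
elim: n => [|n ih] /=; first exact: hdens_bmf.
by apply: Lh_bmf => //; exact: bmf_expv.
Qed.

Lemma nuI_hdens_exp n (g : X -> R) : bmf (En n) g ->
  nuI w (fun x => hdens w x * expR (s * S n x) * g (Tn n x)) =
  nuI (thn n w) (fun x => g x * Fn n x).
Proof.
elim: n g => [|n ih] g bg /=.
  by apply: eq_nuI => x _; rewrite /Sn big_ord0 mulr0 expR0 mulr1 mulrC.
have bgT : bmf (En n) (fun x => g (T (thn n w) x)) by exact: bmf_T.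
transitivity (nuI w (fun x => hdens w x * expR (s * S n x) *
    (expR (s * vn n (Tn n x)) * g (T (thn n w) (Tn n x))))).
  by apply: eq_nuI => x Ex; rewrite S_recr mulrDr expRD; ring.
rewrite (ih (fun y => expR (s * vn n y) * g (T (thn n w) y))); last exact: bmf_expv.
rewrite -nuI_comp//; last by apply: bmf_expv; exact: Fn_bmf.
by apply: eq_nuI => x Ex; ring.
Qed.

Lemma nuI_hdens_expS n : nuI w (fun x => hdens w x * expR (s * S n x)) =
  nuI (thn n w) (Fn n).
Proof.
have := nuI_hdens_exp (bmf_cst (En n) 1).
rewrite (eq_nuI (g := fun x => hdens w x * expR (s * S n x))) => [->|x _].
  by apply: eq_nuI => x _; rewrite mul1r.
by rewrite mulr1.
Qed.

Let t := `|s| * k.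
Variables K1 K2 : R.
Hypothesis expand_in : forall t p q r : R, 0 <= t -> t <= 1 / 20 ->
    `|p| <= t -> `|q| <= 2 * t -> `|r| <= 7 * t ^+ 2 ->
    `|expR (p + q + r) - (1 + p + q + r + (p + q) ^+ 2 / 2)| <= K1 * t ^+ 3.
Hypothesis expand_out : forall t q r e : R, 0 <= t -> t <= 1 / 20 ->
    `|q| <= 2 * t -> `|r| <= 7 * t ^+ 2 -> `|e| <= 3 * t ^+ 2 ->
    1 + q + r + q ^+ 2 / 2 + e + K1 * t ^+ 3 <= expR (q + r + e + K2 * t ^+ 3) /\
    expR (q + r + e - K2 * t ^+ 3) <= 1 + q + r + q ^+ 2 / 2 + e - K1 * t ^+ 3.
Hypothesis t_le : t <= 1 / 20.

(** First and second order parts in s of ln ((h + s X + s^2 Y) / h). The form exp (q + r) keeps the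
    approximate density positive and turns errors into factors. *)
Definition qn n x := s * (Xn w n x / h n x).
Definition rn n x := s ^+ 2 * (Yn w n x / h n x - (Xn w n x / h n x) ^+ 2 / 2).

Let t0 : 0 <= t. Proof. by rewrite mulr_ge0. Qed.
Let t2 : t ^+ 2 = s ^+ 2 * k ^+ 2.
Proof. by rewrite exprMn real_normK ?num_real. Qed.

Lemma qn_le n x : (n <= N)%N -> En n x -> `|qn n x| <= 2 * t.
Proof.
move=> nN Ex; have h0 := hdens_gt0 (gn n) Ex.
rewrite /qn normrM /t mulrCA ler_wpM2l// normrM normfV (gtr0_norm h0).
by rewrite ler_pdivrMr// Xn_le.
Qed.

Lemma rn_le n x : (n <= N)%N -> En n x -> `|rn n x| <= 7 * t ^+ 2.
Proof.
move=> nN Ex; have h0 := hdens_gt0 (gn n) Ex.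
rewrite /rn normrM (ger0_norm (sqr_ge0 _)) t2 mulrCA ler_wpM2l ?sqr_ge0//.
have a1 : `|Yn w n x / h n x| <= 5 * k ^+ 2.
  by rewrite normrM normfV (gtr0_norm h0) ler_pdivrMr// Yn_le.
have a2 : `|Xn w n x / h n x| <= 2 * k.
  by rewrite normrM normfV (gtr0_norm h0) ler_pdivrMr// Xn_le.
have a3 := sqr_le_of_norm a2.
have a4 : 0 <= (Xn w n x / h n x) ^+ 2 := sqr_ge0 _.
move: a1; rewrite !ler_norml => /andP[b1 b2].
have e4 : (2 * k) ^+ 2 = 4 * k ^+ 2 by ring.
rewrite e4 in a3.
by apply/andP; split; lra.
Qed.

(** Second order expansion of h exp (s v + q + r), with an error c h. The terms in X^2 / h, which
    are not linear in the correctors, cancel between r and (s v + q)^2 / 2, so the recursions of X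
    and Y apply under Lh. *)
Let Pn n c x := h n x + s * (vn n x * h n x + Xn w n x)
  + s ^+ 2 * (Yn w n x + Wn w n x) + c * h n x.

Let Pn_bmf n c : bmf (En n) (Pn n c).
Proof.
have bh := hdens_bmf (gn n).
apply: bmfD; last exact: bmfZ.
apply: bmfD; last by apply: bmfZ; apply: bmfD; [exact: Yn_bmf | exact: Wn_bmf].
by apply: bmfD => //; apply: bmfZ; apply: bmfD; [exact: bvh | exact: Xn_bmf].
Qed.

Let Lh_Pn n c x : En n.+1 x -> Lh (thn n w) (Pn n c) x =
  h n.+1 x * (1 + qn n.+1 x + rn n.+1 x + qn n.+1 x ^+ 2 / 2 + s ^+ 2 * en w n + c).
Proof.
move=> Ex; have bh := hdens_bmf (gn n).
have h0 := hdens_gt0 (gn n.+1) Ex.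
have bvX : bmf (En n) (fun x => vn n x * h n x + Xn w n x).
  by apply: bmfD; [exact: bvh | exact: Xn_bmf].
have bYW : bmf (En n) (fun x => Yn w n x + Wn w n x).
  by apply: bmfD; [exact: Yn_bmf | exact: Wn_bmf].
have gnn := gn n.
rewrite /Pn LhD//; first last.
- exact: bmfZ.
- by apply: bmfD; [apply: bmfD => //; exact: bmfZ | exact: bmfZ].
rewrite LhD//; first last.
- exact: bmfZ.
- by apply: bmfD => //; exact: bmfZ.
rewrite LhD//; last exact: bmfZ.
rewrite !LhZ// !Lh_hdens// -[Lh _ (fun z => _ + Xn _ _ _) x]/(Xn w n.+1 x).
have -> : Lh (thn n w) (fun x => Yn w n x + Wn w n x) x = Yn w n.+1 x + en w n * h n.+1 x.
  by rewrite /= subrK.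
rewrite -[hdens (theta (thn n w)) x]/(h n.+1 x) /qn /rn.
by field; rewrite gt_eqF.
Qed.

Let pointwise n x : (n < N)%N -> En n x ->
  expR (s * vn n x) * (h n x * expR (qn n x + rn n x)) <= Pn n (K1 * t ^+ 3) x /\
  Pn n (- (K1 * t ^+ 3)) x <= expR (s * vn n x) * (h n x * expR (qn n x + rn n x)).
Proof.
move=> nN Ex; have h0 := hdens_gt0 (gn n) Ex.
have pv : `|s * vn n x| <= t.
  rewrite normrM ler_wpM2l//.
  exact: le_trans (v_le (gn n) Ex) (cc_lek' nN).
have := expand_in t0 t_le pv (qn_le (ltnW nN) Ex) (rn_le (ltnW nN) Ex).
have -> : expR (s * vn n x) * (h n x * expR (qn n x + rn n x)) =
  h n x * expR (s * vn n x + qn n x + rn n x).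
  by rewrite mulrCA -expRD addrA.
have PE c : Pn n c x = h n x * (1 + s * vn n x + qn n x + rn n x + (s * vn n x + qn n x) ^+ 2 / 2 + c).
  by rewrite /Pn /Wn /qn /rn; field; rewrite gt_eqF.
rewrite !PE ler_norml => /andP[a1 a2].
by split; rewrite ler_pM2l//; lra.
Qed.

(** Inductively Fn is h exp (q + r) times the exponential of the accumulated s^2 en: expanding
    before a step and recombining after it costs a factor exp (+- K2 t^3). *)
Lemma Fn_bounds n : (n <= N)%N -> forall x, En n x ->
  Fn n x <= expR (s ^+ 2 * \sum_(j < n) en w j + n%:R * (K2 * t ^+ 3)) *
     (h n x * expR (qn n x + rn n x)) /\
  expR (s ^+ 2 * \sum_(j < n) en w j - n%:R * (K2 * t ^+ 3)) *
     (h n x * expR (qn n x + rn n x)) <= Fn n x.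
Proof.
elim: n => [|n ih] nN x Ex.
  rewrite big_ord0 mulr0 mul0r addr0 subr0 expR0 mul1r /=.
  rewrite /qn /rn /= !mul0r expr0n/= !mul0r subrr !mulr0 addr0 expR0 mulr1.
  by split.
have gnn := gn n; have h0 := hdens_gt0 (gn n.+1) Ex.
have ihn := ih (ltnW nN).
set sg := \sum_(j < n) en w j in ihn *.
have eb : `|s ^+ 2 * en w n| <= 3 * t ^+ 2.
  rewrite normrM (ger0_norm (sqr_ge0 _)) t2 mulrCA ler_wpM2l ?sqr_ge0//.
  exact: en_le.
have [ex1 ex2] := expand_out t0 t_le (qn_le nN Ex) (rn_le nN Ex) eb.
have eN : n.+1%:R * (K2 * t ^+ 3) = n%:R * (K2 * t ^+ 3) + K2 * t ^+ 3.
  by rewrite -addn1 natrD mulrDl mul1r.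
rewrite big_ord_recr/= -/sg eN; split.
  apply: (@le_trans _ _ (Lh (thn n w) (fun z =>
      expR (s ^+ 2 * sg + n%:R * (K2 * t ^+ 3)) * Pn n (K1 * t ^+ 3) z) x)).
    apply: le_Lh => //; [apply: bmf_expv; exact: Fn_bmf | exact: bmfZ |].
    move=> z Ez; have [p1 _] := pointwise nN Ez.
    have [i1 _] := ihn z Ez.
    apply: le_trans (ler_wpM2l (expR_ge0 _) i1) _.
    by rewrite mulrCA ler_wpM2l ?expR_ge0.
  rewrite LhZ// Lh_Pn//.
  apply: (@le_trans _ _ (expR (s ^+ 2 * sg + n%:R * (K2 * t ^+ 3)) * (h n.+1 x *
      expR (qn n.+1 x + rn n.+1 x + s ^+ 2 * en w n + K2 * t ^+ 3)))).
    by rewrite ler_wpM2l ?expR_ge0// ler_wpM2l ?(ltW h0).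
  rewrite mulrCA [leRHS]mulrCA -!expRD ler_wpM2l ?(ltW h0)//.
  by rewrite ler_expR mulrDr le_eqVlt; apply/orP; left; apply/eqP; ring.
apply: (@le_trans _ _ (Lh (thn n w) (fun z =>
      expR (s ^+ 2 * sg - n%:R * (K2 * t ^+ 3)) * Pn n (- (K1 * t ^+ 3)) z) x)); last first.
  apply: le_Lh => //; [exact: bmfZ | apply: bmf_expv; exact: Fn_bmf |].
  move=> z Ez; have [_ p1] := pointwise nN Ez.
  have [_ i1] := ihn z Ez.
  apply: le_trans (ler_wpM2l (expR_ge0 _) i1).
  by rewrite [leRHS]mulrCA ler_wpM2l ?expR_ge0.
rewrite LhZ// Lh_Pn//.
apply: (@le_trans _ _ (expR (s ^+ 2 * sg - n%:R * (K2 * t ^+ 3)) * (h n.+1 x *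
      expR (qn n.+1 x + rn n.+1 x + s ^+ 2 * en w n - K2 * t ^+ 3)))); last first.
  by rewrite ler_wpM2l ?expR_ge0// ler_wpM2l ?(ltW h0).
rewrite mulrCA [leRHS]mulrCA -!expRD ler_wpM2l ?(ltW h0)//.
by rewrite ler_expR mulrDr le_eqVlt; apply/orP; left; apply/eqP; ring.
Qed.

Lemma nuI_exp_bounds :
  expR (s ^+ 2 * \sum_(j < N) en w j - (N%:R * (K2 * t ^+ 3) + (2 * t + 7 * t ^+ 2)))
    <= nuI w (fun x => hdens w x * expR (s * S N x)) /\
  nuI w (fun x => hdens w x * expR (s * S N x)) <=
  expR (s ^+ 2 * \sum_(j < N) en w j + (N%:R * (K2 * t ^+ 3) + (2 * t + 7 * t ^+ 2))).
Proof.
rewrite nuI_hdens_expS; have bh := hdens_bmf (gn N); have bF := Fn_bmf N.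
have H x : En N x -> - (2 * t + 7 * t ^+ 2) <= qn N x + rn N x <= 2 * t + 7 * t ^+ 2.
  move=> Ex; rewrite -ler_norml; apply: le_trans (ler_normD _ _) _.
  by rewrite lerD ?qn_le ?rn_le.
have hE c : c = nuI (thn N w) (fun x => c * h N x) by rewrite nuI_Z// nuI_hdens// mulr1.
split.
  rewrite [leLHS]hE; apply: le_nuI => //; first exact: bmfZ.
  move=> x Ex; have h0 := hdens_gt0 (gn N) Ex.
  have [_ i] := Fn_bounds (leqnn N) Ex.
  apply: le_trans i; rewrite [leRHS]mulrCA -expRD [leLHS]mulrC ler_wpM2l ?(ltW h0)//.
  by rewrite ler_expR; have /andP[] := H x Ex; lra.
rewrite [leRHS]hE; apply: le_nuI => //; first exact: bmfZ.
move=> x Ex; have h0 := hdens_gt0 (gn N) Ex.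
have [i _] := Fn_bounds (leqnn N) Ex.
apply: le_trans i _; rewrite [leLHS]mulrCA -expRD [leRHS]mulrC ler_wpM2l ?(ltW h0)//.
by rewrite ler_expR; have /andP[] := H x Ex; lra.
Qed.

End expansion.

(** Fibrewise constants shift S_n by a constant, so the variance hypothesis on S_n u can be read for
    the centred v. *)
Lemma variance_en (u' : Omega -> X -> R) (c : Omega -> R) w n : gd w ->
  (forall w x, u' w x = v w x + c w) ->
  nuI w (fun x => hdens w x * (Sn theta T u' w n x -
     nuI w (fun x => hdens w x * Sn theta T u' w n x)) ^+ 2) = 2 * \sum_(j < n) en w j.
Proof.
move=> gw u'E; have bh := hdens_bmf gw.
pose cn := \sum_(j < n) c (thn j w).
have SE x : Sn theta T u' w n x = Sn theta T v w n x + cn.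
  by rewrite /Sn /cn -big_split; apply: eq_bigr => j _; exact: u'E.
have bS := S_bmf gw n.
have m0 : nuI w (fun x => hdens w x * Sn theta T u' w n x) = cn.
  transitivity (nuI w (fun x => hdens w x * Sn theta T v w n x * 1 + cn * hdens w x)).
    by apply: eq_nuI => x _; rewrite SE; ring.
  rewrite nuI_D; [|by apply: bmfM; [exact: bmfM | exact: bmf_cst]|exact: bmfZ].
  rewrite (nuI_hdens_S_comp gw (g := fun=> 1)); last exact: bmf_cst.
  have h1 : nuI w (fun x => hdens w x) = 1 by exact: nuI_hdens.
  rewrite [X in _ + X]nuI_Z// h1 mulr1 -[RHS]add0r; congr (_ + _).
  by rewrite -(nuI_Xn gw n); apply: eq_nuI => x _; rewrite mul1r.
rewrite -(nuI_hdens_S_sqr gw); apply: eq_nuI => x _.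
by rewrite m0 SE addrK.
Qed.

(** * Moderate deviations on a single orbit *)

Section moderate_deviations.
Variables (w : Omega) (a kn : nat -> R) (sigma : R).
Hypothesis gw : gd w.
Hypothesis kn_ge0 : forall n, 0 <= kn n.
Hypothesis kap_kn : forall n j, (j < n)%N -> kap (thn j w) <= kn n.
Hypothesis a_gt0 : forall n, 0 < a n.
Hypothesis sigma_gt0 : 0 < sigma.
Hypothesis speed : (fun n => n%:R / a n ^+ 2) @ \oo --> 0.
Hypothesis kn_a : (fun n => kn n / a n) @ \oo --> 0.
Hypothesis a_kn : (fun n => a n * kn n / n%:R) @ \oo --> 0.
Hypothesis a_kn3 : (fun n => a n * kn n ^+ 3 / n%:R) @ \oo --> 0.
Hypothesis variance : (fun n => (2 * \sum_(j < n) en w j) / n%:R) @ \oo --> sigma ^+ 2.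

Local Notation S n := (Sn theta T v w n).
Local Notation V n := (a n ^+ 2 / n%:R).

Lemma cumulant_cvg t :
  (fun n => (V n)^-1 * ln (nuI w (fun x => hdens w x * expR (t * V n * (S n x / a n)))))
    @ \oo --> t ^+ 2 * sigma ^+ 2 / 2.
Proof.
have [K1 [K2 [hin hout]]] := expR_expand R.
pose tau n := `|t * (a n / n%:R)| * kn n.
pose b n := n%:R * (K2 * tau n ^+ 3) + (2 * tau n + 7 * tau n ^+ 2).
have main : (fun n => t ^+ 2 / 2 * ((2 * \sum_(j < n) en w j) / n%:R)) @ \oo -->
    t ^+ 2 * sigma ^+ 2 / 2.
  have -> : t ^+ 2 * sigma ^+ 2 / 2 = t ^+ 2 / 2 * sigma ^+ 2 by field.
  exact: cvgMr.
(* The error b n divided by V n, rearranged so that every summand is built from the given null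
   sequences; the linear term in tau yields kn / a, the quadratic one kn^2 / n. *)
pose err n := `|t| ^+ 3 * K2 * (a n * kn n ^+ 3 / n%:R) + (2 * `|t| * (kn n / a n)
   + 7 * `|t| ^+ 2 * ((kn n / a n) * (a n * kn n / n%:R))).
have err0 : err @ \oo --> 0.
  rewrite -[0 in X in _ --> X](_ : `|t| ^+ 3 * K2 * 0 + (2 * `|t| * 0 + 7 * `|t| ^+ 2 * (0 * 0)) = 0).
    by apply: cvgD; [exact: cvgMr | apply: cvgD; [exact: cvgMr | apply: cvgMr; exact: cvgM]].
  by ring.
have tau0 : tau @ \oo --> 0.
  have -> : tau = fun n => `|t| * (a n * kn n / n%:R).
    apply/funext => n; rewrite /tau normrM (ger0_norm (_ : 0 <= a n / n%:R)).
      by ring.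
    by rewrite divr_ge0// ltW.
  by rewrite -[0 in X in _ --> X](mulr0 `|t|); exact: cvgMr.
have close : \forall n \near \oo,
  `|(V n)^-1 * ln (nuI w (fun x => hdens w x * expR (t * V n * (S n x / a n))))
    - t ^+ 2 / 2 * ((2 * \sum_(j < n) en w j) / n%:R)| <= err n.
  near=> n.
  have n0 : 0 < n%:R :> R by rewrite ltr0n; near: n; exists 1%N.
  have an := a_gt0 n.
  have t20 : tau n <= 1 / 20.
    have /andP[_ h] : 0 - 1 / 20 < tau n < 0 + 1 / 20 by near: n; apply: cvg_near_itv => //; lra.
    by apply: ltW; rewrite add0r in h.
  have [h1 h2] := nuI_exp_bounds gw (@kap_kn n) (kn_ge0 n) hin hout t20.
  rewrite -/(tau n) -/(b n) in h1 h2.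
  set m := nuI w _ in h1 h2.
  have -> : nuI w (fun x => hdens w x * expR (t * V n * (S n x / a n))) = m.
    apply: eq_nuI => x _; congr (_ * expR _).
    by field; rewrite !gt_eqF.
  have m0 : 0 < m := lt_le_trans (expR_gt0 _) h1.
  have l1 := h1; rewrite -ler_ln ?posrE ?expR_gt0// expRK in l1.
  have l2 := h2; rewrite -ler_ln ?posrE ?expR_gt0// expRK in l2.
  have tauE : tau n = `|t| * (a n / n%:R) * kn n.
    by rewrite /tau normrM (gtr0_norm (divr_gt0 an n0)).
  have bE : (V n)^-1 * b n = err n.
    by rewrite /b /err tauE; field; rewrite !gt_eqF.
  have mE' : t ^+ 2 / 2 * ((2 * \sum_(j < n) en w j) / n%:R) =
    (V n)^-1 * ((t * (a n / n%:R)) ^+ 2 * \sum_(j < n) en w j).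
    by field; rewrite !gt_eqF.
  have V0 : 0 <= (V n)^-1 by rewrite invr_ge0 divr_ge0 ?sqr_ge0// ltW.
  rewrite mE' -mulrBr normrM ger0_norm// -bE ler_wpM2l//.
  by rewrite ler_norml; apply/andP; split; lra.
apply/cvgrPdist_lt => e e0; near=> n.
have c1 : `|(V n)^-1 * ln (nuI w (fun x => hdens w x * expR (t * V n * (S n x / a n))))
    - t ^+ 2 / 2 * ((2 * \sum_(j < n) en w j) / n%:R)| <= err n by near: n.
have /andP[_ c2] : 0 - e / 2 < err n < 0 + e / 2.
  by near: n; apply: cvg_near_itv => //; lra.
have /andP[c3 c4] : t ^+ 2 * sigma ^+ 2 / 2 - e / 2 <
    t ^+ 2 / 2 * ((2 * \sum_(j < n) en w j) / n%:R) < t ^+ 2 * sigma ^+ 2 / 2 + e / 2.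
  by near: n; apply: cvg_near_itv => //; lra.
move: c1 c2 c3 c4; rewrite ler_norml ltr_norml add0r.
set A := (V n)^-1 * _; set B := t ^+ 2 / 2 * _; set Z := t ^+ 2 * _ / 2.
by move=> /andP[]; lra.
Unshelve. all: by end_near. Qed.

Variable G : set R.
Hypothesis mG : measurable G.

Lemma mumeasE n :
  mumeas theta thetainv E T phi nu' w [set x | G (S n x / a n)] =
  (\int[nu w]_(x in E w) (hdens w x * \1_G (S n x / a n)))%:E.
Proof.
have bh := hdens_bmf gw.
have bS : bmf (E w) (fun x => S n x / a n).
  by apply: (eq_bmf (f := fun x => (a n)^-1 * S n x)) => [x _|]; [rewrite mulrC | apply: bmfZ; exact: S_bmf].
have bG : bmf (E w) (fun x => \1_G (S n x / a n) : R).
  split; last by exists 1 => x _; rewrite indicE; case: (_ \in _); rewrite ?normr1 ?normr0.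
  apply: (measurableT_comp (f := \1_G : R -> R) (g := fun x => S n x / a n)).
    exact: measurable_indic.
  by case: bS.
rewrite /mumeas integral_mkcondr /Rintegral fineK; last first.
  exact: integrable_fin_num (bmf_integrable (mE w) (nuE_fin w) (bmfM bh bG)).
apply: eq_integral => x _; rewrite patchE indicE.
have -> : (x \in [set x0 | G (S n x0 / a n)]) = (S n x / a n \in G).
  by apply/idP/idP; rewrite !inE.
by case: ifPn => _; rewrite ?mulr1 ?mulr0.
Qed.

Lemma moderate_deviations :
  let s := fun n => ((n%:R / a n ^+ 2)%:E *
    elog (mumeas theta thetainv E T phi nu' w [set x | G (S n x / a n)%R]))%E in
  (- ereal_inf [set (x ^+ 2 / (2 * sigma ^+ 2))%:E | x in interior G] <= limn_einf s)%E /\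
  (limn_esup s <= - ereal_inf [set (x ^+ 2 / (2 * sigma ^+ 2))%:E | x in closure G])%E.
Proof.
move=> s; have bh := hdens_bmf gw.
have h0 x : E w x -> 0 <= hdens w x by move=> Ex; apply/ltW/hdens_gt0.
have h1 : \int[nu w]_(x in E w) (hdens w x * 1) = 1.
  rewrite -[RHS](nuI_hdens gw); apply: eq_nuI => x _; exact: mulr1.
have V0 : \forall n \near \oo, 0 < V n.
  by exists 1%N => // n /= n1; rewrite divr_gt0 ?exprn_gt0// ltr0n.
have Voo : (fun n => (V n)^-1) @ \oo --> 0.
  by have -> : (fun n => (V n)^-1) = (fun n => n%:R / a n ^+ 2) by apply/funext => n; rewrite invf_div.
have by_ n : bmf (E w) (fun x => S n x / a n).
  by apply: (eq_bmf (f := fun x => (a n)^-1 * S n x)) => [x _|]; [rewrite mulrC | apply: bmfZ; exact: S_bmf].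
have sE : \forall n \near \oo, s n = ((V n)^-1%:E *
   elog (\int[nu w]_(x in E w) (hdens w x * \1_G (S n x / a n)))%:E)%E.
  by apply: nearW => n; rewrite /s mumeasE invf_div.
split.
- exact: (quadratic_ldp_lower (mE w) (nuE_fin w) bh h0 h1 sigma_gt0 V0 Voo by_ cumulant_cvg mG sE).
- exact: (quadratic_ldp_upper (mE w) (nuE_fin w) bh h0 h1 sigma_gt0 V0 Voo by_ cumulant_cvg mG sE).
Qed.

End moderate_deviations.
End cocycle.

(** * The cone of properly expanding maps *)

Section log_holder_cone.
Context d {X : measurableType d} {R : realType}.
Variables (dist : X -> X -> R) (alpha : R).
Hypothesis dist_metric : is_metric dist.
Hypothesis dist_le1 : forall x y, dist x y <= 1.
Hypothesis borel : forall A : set X, measurable A <-> <<s dopen dist >> A.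
Hypothesis alpha_gt0 : 0 < alpha.
Local Notation da x y := (dist x y `^ alpha).

Lemma da_ge0 x y : 0 <= da x y. Proof. exact: powR_ge0. Qed.

Lemma da_le1 x y : da x y <= 1.
Proof. by apply: powR_le1 => //; [case: dist_metric | exact: ltW]. Qed.

Definition lcone (E : set X) (b : R) : set (X -> R) := [set g |
  (forall x, E x -> 0 <= g x) /\
  (forall x y, E x -> E y -> g x <= expR (b * da x y) * g y)].

Variables (E : set X) (b : R).
Hypothesis b_ge0 : 0 <= b.

Lemma lcone_add f g : lcone E b f -> lcone E b g -> lcone E b (fun x => f x + g x).
Proof.
move=> [f0 f1] [g0 g1]; split=> [x Ex|x y Ex Ey]; first by rewrite addr_ge0 ?f0 ?g0.
by rewrite mulrDr lerD ?f1 ?g1.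
Qed.

Lemma lcone_scale (c : R) f : 0 <= c -> lcone E b f -> lcone E b (fun x => c * f x).
Proof.
move=> c0 [f0 f1]; split=> [x Ex|x y Ex Ey]; first by rewrite mulr_ge0 ?f0.
by rewrite mulrCA ler_wpM2l ?f1.
Qed.

Lemma lcone_one : lcone E b (@Defs.one R d X).
Proof.
split=> [x _|x y _ _]; first exact: ler01.
by rewrite /Defs.one mulr1 -expR0 ler_expR mulr_ge0 ?da_ge0.
Qed.

Lemma lcone_lim (f : nat -> X -> R) (g : X -> R) : (forall n, lcone E b (f n)) ->
  (forall x, E x -> f^~ x @ \oo --> g x) -> lcone E b g.
Proof.
move=> fC fg; split=> [x Ex|x y Ex Ey].
  by apply: (limr_ge_cst (fg x Ex)) => n; case: (fC n) => h _; exact: h.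
have h : (fun n => expR (b * da x y) * f n y) @ \oo --> expR (b * da x y) * g y.
  by apply: cvgMr; exact: fg.
apply: (ler_cvg_seq (fg x Ex) h) => n.
by case: (fC n) => _; apply.
Qed.

Lemma lcone_K f x y : lcone E b f -> E x -> E y -> f x <= expR b * f y.
Proof.
move=> [f0 f1] Ex Ey; apply: le_trans (f1 x y Ex Ey) _.
by rewrite ler_wpM2r ?f0// ler_expR ler_piMr// da_le1.
Qed.

Lemma lcone_holder f : lcone E b f -> holder_fun dist alpha E f.
Proof.
move=> Cf; have [f0 f1] := Cf.
have [[x0 Ex0]|E0] := pselect (E !=set0); last first.
  apply/(holder_funP alpha dist_metric); split.
    by exists 0 => x Ex; exfalso; apply: E0; exists x.
  by exists 0 => // x y Ex; exfalso; apply: E0; exists x.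
have [M M0 fM] : exists2 M : R, 0 <= M & forall x, E x -> f x <= M.
  by exists (expR b * f x0) => [|x Ex]; [rewrite mulr_ge0 ?expR_ge0 ?f0 | exact: lcone_K].
apply/(holder_funP alpha dist_metric); split.
  by exists M => x Ex; rewrite ger0_norm ?f0 ?fM.
exists (b * expR b * M) => [|x y Ex Ey]; first by rewrite !mulr_ge0 ?expR_ge0.
have key z z' : E z -> E z' -> f z - f z' <= b * expR b * M * da z z'.
  move=> Ez Ez'; have h := f1 z z' Ez Ez'.
  have h0 := f0 z' Ez'; have hM := fM z' Ez'.
  have e1 : expR (b * da z z') - 1 <= b * da z z' * expR b.
    have t0 : `|b * da z z' - 0| <= b * da z z'.
      by rewrite subr0 ger0_norm// mulr_ge0 ?da_ge0.
    have := expR_diff_le t0; rewrite expR0 mul1r => /(le_trans (ler_norm _)) h'.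
    apply: le_trans h' _; rewrite ler_wpM2l ?mulr_ge0 ?da_ge0//.
    by rewrite ler_expR ler_piMr// da_le1.
  apply: (@le_trans _ _ ((expR (b * da z z') - 1) * f z')).
    by rewrite mulrBl mul1r lerB.
  apply: le_trans (ler_wpM2r h0 e1) _.
  have -> : b * expR b * M * da z z' = b * da z z' * expR b * M by ring.
  by rewrite ler_wpM2l// !mulr_ge0 ?da_ge0 ?expR_ge0.
have sym : da x y = da y x by congr (_ `^ _); case: dist_metric.
have k1 := key x y Ex Ey; have k2 := key y x Ey Ex; rewrite -sym in k2.
by rewrite ler_norml; apply/andP; split; lra.
Qed.

(** To first order in a both sides are (1 - q^2) a. The tangent line bounds for exp ((1 - q) a) and
    exp (- 2 q a) cancel exactly when inserted in the difference. *)
Lemma expR_convex_bound (q a : R) : 0 <= q <= 1 -> 0 <= a ->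
  (1 - q) * (expR a - expR (- (q * a))) <= (1 + q) * (expR a - expR (q * a)).
Proof.
move=> /andP[q0 q1] a0.
have h1 : expR (q * a) * (1 + (1 - q) * a) <= expR a.
  have -> : expR a = expR (q * a) * expR ((1 - q) * a) by rewrite -expRD; congr expR; ring.
  by rewrite ler_wpM2l ?expR_ge0// expR_ge1Dx.
have h2 : expR (q * a) * (1 - 2 * (q * a)) <= expR (- (q * a)).
  have -> : expR (- (q * a)) = expR (q * a) * expR (- (2 * (q * a))).
    by rewrite -expRD; congr expR; ring.
  by rewrite ler_wpM2l ?expR_ge0// expR_ge1Dx.
have h3 := ler_wpM2l (mulr_ge0 (ler0n R 2) q0) h1.
have q1' : 0 <= 1 - q by lra.
have h4 := ler_wpM2l q1' h2.
rewrite -subr_ge0.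
have -> : (1 + q) * (expR a - expR (q * a)) - (1 - q) * (expR a - expR (- (q * a))) =
  (2 * q * expR a - 2 * q * (expR (q * a) * (1 + (1 - q) * a))) +
  ((1 - q) * expR (- (q * a)) - (1 - q) * (expR (q * a) * (1 - 2 * (q * a)))) by ring.
by rewrite addr_ge0// subr_ge0.
Qed.

(* The room between the apertures q b and b pays for subtracting de (p + g) from p. *)
Lemma lcone_sub (q : R) p g : 0 <= q -> q < 1 ->
  lcone E (q * b) p -> lcone E (q * b) g ->
  (forall x, E x -> g x <= expR (q * b) ^+ 2 * p x) ->
  let de := (1 - q) / (1 + q) / (1 + expR (q * b) ^+ 2) in
  lcone E b (fun x => (1 - de) * p x - de * g x).
Proof.
move=> q0 q1 [p0 p1] [g0 g1] gp de.
set r := expR (q * b) ^+ 2 in gp de *.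
have r0 : 0 <= r by exact: sqr_ge0.
have q1' : 0 < 1 + q by lra.
have r1' : 0 < 1 + r by lra.
have de0 : 0 <= de by rewrite divr_ge0 ?divr_ge0// ?ltW//; lra.
have dE : de * (1 + r) = (1 - q) / (1 + q) by rewrite /de divfK// gt_eqF.
have dr1 : de * (1 + r) <= 1 by rewrite dE ler_pdivrMr//; lra.
have mp x : E x -> p x + g x <= (1 + r) * p x.
  by move=> Ex; rewrite mulrDl mul1r lerD2l gp.
have eE x : (1 - de) * p x - de * g x = p x - de * (p x + g x) by ring.
split=> [x Ex|x y Ex Ey].
  rewrite eE subr_ge0; apply: le_trans (ler_wpM2l de0 (mp x Ex)) _.
  by rewrite mulrA ler_piMl ?p0.
rewrite !eE.
set t := da x y; have t0 : 0 <= t by exact: da_ge0.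
have sym : da y x = t by congr (_ `^ _); case: dist_metric.
have P1 := p1 x y Ex Ey; rewrite -/t in P1.
have G1 : expR (- (q * b * t)) * (p y + g y) <= p x + g x.
  rewrite expRN ler_pdivrMl ?expR_gt0// mulrDr.
  by have := p1 y x Ey Ex; have := g1 y x Ey Ex; rewrite sym => *; exact: lerD.
(* Here p + g is bounded by (1 + r) p, and the ratio (1 - q) / (1 + q) inside de is the one of
   [expR_convex_bound] at a = b t. *)
have key : de * (p y + g y) * (expR (b * t) - expR (- (q * b * t))) <=
    p y * (expR (b * t) - expR (q * b * t)).
  have e0 : 0 <= expR (b * t) - expR (- (q * b * t)).
    rewrite subr_ge0 ler_expR; apply: (@le_trans _ _ 0); last exact: mulr_ge0.
    by rewrite oppr_le0 !mulr_ge0.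
  have s1 : de * (p y + g y) <= de * (1 + r) * p y by rewrite -mulrA ler_wpM2l// mp.
  apply: le_trans (ler_wpM2r e0 s1) _.
  rewrite dE mulrAC mulrC ler_wpM2l ?p0//.
  rewrite mulrAC ler_pdivrMr// [leRHS]mulrC -!mulrA.
  by apply: expR_convex_bound; [rewrite q0 ltW | exact: mulr_ge0].
have d1 : de * (expR (- (q * b * t)) * (p y + g y)) <= de * (p x + g x).
  by rewrite ler_wpM2l.
apply: (@le_trans _ _ (expR (q * b * t) * p y - de * (expR (- (q * b * t)) * (p y + g y)))).
  by apply: lerB.
rewrite -subr_ge0.
have -> : expR (b * t) * (p y - de * (p y + g y)) -
  (expR (q * b * t) * p y - de * (expR (- (q * b * t)) * (p y + g y))) =
  p y * (expR (b * t) - expR (q * b * t)) -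
  de * (p y + g y) * (expR (b * t) - expR (- (q * b * t))) by ring.
by rewrite subr_ge0.
Qed.

End log_holder_cone.

(** * Log-Hoelder bounds along inverse branches *)

Section log_holder_step.
Context d {X : measurableType d} {R : realType}.
Variables (dist : X -> X -> R) (alpha : R).
Hypothesis dist_metric : is_metric dist.
Hypothesis dist_le1 : forall x y, dist x y <= 1.
Hypothesis borel : forall A : set X, measurable A <-> <<s dopen dist >> A.
Hypothesis alpha_gt0 : 0 < alpha.
Local Notation da x y := (dist x y `^ alpha).
Variables (E E' : set X) (pre : X -> set X) (ph : X -> R)
    (I : set nat) (y : nat -> X -> X) (l H Dw : R).
Hypothesis br : branches dist alpha E E' pre ph I y l H Dw.
Hypotheses (mE : measurable E) (mE' : measurable E').
Hypothesis l_ge0 : 0 <= l.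
Let wt z := expR (ph z).
Local Notation L := (top pre wt).

Lemma branch_da x x' i : E' x -> E' x' -> I i ->
  da (y i x) (y i x') <= l `^ alpha * da x x'.
Proof.
move=> Ex Ex' Ii; have [h _] : dist (y i x) (y i x') <= l * dist x x' /\
    `|ph (y i x) - ph (y i x')| <= H * da x x' by case: br => _ _ /(_ x x' Ex Ex' i Ii).
have d0 z z' : 0 <= dist z z' by case: dist_metric.
rewrite -powRM//; apply: ge0_ler_powR => //; rewrite ?nnegrE ?mulr_ge0//.
exact: ltW.
Qed.

(** Log-Hoelder constants measured along inverse branches, in terms of the distance on the next
    fibre. They add under products, which handles one or two factors c + v in the same way. *)
Definition branch_loglip (F : X -> R) (tau : R) :=
  (forall z, E z -> 0 <= F z) /\
  (forall x x' i, E' x -> E' x' -> I i -> F (y i x) <= expR (tau * da x x') * F (y i x')).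

Lemma branch_loglipM F G t1 t2 : branch_loglip F t1 -> branch_loglip G t2 ->
  branch_loglip (fun z => F z * G z) (t1 + t2).
Proof.
move=> [F0 F1] [G0 G1]; split=> [z Ez|x x' i Ex Ex' Ii]; first by rewrite mulr_ge0 ?F0 ?G0.
rewrite mulrDl expRD mulrACA; apply: ler_pM.
- by apply: F0; exact: (branch_E br Ex Ii).
- by apply: G0; exact: (branch_E br Ex Ii).
- exact: F1.
- exact: G1.
Qed.

Lemma lcone_branch_loglip b f : 0 <= b -> lcone dist alpha E b f ->
  branch_loglip f (b * l `^ alpha).
Proof.
move=> b0 [f0 f1]; split => // x x' i Ex Ex' Ii.
have Ey := branch_E br Ex Ii; have Ey' := branch_E br Ex' Ii.
apply: le_trans (f1 _ _ Ey Ey') _; rewrite ler_wpM2r ?f0// ler_expR -mulrA.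
by rewrite ler_wpM2l// branch_da.
Qed.

(** The logarithm of c + v has Hoelder constant at most v1 / (c - U), and passing to a branch
    multiplies it by l^alpha. *)
Lemma pert_branch_loglip (v : X -> R) (c U v1 t : R) :
  (forall z, E z -> `|v z| <= U) ->
  (forall z z', E z -> E z' -> `|v z - v z'| <= v1 * da z z') ->
  0 <= v1 -> U <= c -> 0 <= t -> v1 * l `^ alpha <= t * (c - U) ->
  branch_loglip (fun z => c + v z) t.
Proof.
move=> vU vL v10 Uc t0 ht.
have cU z : E z -> c - U <= c + v z.
  by move=> /vU; rewrite ler_norml => /andP[]; lra.
split=> [z Ez|x x' i Ex Ex' Ii]; first by apply: le_trans (cU z Ez); rewrite subr_ge0.
have Ey := branch_E br Ex Ii; have Ey' := branch_E br Ex' Ii.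
have d0 := da_ge0 dist alpha x x'.
have h1 : v (y i x) <= v (y i x') + t * (c - U) * da x x'.
  rewrite -lerBlDl; apply: le_trans (ler_norm _) _; apply: le_trans (vL _ _ Ey Ey') _.
  apply: le_trans (ler_wpM2l v10 (branch_da Ex Ex' Ii)) _.
  by rewrite mulrA ler_wpM2r.
have h2 : t * (c - U) * da x x' <= t * da x x' * (c + v (y i x')).
  by rewrite mulrAC ler_wpM2l ?mulr_ge0// cU.
have h3 : 0 <= c + v (y i x') by apply: le_trans (cU _ Ey'); rewrite subr_ge0.
have h4 := ler_wpM2r h3 (expR_ge1Dx (t * da x x')).
by apply: le_trans h4; rewrite mulrDl mul1r; lra.
Qed.

Lemma lcone_top F tau : bdd E F -> branch_loglip F tau ->
  lcone dist alpha E' (H + tau) (L F).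
Proof.
move=> bF [F0 F1]; split=> [x Ex|x x' Ex Ex'].
  exact: (top_ge0 br Ex bF F0).
rewrite !(topE br)// -csumZ; last exact: (term_summable br).
have sx' := term_summable br Ex' bF.
apply: le_csum; first exact: (term_summable br).
  have sc := term_summable br Ex' (bddZ (expR ((H + tau) * da x x')) bF).
  apply: eq_integrable sc => // i _ /=.
  by rewrite mulrCA.
move=> i Ii.
have [_ h] : dist (y i x) (y i x') <= l * dist x x' /\
    `|ph (y i x) - ph (y i x')| <= H * da x x' by case: br => _ _ /(_ x x' Ex Ex' i Ii).
have e1 : wt (y i x) <= expR (H * da x x') * wt (y i x').
  rewrite /wt -expRD ler_expR; move: h; rewrite ler_norml => /andP[_]; lra.
rewrite [(H + tau) * _]mulrDl expRD.
have -> : expR (H * da x x') * expR (tau * da x x') * (wt (y i x') * F (y i x')) =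
  (expR (H * da x x') * wt (y i x')) * (expR (tau * da x x') * F (y i x')) by ring.
apply: ler_pM; [exact: expR_ge0| |exact: e1|exact: F1].
by apply: F0; exact: (branch_E br Ex Ii).
Qed.

End log_holder_step.

(** [supn] takes [fine] of an extended supremum, which would be 0 if that were infinite; the bound M
    rules this out. *)
Lemma le_supn (R : realType) (X : Type) (A : set X) (g : X -> R) (M : R) :
  (forall x, A x -> `|g x| <= M) -> forall x, A x -> g x <= supn A g.
Proof.
move=> gM x Ax; rewrite /supn.
have ub : (ereal_sup [set (g x)%:E | x in A] <= M%:E)%E.
  by apply: ge_ereal_sup => _ [z Az <-]; rewrite lee_fin (le_trans (ler_norm _) (gM z Az)).
have lb : ((g x)%:E <= ereal_sup [set (g x)%:E | x in A])%E.
  by apply: ereal_sup_ubound; exists x.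
rewrite -lee_fin fineK// fin_numE; apply/andP; split.
  by rewrite gt_eqF// (lt_le_trans _ lb)// ltNyr.
by rewrite lt_eqF// (le_lt_trans ub)// ltry.
Qed.

Lemma coshR_ge (R : realType) (x : R) : expR x / 2 <= coshR x.
Proof. by rewrite /coshR ler_wpM2r// lerDl expR_ge0. Qed.

(** * Bounds on the centred observable *)

Section observable.
Context {R : realType} {dO dX : measure_display}.
Context {Omega : measurableType dO} {X : measurableType dX}.
Variables (theta thetainv : Omega -> Omega) (dist : X -> X -> R) (alpha : R).
Variables (E : Omega -> set X) (T : Omega -> X -> X) (phi u : Omega -> X -> R).
Variable nu : Omega -> {measure set X -> \bar R}.
Hypothesis dist_metric : is_metric dist.
Hypothesis u_holder : forall w, holder_fun dist alpha (E w) (u w).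
Local Notation ut := (ut theta thetainv E T phi nu u).
Local Notation supu := (supu theta thetainv E T phi nu u).

Lemma ut_holder w : holder_fun dist alpha (E w) (ut w).
Proof.
have /(holder_funP alpha dist_metric)[[M uM] [C C0 uC]] := u_holder w.
apply/(holder_funP alpha dist_metric); split.
  exists (M + `|muint theta thetainv E T phi nu w (u w)|) => x Ex.
  by rewrite /Defs.ut (le_trans (ler_normB _ _))// lerD2r uM.
exists C => // x x' Ex Ex'; rewrite /Defs.ut.
by have -> : forall a b c : R, a - c - (b - c) = a - b by [move=> a b c; ring]; exact: uC.
Qed.

Lemma ut_le w x : E w x -> `|ut w x| <= supu w.
Proof.
have /(holder_funP alpha dist_metric)[[M uM] _] := ut_holder w.
apply: (@le_supn R X (E w) (fun x => `|ut w x|) M) => z Ez.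
by rewrite normr_id uM.
Qed.

Lemma ut_vu w x x' : E w x -> E w x' ->
  `|ut w x - ut w x'| <= vu dist alpha E u w * dist x x' `^ alpha.
Proof.
move=> Ex Ex'; rewrite /Defs.ut.
have -> : forall a b c : R, a - c - (b - c) = a - b by [move=> a b c; ring].
by apply: (hvP dist_metric) => //; case: (u_holder w).
Qed.

Lemma vu_ge0 w : 0 <= vu dist alpha E u w. Proof. exact: hv_ge0. Qed.

End observable.

(** * Cone estimates in setting A *)

Section settingA_cone.
Context {R : realType} {dO dX : measure_display}.
Context {Omega : measurableType dO} {X : measurableType dX}.
Variables (theta thetainv : Omega -> Omega) (dist : X -> X -> R) (alpha : R).
Variables (E : Omega -> set X) (T : Omega -> X -> X) (phi u : Omega -> X -> R).
Variable nu : Omega -> probability X R.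
Local Notation nu' := (fun w => nu w : {measure set X -> \bar R}).
Variables (gam HA DA : Omega -> R).
Hypothesis dist_metric : is_metric dist.
Hypothesis dist_le1 : forall x y, dist x y <= 1.
Hypothesis borel : forall A : set X, measurable A <-> <<s dopen dist >> A.
Hypothesis alpha_gt0 : 0 < alpha.
Hypothesis mE : forall w, measurable (E w).
Hypothesis u_holder : forall w, holder_fun dist alpha (E w) (u w).
(** The fibrewise clause of [settingA], named so that it can be imposed on all of [gd]. *)
Definition fibreA (w : Omega) : Prop :=
    [/\ 1 < gam w, 0 <= HA w,
     (exists (I : set nat) (y : nat -> X -> X),
       (forall x, E (theta w) x ->
          [/\ forall i, I i -> Defs.preim E T w x (y i x),
              forall z, Defs.preim E T w x z -> exists2 i, I i & y i x = z &
              forall i j, I i -> I j -> y i x = y j x -> i = j]) /\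
       (forall x x', E (theta w) x -> E (theta w) x' -> forall i, I i ->
          dist (y i x) (y i x') <= (gam w)^-1 * dist x x' /\
          `|phi w (y i x) - phi w (y i x')| <= HA w * (dist x x') `^ alpha)),
     HA w <= (gam (theta w)) `^ alpha - 1 &
     forall x, E (theta w) x ->
       (\esum_(y in Defs.preim E T w x) (expR (phi w y))%:E <= (DA w)%:E)%E].

Variables (gd : set Omega) (M : R).
Hypothesis M_ge0 : 0 <= M.
Hypothesis gd_theta : forall w, gd w -> gd (theta w).
Hypothesis gd_nuE : forall w, gd w -> nu w (E w) = 1%E.
Hypothesis gd_raw : forall w, gd w -> fibreA w.
Hypothesis gd_EA : forall w, gd w ->
  (EA dist alpha theta thetainv E T phi nu' u gam HA w <= M%:E)%E.

Local Notation L := (Lop E T phi).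
Local Notation ut := (ut theta thetainv E T phi nu' u).
Local Notation supu := (supu theta thetainv E T phi nu' u).
Local Notation vu := (vu dist alpha E u).
Local Notation q := (qA alpha theta gam HA).
Local Notation Ht := (HtA dist alpha E u gam HA).
Local Notation kp w := (gam w `^ alpha).

Definition CA w := lcone dist alpha (E w) (kp w).
Definition CKA w := expR (kp w).
Definition deA w := (1 - q w) / (1 + q w) / (1 + expR (q w * kp (theta w)) ^+ 2).
(** The second term makes each factor cc +- v log-Hoelder along branches with constant (1 - q) kp /
    2. Two such factors and the image aperture q kp add up to exactly kp, so both perturbed
    operators stay within the cone. *)
Definition ccA w := supu w + vu w * (gam w)^-1 `^ alpha * (2 / ((1 - q w) * kp (theta w))).

Lemma branchesA w : gd w -> exists I y,
  branches dist alpha (E w) (E (theta w)) (Defs.preim E T w) (phi w) I y (gam w)^-1 (HA w) (DA w).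
Proof.
move=> /gd_raw[_ _ [I [y [h1 h2]]] _ h3]; exists I, y; split => //.
by move=> x z _ [].
Qed.

Lemma kpA_ge1 w : gd w -> 1 < kp w.
Proof.
move=> /gd_raw[g1 _ _ _ _].
have h : 1 `^ alpha = 1 :> R by rewrite powR1.
by rewrite -h; apply: gt0_ltr_powR => //; rewrite ?nnegrE ?ler01// (le_trans ler01)// ltW.
Qed.

Lemma kpA_inv w : gd w -> kp w * (gam w)^-1 `^ alpha = 1.
Proof.
move=> /gd_raw[g1 _ _ _ _]; have g0 : 0 < gam w by lra.
by rewrite -powRM ?invr_ge0 ?(ltW g0)// divff ?gt_eqF// powR1.
Qed.

Lemma qA_kp w : gd w -> q w * kp (theta w) = HA w + 1.
Proof.
move=> gw; have k1 := kpA_ge1 (gd_theta gw).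
by rewrite /qA powRN mulfVK// gt_eqF//; lra.
Qed.

Lemma qA_ge0 w : gd w -> 0 <= q w.
Proof.
move=> gw; have [_ h _ _ _] := gd_raw gw.
by rewrite /qA mulr_ge0 ?powR_ge0// addr_ge0.
Qed.

Lemma HtA_ge w : gd w -> vu w * (gam w)^-1 `^ alpha <= Ht w /\ 0 <= Ht w.
Proof.
move=> gw; have [g1 h _ _ _] := gd_raw gw.
have -> : (gam w)^-1 `^ alpha = (gam w) `^ (- alpha).
  have k1 := kpA_inv gw; have k2 := kpA_ge1 gw.
  by rewrite powRN; apply: (mulfI (lt0r_neq0 (lt_trans ltr01 k2))); rewrite k1 divff// gt_eqF// (lt_trans ltr01).
by rewrite /HtA mulrC lerDl h; split => //; rewrite addr_ge0// mulr_ge0 ?powR_ge0 ?vu_ge0.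
Qed.

(** A finite E_w forces q < 1 and a positive denominator in c_0, since [DfA] and [c0A] are +oo
    otherwise. *)
Lemma EA_unfold w : gd w -> q w < 1 /\
  exists D : R, [/\ D = kp (theta w) + 2 * ln ((1 + q w) / (1 - q w)),
   0 < kp (theta w) - 1 - Ht w &
   (3 * supu w + Ht w / (kp (theta w) - 1 - Ht w)) * (1 + coshR (7 * D / 2)) <= M].
Proof.
move=> gw; have := gd_EA gw; rewrite /EA /c0A /DfA.
case: ifPn => // h1; case: ifPn => // h2.
rewrite /= lee_fin => h3; split => //.
by exists (kp (theta w) + 2 * ln ((1 + q w) / (1 - q w))); split.
Qed.

Lemma qA_lt1 w : gd w -> q w < 1. Proof. by move=> /EA_unfold[]. Qed.

Lemma deA_gt0 w : gd w -> 0 < deA w.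
Proof.
move=> gw; have q0 := qA_ge0 gw; have q1 := qA_lt1 gw.
apply: divr_gt0; last by apply: ltr_wpDr => //; exact: sqr_ge0.
by apply: divr_gt0; lra.
Qed.

Lemma deA_le w : gd w -> deA w <= 1 / 2.
Proof.
move=> gw; have q0 := qA_ge0 gw; have q1 := qA_lt1 gw.
have k1 := kpA_ge1 (gd_theta gw).
have e1 : 1 <= expR (q w * kp (theta w)) ^+ 2.
  by rewrite exprn_ege1// -expR0 ler_expR mulr_ge0// (le_trans ler01)// ltW.
rewrite /deA ler_pdivrMr; last by apply: ltr_wpDr => //; exact: sqr_ge0.
apply: (@le_trans _ _ 1); last by lra.
by rewrite ler_pdivrMr; lra.
Qed.

(* With Q = (1+q)/(1-q) and W = exp(2 kp) Q^2, W/2 bounds the hyperbolic cosine in E_w from below. *)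
Lemma ccA_le w : gd w -> ccA w <= (12 * M) * deA w.
Proof.
move=> gw; have q0 := qA_ge0 gw; have [q1 [D [DE hd h]]] := EA_unfold gw.
have k1 := kpA_ge1 (gd_theta gw).
have [v1 v2] := HtA_ge gw.
have E0 : E w !=set0.
  apply/set0P/eqP => E0; have := gd_nuE gw; rewrite E0 measure0 => /eqP.
  by rewrite eqe eq_sym oner_eq0.
have U0 : 0 <= supu w.
  by have [x Ex] := E0; exact: le_trans (normr_ge0 _) (ut_le theta thetainv T phi nu' dist_metric u_holder Ex).
have q2 : 0 < 1 - q w by lra.
set Q := (1 + q w) / (1 - q w) in DE.
have Q1 : 1 <= Q by rewrite /Q ler_pdivlMr//; lra.
have Q0 : 0 < Q by lra.
set k := kp (theta w) in DE hd h k1 *.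
have lnQ0 : 0 <= ln Q by rewrite ln_ge0.
set W := expR (2 * k) * Q ^+ 2.
have W0 : 0 < W by rewrite mulr_gt0 ?expR_gt0 ?exprn_gt0.
have hW : W / 2 <= 1 + coshR (7 * D / 2).
  apply: le_trans (_ : coshR (7 * D / 2) <= _); last by rewrite lerDr.
  apply: le_trans (coshR_ge _); rewrite ler_wpM2r ?invr_ge0//.
  have -> : W = expR (2 * k + (ln Q + ln Q)) by rewrite /W !expRD lnK ?posrE// expr2.
  by rewrite ler_expR DE; lra.
have c00 : 0 <= 3 * supu w + Ht w / (k - 1 - Ht w).
  by apply: addr_ge0; [exact: mulr_ge0 | apply: divr_ge0 => //; exact: ltW].
have h' : (3 * supu w + Ht w / (k - 1 - Ht w)) * (W / 2) <= M.
  by apply: le_trans (ler_wpM2l c00 hW) h.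
have hU : supu w <= M / W.
  rewrite ler_pdivlMr//.
  have : 3 * supu w * (W / 2) <= M.
    apply: le_trans h'; apply: ler_wpM2r; first by rewrite divr_ge0// ltW.
    by rewrite lerDl divr_ge0// ltW.
  have UW : 0 <= supu w * W by apply: mulr_ge0 => //; exact: ltW.
  by move: UW; lra.
(* The denominator k - 1 - Ht of c_0 is at most k, so the bound on the quotient bounds Ht itself. *)
have hH : Ht w <= 2 * M / W * k.
  have : Ht w / (k - 1 - Ht w) * (W / 2) <= M.
    apply: le_trans h'; apply: ler_wpM2r; first by rewrite divr_ge0// ltW.
    by rewrite lerDr mulr_ge0.
  rewrite mulrAC ler_pdivrMr// => h2.
  rewrite mulrAC ler_pdivlMr//.
  have h3 : M * (k - 1 - Ht w) <= M * k by rewrite ler_wpM2l//; lra.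
  by lra.
have cc1 : ccA w <= M / W + 2 * M / W * (2 * Q).
  rewrite /ccA; apply: lerD => //.
  have z0 : 0 <= 2 / ((1 - q w) * k) by rewrite divr_ge0// mulr_ge0// ?ltW//; lra.
  apply: le_trans (ler_wpM2r z0 (le_trans v1 hH)) _.
  have -> : 2 * M / W * k * (2 / ((1 - q w) * k)) = 2 * M / W * (2 * (1 - q w)^-1).
    by field; rewrite !gt_eqF//; lra.
  have MW0 : 0 <= 2 * M / W by apply: divr_ge0; [exact: mulr_ge0 | exact: ltW].
  apply: ler_wpM2l => //; apply: ler_wpM2l => //.
  rewrite /Q -[leLHS]mul1r ler_wpM2r ?invr_ge0 ?(ltW q2)//; lra.
(* Both 1 and exp (q k)^2 are at most exp (2 k). *)
have deE : 1 / (2 * Q * expR (2 * k)) <= deA w.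
  have -> : 1 / (2 * Q * expR (2 * k)) = (1 - q w) / (1 + q w) / (expR (2 * k) + expR (2 * k)).
    rewrite -mulr2n -mulr_natl /Q; have q3 : 0 < 1 + q w by lra.
    by field; rewrite !gt_eqF// expR_gt0.
  rewrite /deA -/k; apply: ler_wpM2l; first by rewrite divr_ge0//; lra.
  rewrite lef_pV2 ?posrE; first last.
  - by apply: ltr_wpDr => //; exact: sqr_ge0.
  - by rewrite addr_gt0 ?expR_gt0.
  apply: lerD.
    by apply: le_trans (expR_ge1Dx (2 * k)); lra.
  rewrite expr2 -expRD ler_expR.
  have : q w * k <= k by rewrite ler_piMl//; lra.
  lra.
apply: le_trans cc1 _.
have M12 : 0 <= 12 * M by rewrite mulr_ge0.
apply: le_trans (ler_wpM2l M12 deE).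
have -> : 12 * M * (1 / (2 * Q * expR (2 * k))) = M / W * (6 * Q).
  by rewrite /W; field; rewrite !gt_eqF ?expR_gt0.
have -> : M / W + 2 * M / W * (2 * Q) = M / W * (1 + 4 * Q) by field; rewrite gt_eqF.
by apply: ler_wpM2l; [apply: divr_ge0 => //; exact: ltW | lra].
Qed.

(** Along branches the aperture kp shrinks to 1; adding the distortion H of the weights gives H + 1,
    which is q times the aperture on the next fibre. *)
Lemma CA_L w f : gd w -> CA w f -> lcone dist alpha (E (theta w)) (q w * kp (theta w)) (L w f).
Proof.
move=> gw Cf; have [I [y br]] := branchesA gw.
have [g1 _ _ _ _] := gd_raw gw.
have k0 : 0 <= kp w := powR_ge0 _ _.
have l0 : 0 <= (gam w)^-1 by rewrite invr_ge0; lra.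
rewrite qA_kp//; have bf : bmf (E w) f.
  exact: (holder_bmf dist_metric borel alpha_gt0 (mE w) (lcone_holder dist_metric dist_le1 alpha_gt0 k0 Cf)).
have := lcone_branch_loglip dist_metric alpha_gt0 br l0 k0 Cf.
rewrite kpA_inv// => h.
exact: (lcone_top br (bmf_bdd bf) h).
Qed.

Lemma lconeW A (b b' : R) f : b <= b' -> lcone dist alpha A b f -> lcone dist alpha A b' f.
Proof.
move=> bb [f0 f1]; split => // x z Ax Az; apply: le_trans (f1 x z Ax Az) _.
by rewrite ler_wpM2r ?f0// ler_expR ler_wpM2r// da_ge0.
Qed.

Lemma CA_L' w f : gd w -> CA w f -> CA (theta w) (L w f).
Proof.
move=> gw Cf; apply: lconeW (CA_L gw Cf).
have k1 := kpA_ge1 (gd_theta gw); rewrite ler_piMl//; last exact/ltW/qA_lt1.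
exact: le_trans ler01 (ltW k1).
Qed.

(** Comparing integrals is enough: the values of an image are within a factor exp (q kp) of its
    integral, hence L g <= exp (q kp)^2 L f pointwise. *)
Lemma CA_contr w f g : gd w -> CA w f -> CA w g ->
  nuI E nu (theta w) (L w g) <= nuI E nu (theta w) (L w f) ->
  CA (theta w) (fun x => (1 - deA w) * L w f x - deA w * L w g x).
Proof.
move=> gw Cf Cg fg; have gw' := gd_theta gw.
have k0 : 0 <= kp (theta w) := powR_ge0 _ _.
have Lf := CA_L gw Cf; have Lg := CA_L gw Cg.
have q0 := qA_ge0 gw.
have qk0 : 0 <= q w * kp (theta w) by rewrite mulr_ge0.
apply: (lcone_sub dist_metric k0 q0 (qA_lt1 gw) Lf Lg) => x Ex.
have bL h : lcone dist alpha (E (theta w)) (q w * kp (theta w)) h -> bmf (E (theta w)) h.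
  move=> Ch; exact: (holder_bmf dist_metric borel alpha_gt0 (mE _) (lcone_holder dist_metric dist_le1 alpha_gt0 qk0 Ch)).
set r := expR (q w * kp (theta w)).
have h1 : L w g x <= r * nuI E nu (theta w) (L w g).
  rewrite -(nuI_cst mE gd_nuE (L w g x) gw') -(nuI_Z _ mE)//; last exact: bL.
  apply: (le_nuI _ mE) => //; [exact: bmf_cst | apply: bmfZ; exact: bL |].
  by move=> z Ez; exact: (lcone_K dist_metric dist_le1 alpha_gt0 qk0 Lg).
have h2 : nuI E nu (theta w) (L w f) <= r * L w f x.
  rewrite -(nuI_cst mE gd_nuE (r * L w f x) gw').
  apply: (le_nuI _ mE) => //; [exact: bL | exact: bmf_cst |].
  by move=> z Ez; exact: (lcone_K dist_metric dist_le1 alpha_gt0 qk0 Lf).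
rewrite expr2 -mulrA; apply: le_trans h1 _; rewrite ler_wpM2l ?expR_ge0//.
exact: le_trans fg h2.
Qed.

Let pertA w (s : R) : gd w -> s ^+ 2 = 1 -> forall I y,
  branches dist alpha (E w) (E (theta w)) (Defs.preim E T w) (phi w) I y (gam w)^-1 (HA w) (DA w) ->
  branch_loglip dist alpha (E w) (E (theta w)) I y (fun z => ccA w + s * ut w z) ((1 - q w) * kp (theta w) / 2).
Proof.
move=> gw s1 I y br; have [g1 _ _ _ _] := gd_raw gw.
have l0 : 0 <= (gam w)^-1 by rewrite invr_ge0; lra.
have q1 := qA_lt1 gw; have k1 := kpA_ge1 (gd_theta gw).
have k0 : 0 < kp (theta w) by lra.
have q2 : 0 < 1 - q w by lra.
have z0 : 0 <= vu w * (gam w)^-1 `^ alpha by rewrite mulr_ge0 ?vu_ge0 ?powR_ge0.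
have sn : `|s| = 1 by apply/eqP; rewrite -sqr_norm_eq1 s1.
apply: (pert_branch_loglip dist_metric alpha_gt0 br l0 (U := supu w) (v1 := vu w)).
- by move=> z Ez; rewrite normrM sn mul1r; exact: (ut_le _ _ _ _ _ dist_metric u_holder).
- by move=> z z' Ez Ez'; rewrite -mulrBr normrM sn mul1r; exact: (ut_vu _ _ _ _ _ dist_metric u_holder).
- exact: vu_ge0.
- rewrite /ccA lerDl mulr_ge0// divr_ge0// mulr_ge0 ?ltW//.
- by rewrite divr_ge0// mulr_ge0 ?ltW.
rewrite /ccA addrAC subrr add0r le_eqVlt; apply/orP; left; apply/eqP.
by field; rewrite !gt_eqF.
Qed.

Let CA_bdd w f : CA w f -> bdd (E w) f.
Proof.
move=> Cf; have k0 : 0 <= kp w := powR_ge0 _ _.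
exact: (bmf_bdd (holder_bmf dist_metric borel alpha_gt0 (mE w) (lcone_holder dist_metric dist_le1 alpha_gt0 k0 Cf))).
Qed.

Let bddM (A : set X) (f g : X -> R) : bdd A f -> bdd A g -> bdd A (fun x => f x * g x).
Proof.
by move=> [B fB] [N gN]; exists (B * N) => x Ax; rewrite normrM ler_pM ?fB ?gN.
Qed.

Let pert_bdd w s : bdd (E w) (fun x => ccA w + s * ut w x).
Proof.
have /(holder_funP alpha dist_metric)[[B uB] _] := ut_holder theta thetainv T phi nu' dist_metric u_holder w.
exists (`|ccA w| + `|s| * B) => x Ex; apply: le_trans (ler_normD _ _) _.
by rewrite lerD2l normrM ler_wpM2l ?uB.
Qed.

Lemma CA_pert1 w (s : R) f : gd w -> s ^+ 2 = 1 -> CA w f ->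
  CA (theta w) (L w (fun x => (ccA w + s * ut w x) * f x)).
Proof.
move=> gw s1 Cf; have [I [y br]] := branchesA gw; have [g1 _ _ _ _] := gd_raw gw.
have k0 : 0 <= kp w := powR_ge0 _ _.
have l0 : 0 <= (gam w)^-1 by rewrite invr_ge0; lra.
have := lcone_branch_loglip dist_metric alpha_gt0 br l0 k0 Cf; rewrite kpA_inv// => hf.
have h := branch_loglipM br (pertA gw s1 br) hf.
apply: lconeW (lcone_top br (bddM (pert_bdd w s) (CA_bdd Cf)) h).
have e := qA_kp gw; have q1 := qA_lt1 gw; have k1 := kpA_ge1 (gd_theta gw).
have : 0 <= (1 - q w) * kp (theta w) by rewrite mulr_ge0//; lra.
by lra.
Qed.

Lemma CA_pert2 w (s s' : R) f : gd w -> s ^+ 2 = 1 -> s' ^+ 2 = 1 -> CA w f ->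
  CA (theta w) (L w (fun x => (ccA w + s * ut w x) * ((ccA w + s' * ut w x) * f x))).
Proof.
move=> gw s1 s1' Cf; have [I [y br]] := branchesA gw; have [g1 _ _ _ _] := gd_raw gw.
have k0 : 0 <= kp w := powR_ge0 _ _.
have l0 : 0 <= (gam w)^-1 by rewrite invr_ge0; lra.
have := lcone_branch_loglip dist_metric alpha_gt0 br l0 k0 Cf; rewrite kpA_inv// => hf.
have h := branch_loglipM br (pertA gw s1 br) (branch_loglipM br (pertA gw s1' br) hf).
apply: lconeW (lcone_top br (bddM (pert_bdd w s) (bddM (pert_bdd w s') (CA_bdd Cf))) h).
by have e := qA_kp gw; lra.
Qed.

Lemma supu_le_ccA w : gd w -> supu w <= ccA w.
Proof.
move=> gw; have q1 := qA_lt1 gw; have k1 := kpA_ge1 (gd_theta gw).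
rewrite /ccA lerDl mulr_ge0//; first by rewrite mulr_ge0 ?vu_ge0 ?powR_ge0.
by rewrite divr_ge0// mulr_ge0//; lra.
Qed.

End settingA_cone.

(** * The cone of partially expanding maps *)

Section holder_cone.
Context d {X : measurableType d} {R : realType}.
Variables (dist : X -> X -> R) (alpha : R).
Hypothesis dist_metric : is_metric dist.
Hypothesis dist_le1 : forall x y, dist x y <= 1.
Hypothesis alpha_gt0 : 0 < alpha.
Local Notation da x y := (dist x y `^ alpha).

(* The inequality with all x'' says v(g) <= b inf g without mentioning an infimum. *)
Definition hcone (E : set X) (b : R) : set (X -> R) := [set g |
  (forall x, E x -> 0 <= g x) /\
  (forall x y z, E x -> E y -> E z -> `|g x - g y| <= b * da x y * g z)].

Variables (E : set X) (b : R).
Hypothesis b_ge0 : 0 <= b.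

Lemma hcone_add f g : hcone E b f -> hcone E b g -> hcone E b (fun x => f x + g x).
Proof.
move=> [f0 f1] [g0 g1]; split=> [x Ex|x y z Ex Ey Ez]; first by rewrite addr_ge0 ?f0 ?g0.
rewrite mulrDr opprD addrACA; apply: le_trans (ler_normD _ _) _.
by rewrite lerD ?f1 ?g1.
Qed.

Lemma hcone_scale (c : R) f : 0 <= c -> hcone E b f -> hcone E b (fun x => c * f x).
Proof.
move=> c0 [f0 f1]; split=> [x Ex|x y z Ex Ey Ez]; first by rewrite mulr_ge0 ?f0.
by rewrite -mulrBr normrM ger0_norm// mulrCA ler_wpM2l ?f1.
Qed.

Lemma hcone_one : hcone E b (@Defs.one R d X).
Proof.
split=> [x _|x y z _ _ _]; first exact: ler01.
by rewrite /Defs.one subrr normr0 mulr1 mulr_ge0 ?da_ge0.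
Qed.

Lemma hcone_lim (f : nat -> X -> R) (g : X -> R) : (forall n, hcone E b (f n)) ->
  (forall x, E x -> f^~ x @ \oo --> g x) -> hcone E b g.
Proof.
move=> fC fg; split=> [x Ex|x y z Ex Ey Ez].
  by apply: (limr_ge_cst (fg x Ex)) => n; case: (fC n) => h _; exact: h.
have h1 : (fun n => `|f n x - f n y|) @ \oo --> `|g x - g y|.
  by apply: cvg_norm; apply: cvgB; exact: fg.
have h2 : (fun n => b * da x y * f n z) @ \oo --> b * da x y * g z.
  by apply: cvgMr; exact: fg.
apply: (ler_cvg_seq h1 h2) => n.
by case: (fC n) => _; apply.
Qed.

Lemma hcone_K f x y : hcone E b f -> E x -> E y -> f x <= (1 + b) * f y.
Proof.
move=> [f0 f1] Ex Ey; rewrite mulrDl mul1r -lerBlDl.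
apply: le_trans (ler_norm _) _; apply: le_trans (f1 x y y Ex Ey Ey) _.
by rewrite ler_wpM2r ?f0// ler_piMr// da_le1.
Qed.

Lemma hcone_inf f : hcone E b f -> E !=set0 -> exists2 m, 0 <= m &
  (forall x, E x -> m <= f x <= (1 + b) * m) /\
  (forall x y, E x -> E y -> `|f x - f y| <= b * m * da x y).
Proof.
move=> Cf [x0 Ex0]; have [f0 f1] := Cf.
pose A := f @` E; pose m := inf A.
have A0 : A !=set0 by exists (f x0), x0.
have lA : has_lbound A by exists 0 => _ [x Ex <-]; exact: f0.
have key (c t : R) : 0 <= c -> (forall x, E x -> t <= c * f x) -> t <= c * m.
  rewrite le_eqVlt => /predU1P[<-|c0] h; first by have := h x0 Ex0; rewrite !mul0r.
  rewrite -ler_pdivrMl//; apply: lb_le_inf => // _ [x Ex <-].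
  by rewrite ler_pdivrMl// h.
have m0 : 0 <= m by rewrite -[m]mul1r; apply: key => // x Ex; rewrite mul1r f0.
exists m => //; split=> [x Ex|x y Ex Ey].
  apply/andP; split; first by apply: ge_inf => //; exists x.
  by apply: key => [|z Ez]; [rewrite addr_ge0 | exact: hcone_K].
rewrite mulrAC; apply: key => [|z Ez]; first by rewrite mulr_ge0 ?da_ge0.
exact: f1.
Qed.

Lemma hcone_holder f : hcone E b f -> holder_fun dist alpha E f.
Proof.
move=> Cf; have [E0|E0] := pselect (E !=set0); last first.
  apply/(holder_funP alpha dist_metric); split.
    by exists 0 => x Ex; exfalso; apply: E0; exists x.
  by exists 0 => // x y Ex; exfalso; apply: E0; exists x.
have [m m0 [h1 h2]] := hcone_inf Cf E0.
apply/(holder_funP alpha dist_metric); split.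
  exists ((1 + b) * m) => x Ex; case/andP: (h1 x Ex) => h3 h4.
  by rewrite ger0_norm ?(le_trans m0).
by exists (b * m) => //; rewrite mulr_ge0.
Qed.

Lemma hconeW (b' : R) f : b <= b' -> hcone E b f -> hcone E b' f.
Proof.
move=> bb [f0 f1]; split => // x y z Ex Ey Ez; apply: le_trans (f1 x y z Ex Ey Ez) _.
by rewrite ler_wpM2r ?f0// ler_wpM2r// da_ge0.
Qed.

(** The analogue of [lcone_sub], with linear inequalities. From de (1 + r)(1 + z) = 1 - z, what
    remains after bounding g by r p is de (1 + z)(1 - de (1 + r)) p, which is nonnegative. *)
Lemma hcone_sub (z r : R) p g : 0 <= z -> z < 1 -> 0 <= r ->
  hcone E (z * b) p -> hcone E (z * b) g ->
  (forall x, E x -> g x <= r * p x) ->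
  let de := (1 - z) / (1 + z) / (1 + r) in
  hcone E b (fun x => (1 - de) * p x - de * g x).
Proof.
move=> z0 z1 r0 [p0 p1] [g0 g1] gp de.
have z1' : 0 < 1 + z by lra.
have r1' : 0 < 1 + r by lra.
have de0 : 0 <= de by rewrite divr_ge0 ?divr_ge0// ?ltW//; lra.
have dE : de * (1 + r) = (1 - z) / (1 + z) by rewrite /de divfK// gt_eqF.
have dE' : de * (1 + r) * (1 + z) = 1 - z by rewrite dE divfK// gt_eqF.
have dr1 : de * (1 + r) <= 1 by rewrite dE ler_pdivrMr//; lra.
have d1 : de <= 1 by apply: le_trans dr1; rewrite ler_peMr//; lra.
clearbody de.
have eE x : (1 - de) * p x - de * g x = p x - de * (p x + g x) by ring.
split=> [x Ex|x y x' Ex Ey Ex'].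
  rewrite eE subr_ge0; apply: le_trans (_ : de * ((1 + r) * p x) <= _).
    by rewrite ler_wpM2l// mulrDl mul1r lerD2l gp.
  by rewrite mulrA ler_piMl ?p0.
have t0 := da_ge0 dist alpha x y; set t := da x y in t0 *.
have h1 : `|((1 - de) * p x - de * g x) - ((1 - de) * p y - de * g y)| <=
    (1 - de) * (z * b * t * p x') + de * (z * b * t * g x').
  have -> : ((1 - de) * p x - de * g x) - ((1 - de) * p y - de * g y) =
    (1 - de) * (p x - p y) - de * (g x - g y) by ring.
  apply: le_trans (ler_normB _ _) _; rewrite !normrM (ger0_norm de0) ger0_norm ?subr_ge0//.
  by apply: lerD; rewrite ler_wpM2l ?subr_ge0 ?p1 ?g1.
apply: le_trans h1 _; rewrite -subr_ge0.
have -> : b * t * ((1 - de) * p x' - de * g x') -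
  ((1 - de) * (z * b * t * p x') + de * (z * b * t * g x')) =
  b * t * ((1 - z) * (1 - de) * p x' - de * (1 + z) * g x') by ring.
rewrite mulr_ge0 ?mulr_ge0// subr_ge0.
have h2 : de * (1 + z) * g x' <= de * (1 + z) * (r * p x').
  by rewrite ler_wpM2l ?gp// mulr_ge0// ltW.
apply: le_trans h2 _; rewrite mulrA ler_wpM2r ?p0// -dE' -subr_ge0.
have -> : de * (1 + r) * (1 + z) * (1 - de) - de * (1 + z) * r =
  de * (1 + z) * (1 - de * (1 + r)) by ring.
by apply: mulr_ge0; rewrite ?subr_ge0//; apply: mulr_ge0 => //; exact: ltW.
Qed.

End holder_cone.

(** * Averaged contraction over finitely many branches *)

Section holder_step.
Context d {X : measurableType d} {R : realType}.
Variables (dist : X -> X -> R) (alpha : R).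
Hypothesis dist_metric : is_metric dist.
Hypothesis dist_le1 : forall x y, dist x y <= 1.
Hypothesis alpha_gt0 : 0 < alpha.
Local Notation da x y := (dist x y `^ alpha).
Variables (E E' : set X) (pre : X -> set X) (ph : X -> R) (N : nat)
    (y : nat -> X -> X) (l H Dw : R).
Local Notation I := [set i : nat | (1 <= i <= N)%N].
Hypothesis br : branches dist alpha E E' pre ph I y l H Dw.
Variables (La : nat -> R) (a hi lo : R).
Hypothesis da_y : forall x x' i, E' x -> E' x' -> I i ->
  da (y i x) (y i x') <= La i * da x x'.
Hypothesis sum_La : \sum_(i < N) La i.+1 <= N%:R * a.
Hypothesis ph_hi : forall z, E z -> ph z <= hi.
Hypothesis ph_lo : forall z, E z -> lo <= ph z.
Let wt z := expR (ph z).
Local Notation L := (top pre wt).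

Lemma top_finite F x : E' x -> bdd E F ->
  L F x = \sum_(i < N) wt (y i.+1 x) * F (y i.+1 x).
Proof.
move=> Ex bF; rewrite (topE br)//.
have sF := term_summable br Ex bF.
rewrite (@eq_csum _ _ _ (fun i => if (i < N.+1)%N then wt (y i x) * F (y i x) else 0)).
  rewrite csum_trunc//; rewrite big_ord_recl /= ifF ?add0r; last first.
    by apply/negbTE; rewrite notin_setE /=.
  apply: eq_bigr => i _; rewrite ifT// inE /=.
  exact: ltn_ord.
by move=> i /= /andP[_ iN]; rewrite ltnS iN.
Qed.

Let IS (i : 'I_N) : I i.+1. Proof. exact: ltn_ord. Qed.

(** Weights are replaced by exp hi above and exp lo below; the number N of branches cancels and only
    the average of the branch constants La remains. Contracting inverse branches can thus compensate
    expanding ones, at the price exp (hi - lo). *)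
Lemma hcone_top F m0 B0 V kap' : bdd E F -> 0 <= m0 ->
  (forall z, E z -> m0 <= F z <= B0) ->
  (forall z z', E z -> E z' -> `|F z - F z'| <= V * da z z') ->
  0 <= V -> 0 <= B0 -> 0 <= kap' ->
  expR (hi - lo) * (a * V + H * B0) <= kap' * m0 ->
  hcone dist alpha E' kap' (L F).
Proof.
move=> bF m00 Fb FV V0 B00 k0 hk.
have lb z : E' z -> N%:R * (expR lo * m0) <= L F z.
  move=> Ez; rewrite top_finite// mulr_natl -[X in _ *+ X]card_ord -sumr_const.
  apply: ler_sum => i _; have Ey := branch_E br Ez (IS i).
  by apply: ler_pM; rewrite ?expR_ge0 ?ler_expR ?ph_lo//; case/andP: (Fb _ Ey).
split=> [x Ex|x x' x'' Ex Ex' Ex''].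
  by apply: le_trans (lb x Ex); rewrite !mulr_ge0 ?expR_ge0.
have t0 := da_ge0 dist alpha x x'; set t := da x x' in t0 *.
apply: (@le_trans _ _ (N%:R * (expR hi * (a * V + H * B0)) * t)); last first.
  apply: le_trans (_ : kap' * t * (N%:R * (expR lo * m0)) <= _); last first.
    by rewrite ler_wpM2l ?lb// mulr_ge0.
  have -> : kap' * t * (N%:R * (expR lo * m0)) = N%:R * (expR lo * (kap' * m0)) * t by ring.
  rewrite ler_wpM2r// ler_wpM2l//.
  have -> : expR hi * (a * V + H * B0) = expR lo * (expR (hi - lo) * (a * V + H * B0)).
    by rewrite mulrA -expRD; congr (expR _ * _); ring.
  by rewrite ler_wpM2l ?expR_ge0.
rewrite !top_finite// -sumrB; apply: le_trans (ler_norm_sum _ _ _) _.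
apply: (@le_trans _ _ (\sum_(i < N) (expR hi * V * t * La i.+1 + expR hi * (H * B0) * t))); last first.
  rewrite big_split /= -mulr_sumr sumr_const card_ord -[_ *+ N]mulr_natl.
  have -> : N%:R * (expR hi * (a * V + H * B0)) * t =
    expR hi * V * t * (N%:R * a) + N%:R * (expR hi * (H * B0) * t) by ring.
  by rewrite lerD2r ler_wpM2l// !mulr_ge0 ?expR_ge0.
apply: ler_sum => i _.
have Ey := branch_E br Ex (IS i); have Ey' := branch_E br Ex' (IS i).
set z := y i.+1 x in Ey *; set z' := y i.+1 x' in Ey' *.
have hzz : da z z' <= La i.+1 * t by exact: da_y.
have hph : `|ph z - ph z'| <= H * t.
  by case: br => _ _ /(_ x x' Ex Ex' i.+1 (IS i))[].
have -> : wt z * F z - wt z' * F z' = wt z * (F z - F z') + (wt z - wt z') * F z' by ring.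
apply: le_trans (ler_normD _ _) _; rewrite !normrM; apply: lerD.
  have -> : expR hi * V * t * La i.+1 = expR hi * (V * (La i.+1 * t)) by ring.
  apply: ler_pM => //; first by rewrite ger0_norm ?expR_ge0// ler_expR ph_hi.
  by apply: le_trans (FV _ _ Ey Ey') _; rewrite ler_wpM2l.
have hw u1 u2 : ph u1 <= hi -> expR (ph u1) - expR (ph u2) <= expR hi * `|ph u1 - ph u2|.
  move=> u1h; apply: (@le_trans _ _ (expR (ph u1) * (ph u1 - ph u2))).
    have -> : expR (ph u2) = expR (ph u1) * expR (ph u2 - ph u1).
      by rewrite -expRD; congr expR; ring.
    rewrite -{1}[expR (ph u1)]mulr1 -mulrBr ler_wpM2l ?expR_ge0//.
    by have := expR_ge1Dx (ph u2 - ph u1); lra.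
  apply: (@le_trans _ _ (expR (ph u1) * `|ph u1 - ph u2|)).
    by rewrite ler_wpM2l ?expR_ge0// ler_norm.
  by rewrite ler_wpM2r// ler_expR.
have -> : expR hi * (H * B0) * t = expR hi * (H * t) * B0 by ring.
apply: ler_pM => //.
  apply: (@le_trans _ _ (expR hi * `|ph z - ph z'|)); last by rewrite ler_wpM2l ?expR_ge0.
  rewrite ler_norml; apply/andP; split; last by rewrite hw// ph_hi.
  by rewrite lerNl opprB distrC hw// ph_hi.
by case/andP: (Fb _ Ey') => h1 h2; rewrite ger0_norm// (le_trans m00).
Qed.

(* With G = 1 this is the invariance of the cone. *)
Lemma hcone_top_mul f G kap kap' g0 g1 VG : 0 <= kap -> 0 <= a -> E !=set0 ->
  hcone dist alpha E kap f -> 0 <= g0 -> (forall z, E z -> g0 <= G z <= g1) ->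
  (forall z z', E z -> E z' -> `|G z - G z'| <= VG * da z z') ->
  0 <= VG -> 0 <= g1 -> 0 <= kap' ->
  expR (hi - lo) * (a * (g1 * kap + VG * (1 + kap)) + H * (g1 * (1 + kap))) <= kap' * g0 ->
  hcone dist alpha E' kap' (L (fun z => G z * f z)).
Proof.
move=> k0 a0 E0 Cf g00 Gb GV VG0 g10 k0' hk.
have [m m0 [h1 h2]] := hcone_inf dist_metric dist_le1 alpha_gt0 k0 Cf E0.
have f0 z : E z -> 0 <= f z by case: Cf => h _; exact: h.
have kk : 0 <= 1 + kap by rewrite addr_ge0.
have b1 : 0 <= g1 * ((1 + kap) * m) by rewrite !mulr_ge0.
have fb z : E z -> g0 * m <= G z * f z <= g1 * ((1 + kap) * m).
  move=> Ez; case/andP: (h1 z Ez) => ? ?; case/andP: (Gb z Ez) => ? ?.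
  by rewrite !ler_pM ?f0// (le_trans g00).
apply: (@hcone_top _ (g0 * m) (g1 * ((1 + kap) * m)) (g1 * kap * m + VG * (1 + kap) * m)) => //.
- exists (g1 * ((1 + kap) * m)) => z Ez; case/andP: (fb z Ez) => s1 s2.
  by rewrite ger0_norm// (le_trans _ s1)// mulr_ge0.
- by rewrite mulr_ge0.
- move=> z z' Ez Ez'.
  have -> : G z * f z - G z' * f z' = G z * (f z - f z') + (G z - G z') * f z' by ring.
  apply: le_trans (ler_normD _ _) _; rewrite !normrM mulrDl; apply: lerD.
    have -> : g1 * kap * m * da z z' = g1 * (kap * m * da z z') by ring.
    apply: ler_pM => //; last exact: h2.
    by case/andP: (Gb z Ez) => s1 s2; rewrite ger0_norm// (le_trans g00).
  have -> : VG * (1 + kap) * m * da z z' = VG * da z z' * ((1 + kap) * m) by ring.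
  apply: ler_pM => //; first exact: GV.
  by case/andP: (h1 z' Ez') => s1 s2; rewrite ger0_norm ?f0.
- by rewrite addr_ge0// !mulr_ge0.
have -> : expR (hi - lo) * (a * (g1 * kap * m + VG * (1 + kap) * m) + H * (g1 * ((1 + kap) * m))) =
  expR (hi - lo) * (a * (g1 * kap + VG * (1 + kap)) + H * (g1 * (1 + kap))) * m by ring.
by rewrite mulrA ler_wpM2r.
Qed.

End holder_step.

Section supn_infn.
Context {R : realType} (X : Type) (A : set X) (g : X -> R) (M : R).

Lemma infn_le : (forall x, A x -> `|g x| <= M) -> forall x, A x -> infn A g <= g x.
Proof.
move=> gM x Ax; rewrite /infn.
have lb : ((- M)%:E <= ereal_inf [set (g x)%:E | x in A])%E.
  apply: le_ereal_inf_tmp => _ [z Az <-]; rewrite lee_fin.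
  by have := gM z Az; rewrite ler_norml => /andP[].
have ub : (ereal_inf [set (g x)%:E | x in A] <= (g x)%:E)%E.
  by apply: ereal_inf_lbound; exists x.
rewrite -lee_fin fineK// fin_numE; apply/andP; split.
  by rewrite gt_eqF// (lt_le_trans _ lb)// ltNyr.
by rewrite lt_eqF// (le_lt_trans ub)// ltry.
Qed.

Lemma supn_le : A !=set0 -> (forall x, A x -> g x <= M) -> supn A g <= M.
Proof.
move=> [x0 Ax0] gM; rewrite /supn.
have ub : (ereal_sup [set (g x)%:E | x in A] <= M%:E)%E.
  by apply: ge_ereal_sup => _ [z Az <-]; rewrite lee_fin gM.
have lb : ((g x0)%:E <= ereal_sup [set (g x)%:E | x in A])%E.
  by apply: ereal_sup_ubound; exists x0.
rewrite -lee_fin fineK// fin_numE; apply/andP; split.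
  by rewrite gt_eqF// (lt_le_trans _ lb)// ltNyr.
by rewrite lt_eqF// (le_lt_trans ub)// ltry.
Qed.

Lemma le_infn : A !=set0 -> (forall x, A x -> M <= g x) -> M <= infn A g.
Proof.
move=> [x0 Ax0] gM; rewrite /infn.
have lb : (M%:E <= ereal_inf [set (g x)%:E | x in A])%E.
  by apply: le_ereal_inf_tmp => _ [z Az <-]; rewrite lee_fin gM.
have ub : (ereal_inf [set (g x)%:E | x in A] <= (g x0)%:E)%E.
  by apply: ereal_inf_lbound; exists x0.
rewrite -lee_fin fineK// fin_numE; apply/andP; split.
  by rewrite gt_eqF// (lt_le_trans _ lb)// ltNyr.
by rewrite lt_eqF// (le_lt_trans ub)// ltry.
Qed.

End supn_infn.

(** * Scalar inequalities for setting B *)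

Section perturbation_inequalities.
Context {R : realType}.

(** The aperture condition for a factor c + v: U bounds |v|, v1 is its Hoelder constant, z k the
    aperture reached without the factor and k the one allowed. The constant 16 leaves room for the
    product of two factors treated next. *)
Lemma pert_ineq1 (z U v1 s k c : R) : 0 <= z < 1 -> 0 <= U -> 0 <= v1 -> s <= 1 -> 1 <= k ->
  (1 - z) * c = 16 * (U + v1) -> U <= c ->
  (c + U) * (z * k) + (1 + s) * v1 <= k * (c - U).
Proof.
move=> /andP[z0 z1] U0 v0 s1 k1 cE Uc.
have h1 : (1 + s) * v1 <= k * (2 * v1).
  apply: (@le_trans _ _ (2 * v1)); first by rewrite ler_wpM2r//; lra.
  by rewrite ler_peMl// mulr_ge0.
have h2 : z * U <= U by rewrite ler_piMl// ltW.
have h3 : 0 <= c - U - (c + U) * z - 2 * v1 by lra.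
have k0 : 0 <= k by lra.
have := mulr_ge0 k0 h3; lra.
Qed.

Lemma pert_ineq2 (z U v1 s k c : R) : 0 <= z < 1 -> 0 <= U -> 0 <= v1 -> s <= 1 -> 1 <= k ->
  (1 - z) * c = 16 * (U + v1) -> U <= c ->
  (c + U) ^+ 2 * (z * k) + (1 + s) * (2 * (c + U) * v1) <= k * (c - U) ^+ 2.
Proof.
move=> /andP[z0 z1] U0 v0 s1 k1 cE Uc.
have c0 : 0 <= c by lra.
have W0 : 0 <= 2 * (c + U) * v1 by rewrite !mulr_ge0// addr_ge0.
have h1 : (1 + s) * (2 * (c + U) * v1) <= k * (2 * (2 * (c + U) * v1)).
  apply: (@le_trans _ _ (2 * (2 * (c + U) * v1))); first by rewrite ler_wpM2r//; lra.
  by rewrite ler_peMl// mulr_ge0.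
have h2 : 0 <= (c - U) ^+ 2 - (c + U) ^+ 2 * z - 2 * (2 * (c + U) * v1).
  have cE2 : (1 - z) * c * c = 16 * (U + v1) * c by rewrite cE.
  have z2 : 0 <= 1 - z by lra.
  have p1 : 0 <= (1 - z) * U ^+ 2 by rewrite mulr_ge0 ?sqr_ge0.
  have p2 : 0 <= (1 - z) * (c * U) by rewrite !mulr_ge0.
  have p3 : 0 <= (c - U) * v1 by rewrite mulr_ge0 ?subr_ge0.
  have p4 : 0 <= c * v1 by rewrite mulr_ge0.
  have p5 : 0 <= c * U by rewrite mulr_ge0.
  have -> : (c - U) ^+ 2 - (c + U) ^+ 2 * z - 2 * (2 * (c + U) * v1) =
    ((1 - z) * c * c + (1 - z) * U ^+ 2 + 2 * ((1 - z) * (c * U)) - 4 * (c * U))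
     + 4 * ((c - U) * v1) - 8 * (c * v1) by ring.
  rewrite cE2.
  have -> : 16 * (U + v1) * c = 16 * (c * U) + 16 * (c * v1) by ring.
  by lra.
have k0 : 0 <= k by lra.
have := mulr_ge0 k0 h2; lra.
Qed.

(* The bound cc <= kap de of setting B: Z is the factor (1 + 2 / s) exp (2 sup |phi|) (1 + H) of c_0, and cosh (7 D / 2) is only used through cosh (7 D / 2) >= (1 + z) / (1 - z) / 2. *)
Lemma gap_ineqB (z M s' Z n r : R) : 0 <= z < 1 -> 0 <= M -> 0 < s' -> s' <= 1 ->
  r = 1 + z * s'^-1 -> r <= 2 * Z -> 0 < Z ->
  32 * s' * Z * n / (1 - z) * ((1 + z) / (1 - z) / 2) <= M ->
  16 * n / (1 - z) <= (8 * M * s'^-1 ^+ 2) * ((1 - z) / (1 + z) / (1 + r ^+ 2)).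
Proof.
move=> /andP[z0 z1] M0 s0 s1 rE rZ Z0 h.
have z2 : 0 < 1 - z by lra.
have z3 : 0 < 1 + z by lra.
have k1 : 1 <= s'^-1 by rewrite invf_ge1.
have k0 : 0 < s'^-1 by rewrite invr_gt0.
have r1 : 1 <= r by rewrite rE lerDl mulr_ge0// ltW.
have r2 : r <= 2 * s'^-1.
  rewrite rE; have : z * s'^-1 <= s'^-1 by rewrite ler_piMl// ltW.
  by lra.
have rr : 1 + r ^+ 2 <= 8 * Z * s'^-1.
  have a1 : 1 <= r ^+ 2 by rewrite exprn_ege1.
  have a2 : r ^+ 2 <= (2 * Z) * (2 * s'^-1) by rewrite expr2 ler_pM//; lra.
  by lra.
have r3 : 0 < 1 + r ^+ 2 by rewrite ltr_wpDr// sqr_ge0.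
have e1 : 32 * s' * Z * n / (1 - z) * ((1 + z) / (1 - z) / 2) =
  16 * n / (1 - z) * (s' * Z * (1 + z) / (1 - z)).
  by field; rewrite gt_eqF.
have w0 : 0 < s' * Z * (1 + z) / (1 - z) by rewrite divr_gt0// mulr_gt0// mulr_gt0.
rewrite e1 -ler_pdivlMr// in h.
apply: le_trans h _.
have -> : M / (s' * Z * (1 + z) / (1 - z)) =
  M * ((1 - z) / (1 + z)) * (s' * Z)^-1.
  by field; rewrite !gt_eqF.
have -> : 8 * M * s'^-1 ^+ 2 * ((1 - z) / (1 + z) / (1 + r ^+ 2)) =
  M * ((1 - z) / (1 + z)) * (8 * s'^-1 ^+ 2 / (1 + r ^+ 2)).
  by field; rewrite !gt_eqF.
rewrite ler_wpM2l//; first by rewrite mulr_ge0// divr_ge0// ltW.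
rewrite ler_pdivlMr// mulrC ler_pdivrMr ?mulr_gt0//.
have -> : 8 * s'^-1 ^+ 2 * (s' * Z) = 8 * Z * s'^-1 by field; rewrite gt_eqF.
exact: rr.
Qed.

End perturbation_inequalities.

(** * Cone estimates in setting B *)

Section settingB_cone.
Context {R : realType} {dO dX : measure_display}.
Context {Omega : measurableType dO} {X : measurableType dX}.
Variables (theta thetainv : Omega -> Omega) (dist : X -> X -> R) (alpha : R).
Variables (E : Omega -> set X) (T : Omega -> X -> X) (phi u : Omega -> X -> R).
Variable nu : Omega -> probability X R.
Local Notation nu' := (fun w => nu w : {measure set X -> \bar R}).
Variables (l sig : Omega -> R) (qB dB : Omega -> nat) (yB : Omega -> nat -> X -> X).
Hypothesis dist_metric : is_metric dist.
Hypothesis dist_le1 : forall x y, dist x y <= 1.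
Hypothesis borel : forall A : set X, measurable A <-> <<s dopen dist >> A.
Hypothesis alpha_gt0 : 0 < alpha.
Hypothesis mE : forall w, measurable (E w).
Hypothesis u_holder : forall w, holder_fun dist alpha (E w) (u w).
Hypothesis phi_bounded : forall w, exists M : R, forall x, E w x -> `|phi w x| <= M.
Variables (gd : set Omega) (M : R).
Hypothesis M_ge0 : 0 <= M.
Hypothesis gd_theta : forall w, gd w -> gd (theta w).
Hypothesis gd_nuE : forall w, gd w -> nu w (E w) = 1%E.
Local Notation s w := (sB alpha E phi l sig qB dB w).
Local Notation H := (HB dist alpha theta E phi dB yB).
Local Notation eps := (epsB E phi).
Local Notation zeta := (zetaB dist alpha theta E phi l sig qB dB yB).
Definition fibreB (w : Omega) : Prop :=
    [/\ [/\ 1 <= l w, 1 < sig w, (0 < qB w)%N & (qB w < dB w)%N],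
     forall x, E (theta w) x ->
       [/\ forall i, (1 <= i <= dB w)%N -> Defs.preim E T w x (yB w i x),
           forall z, Defs.preim E T w x z -> exists2 i, (1 <= i <= dB w)%N & yB w i x = z &
           forall i j, (1 <= i <= dB w)%N -> (1 <= j <= dB w)%N ->
             yB w i x = yB w j x -> i = j],
     forall x x', E (theta w) x -> E (theta w) x' ->
       (forall i, (1 <= i <= qB w)%N ->
          dist (yB w i x) (yB w i x') <= l w * dist x x') /\
       (forall i, (qB w < i <= dB w)%N ->
          dist (yB w i x) (yB w i x') <= (sig w)^-1 * dist x x'),
     forall i, (1 <= i <= dB w)%N ->
       (hsemi dist alpha (E (theta w)) (phi w \o yB w i) < +oo)%E &
     s w < 1 /\
     expR (eps w) * H w <= ((s (theta w))^-1 - 1) / (1 + (s w)^-1)].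
Hypothesis gd_raw : forall w, gd w -> fibreB w.
Hypothesis gd_EB : forall w, gd w ->
  (EB dist alpha theta thetainv E T phi nu' u l sig qB dB yB w <= M%:E)%E.

Local Notation L := (Lop E T phi).
Local Notation ut := (ut theta thetainv E T phi nu' u).
Local Notation supu := (supu theta thetainv E T phi nu' u).
Local Notation normut := (normut dist alpha theta thetainv E T phi nu' u).
Local Notation vt w := (hv dist alpha (E w) (ut w)).
Local Notation a := (aB alpha l sig qB dB).
Local Notation da x y := (dist x y `^ alpha).

Definition CB w := hcone dist alpha (E w) (s w)^-1.
Definition CKB w := 1 + (s w)^-1.
(** Bound on the quotient of two values of a function in the image cone, whose aperture is zeta /
    s(theta w). *)
Definition ratioB w := 1 + zeta w * (s (theta w))^-1.
Definition deB w := (1 - zeta w) / (1 + zeta w) / (1 + ratioB w ^+ 2).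
Definition ccB w := 16 * normut w / (1 - zeta w).

Let hi w := supn (E w) (phi w).
Let lo w := infn (E w) (phi w).
Let Fs w := supn (E w) (fun x => `|phi w x|).
Let La w i := if (i <= qB w)%N then l w `^ alpha else sig w `^ (- alpha).

Let E0 w : gd w -> E w !=set0.
Proof.
move=> gw; apply/set0P/eqP => E0; have := gd_nuE gw; rewrite E0 measure0 => /eqP.
by rewrite eqe eq_sym oner_eq0.
Qed.

Let dB_gt0 w : gd w -> 0 < (dB w)%:R :> R.
Proof. by move=> /gd_raw[[_ _ q0 qd] _ _ _ _]; rewrite ltr0n (ltn_trans q0). Qed.

Let phi_hi w x : E w x -> phi w x <= hi w.
Proof. by have [B hB] := phi_bounded w; exact: (le_supn hB). Qed.

Let phi_lo w x : E w x -> lo w <= phi w x.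
Proof. by have [B hB] := phi_bounded w; exact: (infn_le hB). Qed.

Let phi_Fs w x : E w x -> `|phi w x| <= Fs w.
Proof.
have [B hB] := phi_bounded w.
by apply: (@le_supn R X (E w) (fun x => `|phi w x|) B) => z Ez; rewrite normr_id hB.
Qed.

Let eps_ge0 w : gd w -> 0 <= eps w.
Proof. by move=> /E0[x Ex]; rewrite /epsB subr_ge0 (le_trans (phi_lo Ex)) ?phi_hi. Qed.

Let eps_Fs w : gd w -> eps w <= 2 * Fs w.
Proof.
move=> gw; have h x : E w x -> - Fs w <= phi w x <= Fs w by move=> Ex; rewrite -ler_norml phi_Fs.
have h1 : supn (E w) (phi w) <= Fs w by apply: supn_le => [|x /h/andP[]//]; exact: E0.
have h2 : - Fs w <= infn (E w) (phi w) by apply: le_infn => [|x /h/andP[]//]; exact: E0.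
by rewrite /epsB; lra.
Qed.

Let H_ge0 w : 0 <= H w.
Proof. exact: bigmax_ge_id. Qed.

Let H_le w (i : nat) : (1 <= i <= dB w)%N -> hv dist alpha (E (theta w)) (phi w \o yB w i) <= H w.
Proof.
case: i => // i /= id; rewrite /HB.
exact: (le_bigmax _ (fun i : 'I_(dB w) => hv dist alpha (E (theta w)) (phi w \o yB w i.+1)) (Ordinal id)).
Qed.

Let aB_gt0 w : gd w -> 0 < a w.
Proof.
move=> gw; have d0 := dB_gt0 gw; have [[l1 s1 q0 qd] _ _ _ _] := gd_raw gw.
rewrite /aB divr_gt0// ltr_wpDr ?mulr_ge0 ?powR_ge0 ?subr_ge0 ?ler_nat 1?ltnW//.
by rewrite mulr_gt0 ?ltr0n// powR_gt0// (lt_le_trans ltr01).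
Qed.

Lemma sB_gt0 w : gd w -> 0 < s w.
Proof. by move=> gw; rewrite /sB mulr_gt0 ?expR_gt0 ?aB_gt0. Qed.

Lemma sB_lt1 w : gd w -> s w < 1. Proof. by move=> /gd_raw[_ _ _ _ []]. Qed.

Let sBV_gt0 w : gd w -> 0 < (s w)^-1. Proof. by move=> gw; rewrite invr_gt0 sB_gt0. Qed.

Let sBV_ge1 w : gd w -> 1 <= (s w)^-1.
Proof. by move=> gw; rewrite invf_ge1 ?sB_gt0 ?ltW ?sB_lt1. Qed.

Let sum_La w : gd w -> \sum_(i < dB w) La w i.+1 <= (dB w)%:R * a w.
Proof.
move=> gw; have d0 := dB_gt0 gw; have [[l1 s1 q0 qd] _ _ _ _] := gd_raw gw.
rewrite /aB mulrC divfK ?gt_eqF//.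
rewrite -(big_mkord xpredT (fun i => La w i.+1)) (@big_cat_nat _ _ _ (qB w)) ?(ltnW qd)//=.
rewrite (eq_big_nat _ _ (F2 := fun=> l w `^ alpha)); last by move=> i /andP[_ iq]; rewrite /La iq.
rewrite [X in _ + X](eq_big_nat _ _ (F2 := fun=> sig w `^ (- alpha))); last first.
  by move=> i /andP[iq _]; rewrite /La ltnNge iq.
by rewrite !sumr_const_nat subn0 -natrB 1?ltnW// !mulr_natl.
Qed.

Let da_y w x x' i : gd w -> E (theta w) x -> E (theta w) x' -> (1 <= i <= dB w)%N ->
  da (yB w i x) (yB w i x') <= La w i * da x x'.
Proof.
move=> gw Ex Ex' /andP[i1 id]; have [[l1 s1 q0 qd] _ h _ _] := gd_raw gw.
have [h1 h2] := h x x' Ex Ex'; have d0 z z' : 0 <= dist z z' by case: dist_metric.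
have l0 : 0 <= l w by rewrite (le_trans ler01).
have s0 : 0 < sig w by rewrite (lt_trans ltr01).
rewrite /La; case: leqP => iq.
  rewrite -powRM//; apply: ge0_ler_powR => //; rewrite ?nnegrE ?mulr_ge0// ?(ltW alpha_gt0)//.
  by rewrite h1 ?i1.
rewrite powRN -[_^-1]/((sig w `^ alpha)^-1).
have -> : (sig w `^ alpha)^-1 = (sig w)^-1 `^ alpha.
  have e : sig w `^ alpha * (sig w)^-1 `^ alpha = 1.
    by rewrite -powRM ?invr_ge0 ?(ltW s0)// divff ?gt_eqF// powR1.
  have p0 : sig w `^ alpha != 0 by rewrite gt_eqF// powR_gt0.
  by apply: (mulfI p0); rewrite e divff.
rewrite -powRM ?invr_ge0 ?(ltW s0)//; apply: ge0_ler_powR => //.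
- exact: ltW.
- exact: d0.
- by apply: mulr_ge0 => //; rewrite invr_ge0 ltW.
- by rewrite h2 ?iq.
Qed.

Lemma branchesB w : gd w -> exists D,
  branches dist alpha (E w) (E (theta w)) (Defs.preim E T w) (phi w)
    [set i | (1 <= i <= dB w)%N] (yB w) (l w) (H w) D.
Proof.
move=> gw; have [[l1 s1 q0 qd] h1 h2 h3 _] := gd_raw gw.
have mono : forall x x' i, E (theta w) x -> E (theta w) x' -> (1 <= i <= dB w)%N ->
    dist (yB w i x) (yB w i x') <= l w * dist x x'.
  move=> x x' i Ex Ex' /andP[i1 id]; have [k1 k2] := h2 x x' Ex Ex'.
  case: (leqP i (qB w)) => iq; first by rewrite k1 ?i1.
  apply: le_trans (k2 i _) _; first by rewrite iq.
  rewrite ler_wpM2r//; first by case: dist_metric.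
  by apply: le_trans l1; rewrite invf_le1 ?(ltW s1)// (lt_trans ltr01).
pose J := [set i : nat | (1 <= i <= dB w)%N].
have fJ : finite_set J by apply: (sub_finite_set _ (finite_II (dB w).+1)) => i /= /andP[_]; rewrite ltnS.
pose S := (\esum_(i in J) (expR (hi w))%:E)%E.
have Sfin : S \is a fin_num.
  rewrite /S esum_fset => [|//|i _]; last exact: expR_ge0.
  by rewrite fsbig_finite//= sumEFin.
exists (fine S); split=> [x z _ []//|x Ex|x x' Ex Ex' i Ii|x Ex].
- have [k1 k2 k3] := h1 x Ex; split.
  + by move=> i; exact: k1.
  + by move=> z; exact: k2.
  + by move=> i j; exact: k3.
- split; first exact: mono.
  have hh : holder_fun dist alpha (E (theta w)) (phi w \o yB w i).
    split; last exact: h3.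
    have [B hB] := phi_bounded w; exists B => z Ez.
    by apply: hB; have [k1 _ _] := h1 z Ez; case: (k1 i Ii).
  apply: le_trans (hvP dist_metric hh.2 Ex Ex') _.
  by rewrite ler_wpM2r ?powR_ge0// H_le.
have [k1 k2 k3] := h1 x Ex.
rewrite fineK// (reindex_esum J _ (fun i => yB w i x)); last first.
  split=> [i Ji|i j|z /k2[i Ji <-]]; first exact: k1.
  - by rewrite !inE; exact: k3.
  - by exists i.
apply: le_esum => i Ji; rewrite lee_fin ler_expR phi_hi//.
by case: (k1 i Ji).
Qed.

(** The right-hand side is the aperture produced by one application of L, so zeta is the ratio of
    this aperture to the one allowed on the next fibre. *)
Lemma zetaB_E w : gd w ->
  zeta w * (s (theta w))^-1 = 1 + (1 + (s w)^-1) * expR (eps w) * H w.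
Proof.
by move=> gw; rewrite /zetaB mulrC mulKf// gt_eqF// sB_gt0//; exact: gd_theta.
Qed.

Let zk_ge0 w : gd w -> 0 <= zeta w * (s (theta w))^-1.
Proof.
move=> gw; rewrite zetaB_E// addr_ge0// !mulr_ge0 ?expR_ge0 ?H_ge0//.
by rewrite addr_ge0// ltW// sBV_gt0.
Qed.

Lemma zetaB_ge0 w : gd w -> 0 <= zeta w.
Proof.
move=> gw; have := zk_ge0 gw; rewrite pmulr_lge0//; exact/sBV_gt0/gd_theta.
Qed.

Lemma EB_unfold w : gd w -> zeta w < 1 /\
  exists D : R, [/\ D = 2 * ln ((1 + zeta w) / (1 - zeta w)) + 2 * ln (1 + zeta w * (s w)^-1) &
   (32 * s (theta w) * (1 + 2 * (s w)^-1) * expR (supu w + 2 * Fs w)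
     * normut w * (1 + H w) / (1 - zeta w)) * (1 + coshR (7 * D / 2)) <= M].
Proof.
move=> gw; have := gd_EB gw; rewrite /EB /c0B /DfB.
case: ifPn => // h1.
rewrite /= lee_fin => h3; split => //.
by exists (2 * ln ((1 + zeta w) / (1 - zeta w)) + 2 * ln (1 + zeta w * (s w)^-1)).
Qed.

Lemma zetaB_lt1 w : gd w -> zeta w < 1. Proof. by move=> /EB_unfold[]. Qed.

Lemma deB_gt0 w : gd w -> 0 < deB w.
Proof.
move=> gw; have q0 := zetaB_ge0 gw; have q1 := zetaB_lt1 gw.
apply: divr_gt0; last by apply: ltr_wpDr => //; exact: sqr_ge0.
by apply: divr_gt0; lra.
Qed.

Lemma deB_le w : gd w -> deB w <= 1 / 2.
Proof.
move=> gw; have q0 := zetaB_ge0 gw; have q1 := zetaB_lt1 gw.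
have e1 : 1 <= ratioB w ^+ 2 by rewrite exprn_ege1// /ratioB lerDl zk_ge0.
rewrite /deB ler_pdivrMr; last by apply: ltr_wpDr => //; exact: sqr_ge0.
apply: (@le_trans _ _ 1); last by lra.
by rewrite ler_pdivrMr; lra.
Qed.

Let supu_ge0 w : gd w -> 0 <= supu w.
Proof.
move=> gw; have [x Ex] := E0 gw.
exact: le_trans (normr_ge0 _) (ut_le theta thetainv T phi nu' dist_metric u_holder Ex).
Qed.

Let normut_ge0 w : gd w -> 0 <= normut w.
Proof. by move=> gw; rewrite addr_ge0 ?supu_ge0 ?hv_ge0. Qed.

(** The factor exp (sup |ut|) >= 1 of c_0 is dropped and only the first logarithm in D is kept;
    [gap_ineqB] then applies with Z the part of c_0 that dominates half of [ratioB]. *)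
Lemma ccB_le w : gd w -> ccB w <= (8 * M * (s (theta w))^-1 ^+ 2) * deB w.
Proof.
move=> gw; have q0 := zetaB_ge0 gw; have [q1 [D [DE h]]] := EB_unfold gw.
have gw' := gd_theta gw.
have s0 := sBV_gt0 gw; have H0 := H_ge0 w; have U0 := supu_ge0 gw; have n0 := normut_ge0 gw.
have ep0 := eps_ge0 gw; have ep1 := eps_Fs gw.
have k2 : 0 < s (theta w) := sB_gt0 gw'.
pose Z := (1 + 2 * (s w)^-1) * expR (2 * Fs w) * (1 + H w).
have f1 : 1 <= expR (2 * Fs w) by apply: le_trans (expR_ge1Dx _); lra.
have Z1 : 1 + (s w)^-1 * (expR (2 * Fs w) * (1 + H w)) <= Z.
  have -> : Z = expR (2 * Fs w) * (1 + H w) + 2 * ((s w)^-1 * (expR (2 * Fs w) * (1 + H w))).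
    by rewrite /Z; ring.
  have p1 : 1 <= expR (2 * Fs w) * (1 + H w) by rewrite mulr_ege1// lerDl.
  have p2 : 0 <= (s w)^-1 * (expR (2 * Fs w) * (1 + H w)) by rewrite mulr_ge0 ?(ltW s0)// (le_trans ler01).
  by lra.
have Z0 : 0 < Z.
  apply: lt_le_trans Z1; rewrite ltr_wpDr// mulr_ge0 ?(ltW s0)// mulr_ge0 ?expR_ge0// addr_ge0//.
apply: (@gap_ineqB _ (zeta w) M (s (theta w)) Z (normut w) (ratioB w)) => //.
- by rewrite q0.
- by rewrite ltW// sB_lt1.
- rewrite /ratioB zetaB_E//.
  have e1 : expR (eps w) <= expR (2 * Fs w) by rewrite ler_expR.
  have p3 : (1 + (s w)^-1) * expR (eps w) * H w <= (1 + (s w)^-1) * expR (2 * Fs w) * (1 + H w).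
    apply: ler_pM => //; first by rewrite mulr_ge0 ?expR_ge0// addr_ge0// ltW.
      by rewrite ler_wpM2l// addr_ge0// ltW.
    by rewrite lerDr.
  have p4 : Z = (1 + (s w)^-1) * expR (2 * Fs w) * (1 + H w) + (s w)^-1 * (expR (2 * Fs w) * (1 + H w)).
    by rewrite /Z; ring.
  have p5 : 0 <= (s w)^-1 * (expR (2 * Fs w) * (1 + H w)).
    by rewrite mulr_ge0 ?(ltW s0)// mulr_ge0 ?expR_ge0// addr_ge0.
  have p6 : 2 <= Z.
    apply: le_trans Z1; rewrite -[2]/(1 + 1) lerD2l.
    rewrite mulr_ege1 ?sBV_ge1//; rewrite mulr_ege1// lerDl//.
  by lra.
apply: le_trans h; apply: ler_pM.
- rewrite divr_ge0 ?subr_ge0 ?(ltW q1)// mulr_ge0// mulr_ge0 ?(ltW Z0)// mulr_ge0// ltW//.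
- by rewrite divr_ge0// divr_ge0 ?subr_ge0 ?(ltW q1)// addr_ge0.
- rewrite ler_wpM2r ?invr_ge0 ?subr_ge0 ?(ltW q1)//.
  have -> : 32 * s (theta w) * (1 + 2 * (s w)^-1) * expR (supu w + 2 * Fs w) * normut w * (1 + H w) =
     32 * s (theta w) * Z * normut w * expR (supu w) by rewrite /Z expRD; ring.
  rewrite ler_peMr//; last by apply: le_trans (expR_ge1Dx _); lra.
  by rewrite mulr_ge0// mulr_ge0 ?(ltW Z0)// mulr_ge0// ltW.
set Q := (1 + zeta w) / (1 - zeta w) in DE *.
have Q1 : 1 <= Q by rewrite /Q ler_pdivlMr; lra.
have Q0 : 0 < Q by lra.
have lnQ0 : 0 <= ln Q by rewrite ln_ge0.
have ln2 : 0 <= ln (1 + zeta w * (s w)^-1) by rewrite ln_ge0// lerDl mulr_ge0// ltW.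
apply: le_trans (_ : coshR (7 * D / 2) <= _); last by rewrite lerDr.
apply: le_trans (coshR_ge _); rewrite ler_wpM2r ?invr_ge0//.
by rewrite -[leLHS]lnK ?posrE// ler_expR DE; lra.
Qed.

(** By definition exp (eps) a = s, so the term exp (eps) a / s is 1 and the condition of
    [hcone_top_mul] becomes one in zeta and s alone. *)
Let mul_step w f G g0 g1 VG kap' : gd w -> CB w f -> 0 <= g0 -> 0 <= g1 -> 0 <= VG -> 0 <= kap' ->
  (forall z, E w z -> g0 <= G z <= g1) ->
  (forall z z', E w z -> E w z' -> `|G z - G z'| <= VG * da z z') ->
  g1 * (zeta w * (s (theta w))^-1) + (1 + s w) * VG <= kap' * g0 ->
  hcone dist alpha (E (theta w)) kap' (L w (fun z => G z * f z)).
Proof.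
move=> gw Cf g00 g10 VG0 k0' Gb GV h; have [D br] := branchesB gw.
have k0 : 0 <= (s w)^-1 by rewrite ltW// sBV_gt0.
have s0 : s w != 0 by rewrite gt_eqF// sB_gt0.
have dy x x' i (Ex : E (theta w) x) (Ex' : E (theta w) x') (Ii : (1 <= i <= dB w)%N) :=
  da_y gw Ex Ex' Ii.
apply: (@hcone_top_mul _ _ _ _ _ dist_metric dist_le1 alpha_gt0 _ _ _ _ _ _ _ _ _ br
  _ _ _ _ dy (sum_La gw) (@phi_hi w) (@phi_lo w) f G (s w)^-1 kap' g0 g1 VG) => //.
- exact/ltW/aB_gt0.
- exact: E0.
apply: le_trans h; rewrite zetaB_E// -/(eps w).
have e1 : expR (eps w) * a w = s w by [].
have -> : expR (eps w) * (a w * (g1 * (s w)^-1 + VG * (1 + (s w)^-1)) + H w * (g1 * (1 + (s w)^-1))) =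
  (expR (eps w) * a w) * (g1 * (s w)^-1 + VG * (1 + (s w)^-1)) + g1 * ((1 + (s w)^-1) * expR (eps w) * H w).
  by ring.
rewrite e1 le_eqVlt; apply/orP; left; apply/eqP.
by field.
Qed.

Lemma CB_L w f : gd w -> CB w f ->
  hcone dist alpha (E (theta w)) (zeta w * (s (theta w))^-1) (L w f).
Proof.
move=> gw Cf.
have -> : f = (fun z => (fun=> 1) z * f z) by apply/funext => z; rewrite mul1r.
apply: (mul_step gw Cf (g0 := 1) (g1 := 1) (VG := 0)) => //.
- exact: zk_ge0.
- by move=> z _; rewrite lexx.
- by move=> z z' _ _; rewrite subrr normr0 mul0r.
- by rewrite mul1r mulr0 addr0 mulr1.
Qed.

Let zk_le w : gd w -> zeta w * (s (theta w))^-1 <= (s (theta w))^-1.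
Proof.
by move=> gw; rewrite ler_piMl ?ltW ?zetaB_lt1//; exact/sBV_gt0/gd_theta.
Qed.

Lemma CB_L' w f : gd w -> CB w f -> CB (theta w) (L w f).
Proof. by move=> gw Cf; apply: hconeW (zk_le gw) (CB_L gw Cf). Qed.

Lemma CB_contr w f g : gd w -> CB w f -> CB w g ->
  nuI E nu (theta w) (L w g) <= nuI E nu (theta w) (L w f) ->
  CB (theta w) (fun x => (1 - deB w) * L w f x - deB w * L w g x).
Proof.
move=> gw Cf Cg fg; have gw' := gd_theta gw.
have k0 : 0 <= (s (theta w))^-1 by rewrite ltW// sBV_gt0.
have Lf := CB_L gw Cf; have Lg := CB_L gw Cg.
have zk0 := zk_ge0 gw.
have bL h : hcone dist alpha (E (theta w)) (zeta w * (s (theta w))^-1) h -> bmf (E (theta w)) h.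
  move=> Ch; exact: (holder_bmf dist_metric borel alpha_gt0 (mE _) (hcone_holder dist_metric dist_le1 alpha_gt0 zk0 Ch)).
apply: (hcone_sub k0 (zetaB_ge0 gw) (zetaB_lt1 gw) (sqr_ge0 (ratioB w)) Lf Lg) => x Ex.
have r0 : 0 <= ratioB w by rewrite addr_ge0.
have h1 : L w g x <= ratioB w * nuI E nu (theta w) (L w g).
  rewrite -(nuI_cst mE gd_nuE (L w g x) gw') -(nuI_Z _ mE)//; last exact: bL.
  apply: (le_nuI _ mE) => //; [exact: bmf_cst | apply: bmfZ; exact: bL |].
  by move=> z Ez; exact: (hcone_K dist_metric dist_le1 alpha_gt0 zk0 Lg).
have h2 : nuI E nu (theta w) (L w f) <= ratioB w * L w f x.
  rewrite -(nuI_cst mE gd_nuE (ratioB w * L w f x) gw').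
  apply: (le_nuI _ mE) => //; [exact: bL | exact: bmf_cst |].
  by move=> z Ez; exact: (hcone_K dist_metric dist_le1 alpha_gt0 zk0 Lf).
rewrite expr2 -mulrA; apply: le_trans h1 _; rewrite ler_wpM2l//.
exact: le_trans fg h2.
Qed.

Lemma supu_le_ccB w : gd w -> supu w <= ccB w.
Proof.
move=> gw; have q0 := zetaB_ge0 gw; have q1 := zetaB_lt1 gw.
have q2 : 0 < 1 - zeta w by lra.
have U0 := supu_ge0 gw; have v0 : 0 <= vt w := hv_ge0 _ _ _ _.
rewrite /ccB /Defs.normut ler_pdivlMr//.
apply: (@le_trans _ _ (supu w)); last by lra.
by rewrite ler_piMr//; lra.
Qed.

Let ccB_E w : gd w -> (1 - zeta w) * ccB w = 16 * (supu w + vt w).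
Proof.
move=> gw; have q1 := zetaB_lt1 gw; have q2 : 0 < 1 - zeta w by lra.
by rewrite /ccB mulrC divfK ?gt_eqF.
Qed.

Let ut_vt w x x' : E w x -> E w x' -> `|ut w x - ut w x'| <= vt w * da x x'.
Proof.
move=> Ex Ex'; apply: (hvP dist_metric) => //.
by case: (ut_holder theta thetainv T phi nu' dist_metric u_holder w).
Qed.

Let pert_range w (t : R) z : gd w -> t ^+ 2 = 1 -> E w z ->
  0 <= ccB w - supu w <= ccB w + t * ut w z /\ ccB w + t * ut w z <= ccB w + supu w.
Proof.
move=> gw t1 Ez; have tn : `|t| = 1 by apply/eqP; rewrite -sqr_norm_eq1 t1.
have h : `|t * ut w z| <= supu w.
  by rewrite normrM tn mul1r; exact: (ut_le _ _ _ _ _ dist_metric u_holder).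
have := supu_le_ccB gw; move: h; rewrite ler_norml subr_ge0 => /andP[h1 h2] ->.
by rewrite !lerD2l h1 h2.
Qed.

Let pert_lip w (t : R) z z' : gd w -> t ^+ 2 = 1 -> E w z -> E w z' ->
  `|(ccB w + t * ut w z) - (ccB w + t * ut w z')| <= vt w * da z z'.
Proof.
move=> gw t1 Ez Ez'; have tn : `|t| = 1 by apply/eqP; rewrite -sqr_norm_eq1 t1.
have -> : (ccB w + t * ut w z) - (ccB w + t * ut w z') = t * (ut w z - ut w z') by ring.
by rewrite normrM tn mul1r ut_vt.
Qed.

Lemma CB_pert1 w (t : R) f : gd w -> t ^+ 2 = 1 -> CB w f ->
  CB (theta w) (L w (fun x => (ccB w + t * ut w x) * f x)).
Proof.
move=> gw t1 Cf; have gw' := gd_theta gw.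
have U0 := supu_ge0 gw; have v0 : 0 <= vt w := hv_ge0 _ _ _ _.
have Uc := supu_le_ccB gw.
apply: (mul_step gw Cf (g0 := ccB w - supu w) (g1 := ccB w + supu w) (VG := vt w)) => //.
- by rewrite subr_ge0.
- by rewrite addr_ge0// (le_trans U0).
- by rewrite ltW// sBV_gt0.
- by move=> z Ez; case: (pert_range gw t1 Ez) => /andP[_ ->] ->.
- by move=> z z' Ez Ez'; exact: pert_lip.
apply: pert_ineq1 => //; first by rewrite zetaB_ge0 ?zetaB_lt1.
- exact/ltW/sB_lt1.
- exact: sBV_ge1.
- exact: ccB_E.
Qed.

Lemma CB_pert2 w (t t' : R) f : gd w -> t ^+ 2 = 1 -> t' ^+ 2 = 1 -> CB w f ->
  CB (theta w) (L w (fun x => (ccB w + t * ut w x) * ((ccB w + t' * ut w x) * f x))).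
Proof.
move=> gw t1 t1' Cf; have gw' := gd_theta gw.
have U0 := supu_ge0 gw; have v0 : 0 <= vt w := hv_ge0 _ _ _ _.
have Uc := supu_le_ccB gw; have c0 : 0 <= ccB w + supu w by rewrite addr_ge0// (le_trans U0).
have -> : (fun x => (ccB w + t * ut w x) * ((ccB w + t' * ut w x) * f x)) =
  (fun x => (fun x => (ccB w + t * ut w x) * (ccB w + t' * ut w x)) x * f x).
  by apply/funext => x; rewrite mulrA.
apply: (mul_step gw Cf (g0 := (ccB w - supu w) ^+ 2) (g1 := (ccB w + supu w) ^+ 2)
  (VG := 2 * (ccB w + supu w) * vt w)) => //.
- exact: sqr_ge0.
- exact: sqr_ge0.
- by rewrite mulr_ge0// mulr_ge0.
- by rewrite ltW// sBV_gt0.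
- move=> z Ez; case: (pert_range gw t1 Ez) => /andP[h1 h2] h3.
  case: (pert_range gw t1' Ez) => /andP[_ h2'] h3'.
  rewrite !expr2; apply/andP; split; first exact: ler_pM.
  by apply: ler_pM => //; apply: le_trans h1 _.
- move=> z z' Ez Ez'; case: (pert_range gw t1 Ez) => /andP[h1 h2] h3.
  case: (pert_range gw t1' Ez') => /andP[_ h2'] h3'.
  have l1 := pert_lip gw t1 Ez Ez'; have l2 := pert_lip gw t1' Ez Ez'.
  have -> : forall p q r s : R, p * q - r * s = p * (q - s) + (p - r) * s by move=> *; ring.
  apply: le_trans (ler_normD _ _) _; rewrite !normrM.
  have -> : 2 * (ccB w + supu w) * vt w * da z z' =
    (ccB w + supu w) * (vt w * da z z') + (vt w * da z z') * (ccB w + supu w) by ring.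
  apply: lerD; apply: ler_pM => //.
    by rewrite ger0_norm// (le_trans h1).
  by rewrite ger0_norm// (le_trans h1).
apply: pert_ineq2 => //; first by rewrite zetaB_ge0 ?zetaB_lt1.
- exact/ltW/sB_lt1.
- exact: sBV_ge1.
- exact: ccB_E.
Qed.

End settingB_cone.

(** * Almost sure statements *)

Section speeds.
Context {R : realType}.
Variables (p : R) (a : nat -> R).
Hypothesis p_gt8 : 8 < p.
Hypothesis a_gt0 : forall n, 0 < a n.
Hypothesis a_large : (fun n => a n * n%:R `^ (- Num.max (6 / p) (1 / 2))) @ \oo --> +oo.
Hypothesis a_small : (fun n => a n / n%:R `^ (1 - 8 / p)) @ \oo --> 0.
Variable A : R.
Hypothesis A_ge0 : 0 <= A.
Local Notation m := (Num.max (6 / p) (1 / 2)).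
Local Notation kn n := (A * n%:R `^ (2 / p)).

Let a0 n : 0 <= a n. Proof. exact: ltW. Qed.

Let p0 : 0 < p. Proof. by rewrite (lt_trans _ p_gt8). Qed.

Let nge1 : \forall n \near \oo, 1 <= n%:R :> R.
Proof. by exists 1%N => // n /= n1; rewrite ler1n. Qed.

Let a_inv : (fun n => (a n * n%:R `^ (- m))^-1) @ \oo --> 0.
Proof.
apply/gtr0_cvgV0; last exact: a_large.
by near=> n; rewrite mulr_gt0// powR_gt0// (lt_le_trans ltr01)//; near: n; exact: nge1.
Unshelve. all: by end_near. Qed.

Let squeeze0 (f g : nat -> R) : (forall n, 0 <= f n) -> (\forall n \near \oo, f n <= g n) ->
  g @ \oo --> 0 -> f @ \oo --> 0.
Proof.
move=> f0 fg g0; apply: (squeeze_cvgr _ (cvg_cst 0) g0).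
by apply: filterS fg => n ->; rewrite f0.
Qed.

(** Rests on the exponent 1/2 in the maximum. *)
Lemma speed_cvg0 : (fun n => n%:R / a n ^+ 2) @ \oo --> 0.
Proof.
apply: (@squeeze0 _ (fun n => (a n * n%:R `^ (- m))^-1 * (a n * n%:R `^ (- m))^-1)).
- by move=> n; rewrite divr_ge0 ?sqr_ge0.
- near=> n; have n1 : 1 <= n%:R :> R by near: n; exact: nge1.
  have n0 : 0 < n%:R :> R by rewrite (lt_le_trans ltr01).
  have -> : (a n * n%:R `^ (- m))^-1 = (a n)^-1 * n%:R `^ m by rewrite invfM powRN invrK.
  rewrite mulrACA -expr2 exprVn mulrC ler_wpM2l ?invr_ge0 ?sqr_ge0//.
  rewrite -powRD; last by rewrite (gt_eqF n0) implybT.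
  apply: le_trans (_ : n%:R `^ 1 <= _); [by rewrite powRr1// ltW | apply: ler_powR => //].
  have : 1 / 2 <= m by rewrite le_max lexx orbT.
  lra.
by rewrite -(mulr0 0); apply: cvgM; exact: a_inv.
Unshelve. all: by end_near. Qed.

(** Rests on the exponent 6 / p in the maximum, which exceeds 2 / p. *)
Lemma growth_div_cvg0 : (fun n => kn n / a n) @ \oo --> 0.
Proof.
apply: (@squeeze0 _ (fun n => A * (a n * n%:R `^ (- m))^-1)).
- by move=> n; rewrite divr_ge0// mulr_ge0// powR_ge0.
- near=> n; have n1 : 1 <= n%:R :> R by near: n; exact: nge1.
  have -> : (a n * n%:R `^ (- m))^-1 = (a n)^-1 * n%:R `^ m by rewrite invfM powRN invrK.
  rewrite -mulrA ler_wpM2l// mulrC ler_wpM2l ?invr_ge0//; apply: ler_powR => //.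
  apply: (@le_trans _ _ (6 / p)); last by rewrite le_max lexx.
  by rewrite ler_pM2r ?invr_gt0//; lra.
by rewrite -(mulr0 A); apply: cvgMr; exact: a_inv.
Unshelve. all: by end_near. Qed.

Let small_power (c B : R) : 0 <= B -> c <= 8 / p ->
  (fun n => a n * (B * n%:R `^ c) / n%:R) @ \oo --> 0.
Proof.
move=> B0 c8; apply: (@squeeze0 _ (fun n => B * (a n / n%:R `^ (1 - 8 / p)))).
- by move=> n; rewrite divr_ge0// mulr_ge0// mulr_ge0// powR_ge0.
- near=> n; have n1 : 1 <= n%:R :> R by near: n; exact: nge1.
  have n0 : 0 < n%:R :> R by rewrite (lt_le_trans ltr01).
  rewrite mulrCA -!mulrA ler_wpM2l// ler_wpM2l// -powRN.
  rewrite -[in leLHS](powR_inv1 (ltW n0)) -powRD; last by rewrite (gt_eqF n0) implybT.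
  by apply: ler_powR => //; lra.
by rewrite -(mulr0 B); apply: cvgMr; exact: a_small.
Unshelve. all: by end_near. Qed.

Lemma growth_mul_cvg0 : (fun n => a n * kn n / n%:R) @ \oo --> 0.
Proof. by apply: small_power => //; rewrite ler_pM2r ?invr_gt0//; lra. Qed.

(** Cubing n^(2/p) gives the exponent 6 / p, which is below 8 / p. *)
Lemma growth_cube_cvg0 : (fun n => a n * kn n ^+ 3 / n%:R) @ \oo --> 0.
Proof.
have -> : (fun n => a n * kn n ^+ 3 / n%:R) = (fun n => a n * (A ^+ 3 * n%:R `^ (6 / p)) / n%:R).
  apply/funext => n; rewrite exprMn; congr (_ * (_ * _) / _).
  by rewrite -powR_mulrn ?powR_ge0// -powRrM mulrAC -natrM.
by apply: small_power; [exact: exprn_ge0 | rewrite ler_pM2r ?invr_gt0//; lra].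
Qed.

End speeds.

Lemma measurable_preimT d1 d2 (T1 : measurableType d1) (T2 : measurableType d2)
  (f : T1 -> T2) (A : set T2) :
  measurable_fun setT f -> measurable A -> measurable (f @^-1` A).
Proof. by move=> mf mA; rewrite -[X in measurable X]setTI; exact: mf. Qed.

(** * Consequences of invariance, ergodicity and integrability *)

Section ergodic.
Context d {Omega : measurableType d} {R : realType}.
Variables (P : probability Omega R) (theta thetainv : Omega -> Omega).
Hypothesis thK : cancel theta thetainv.
Hypothesis thinvK : cancel thetainv theta.
Hypothesis mtheta : measurable_fun setT theta.
Hypothesis mthetainv : measurable_fun setT thetainv.
Hypothesis theta_pres : forall A, measurable A -> P (theta @^-1` A) = P A.
Hypothesis theta_erg : forall A, measurable A -> theta @^-1` A = A -> P A = 0%E \/ P A = 1%E.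
Local Notation thn := (thn theta).
Local Notation thmn := (thmn thetainv).

Lemma thetainv_pres A : measurable A -> P (thetainv @^-1` A) = P A.
Proof.
move=> mA; rewrite -theta_pres; last exact: measurable_preimT.
by congr (P _); apply/seteqP; split=> w /=; rewrite thK.
Qed.

Section iterates.
Variables (f : Omega -> Omega) (mf : measurable_fun setT f).
Hypothesis f_pres : forall A, measurable A -> P (f @^-1` A) = P A.

Lemma measurable_iter n A : measurable A -> measurable (iter n f @^-1` A).
Proof.
elim: n A => [//|n ih] A mA.
have -> : iter n.+1 f @^-1` A = iter n f @^-1` (f @^-1` A) by [].
exact/ih/measurable_preimT.
Qed.

Lemma iter_pres n A : measurable A -> P (iter n f @^-1` A) = P A.
Proof.
elim: n A => [//|n ih] A mA.
have -> : iter n.+1 f @^-1` A = iter n f @^-1` (f @^-1` A) by [].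
by rewrite ih ?f_pres//; exact: measurable_preimT.
Qed.

Lemma ae_iter n (Q : set Omega) : {ae P, forall w, Q w} -> {ae P, forall w, Q (iter n f w)}.
Proof.
move=> [N [mN N0 QN]]; exists (iter n f @^-1` N); split.
- exact: measurable_iter.
- by rewrite iter_pres.
- by move=> w /= nQ; exact: QN.
Qed.

End iterates.

Lemma ae_forall_nat (Q : nat -> set Omega) : (forall n, {ae P, forall w, Q n w}) ->
  {ae P, forall w, forall n, Q n w}.
Proof.
move=> hQ; have := negligible_bigcup hQ; apply: negligibleS => w /= /existsNP[n nQ].
by exists n.
Qed.

Lemma ae_setI (A B : set Omega) : {ae P, forall w, A w} -> {ae P, forall w, B w} ->
  {ae P, forall w, (A `&` B) w}.
Proof. by move=> hA hB; apply: filterS2 hA hB => w. Qed.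

(** Imposing Q along the two-sided orbit makes the set invariant under theta and its inverse, while
    its complement stays negligible. *)
Definition orbit_set (Q : set Omega) := [set w | forall n, Q (thn n w) /\ Q (thmn n w)].

Lemma ae_orbit_set Q : {ae P, forall w, Q w} -> {ae P, forall w, orbit_set Q w}.
Proof.
move=> hQ; apply: ae_forall_nat => n.
have h1 := ae_iter mtheta theta_pres n hQ; have h2 := ae_iter mthetainv thetainv_pres n hQ.
by apply: filterS2 h1 h2 => w.
Qed.

Lemma orbit_set_id Q w : orbit_set Q w -> Q w. Proof. by move=> /(_ 0)[]. Qed.

Lemma orbit_set_theta Q w : orbit_set Q w -> orbit_set Q (theta w).
Proof.
move=> h n; split; first by have [] := h n.+1; rewrite /Defs.thn iterSr.
case: n => [|n]; first by have [] := h 1.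
by rewrite /Defs.thmn iterSr thK; have [] := h n.
Qed.

Lemma orbit_set_thetainv Q w : orbit_set Q w -> orbit_set Q (thetainv w).
Proof.
move=> h n; split; last by have [] := h n.+1; rewrite /Defs.thmn iterSr.
case: n => [|n]; first by have [] := h 1.
by rewrite /Defs.thn iterSr thinvK; have [] := h n.
Qed.

Let thmnS_theta k w : thmn k.+1 (theta w) = thmn k w.
Proof. by rewrite /Defs.thmn iterSr thK. Qed.

(** The set of points whose past visits A infinitely often is strictly invariant. As a decreasing
    limit of unions of measure at least P A it has positive measure, hence measure 1 by
    ergodicity. *)
Lemma ergodic_recurrence (A : set Omega) : measurable A -> (0 < P A)%E ->
  {ae P, forall w, forall m, exists2 k, (m <= k)%N & A (thmn k w)}.
Proof.
move=> mA PA; pose F k := thmn k @^-1` A.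
have mF k : measurable (F k) by exact: measurable_iter.
have inv : theta @^-1` lim_sup_set F = lim_sup_set F.
  apply/seteqP; split=> w /= h m _.
    have [k /= mk Fk] := h m.+1 I; case: k mk Fk => // k mk Fk; exists k => //.
    by have : A (thmn k.+1 (theta w)) := Fk; rewrite thmnS_theta.
  have [k /= mk Fk] := h m I; exists k.+1; first exact: leqW.
  by rewrite -[F _ _]/(A (thmn k.+1 (theta w))) thmnS_theta.
have mL : measurable (lim_sup_set F).
  by apply: bigcap_measurable => // k _; exact: bigcup_measurable.
have PL : (P A <= P (lim_sup_set F))%E.
  have c := lim_sup_set_cvg P F mF.
  have fin : (P (\bigcup_(k >= 0) F k) < +oo)%E.
    by apply: le_lt_trans (probability_le1 _ _) _; [exact: bigcup_measurable | exact: ltry].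
  have {}c := c fin; rewrite -(cvg_lim _ c)//.
  apply: lime_ge; first by apply/cvg_ex; eexists; exact: c.
  apply: nearW => n; rewrite -(iter_pres mthetainv thetainv_pres n mA).
  apply: le_measure; rewrite ?inE//; first exact: measurable_iter.
    exact: bigcup_measurable.
  by move=> w Aw; exists n => /=.
have [L0|L1] := theta_erg mL inv.
  by move: (lt_le_trans PA PL); rewrite L0 ltxx.
exists (~` lim_sup_set F); split.
- exact: measurableC.
- by rewrite probability_setC ?L1 ?subee.
- move=> w /= nh h; apply: nh => m.
  by have [k /= mk Fk] := h m I; exists k.
Qed.

(** Pointwise form of the bound of the sum of P (g >= i), i >= 1, by the integral of g. *)
Lemma sum_indicator_le (g : R) n : 0 <= g ->
  \sum_(i < n) (if i.+1%:R <= g then 1 else 0 : R) <= g.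
Proof.
move=> g0; elim: n => [|n ih]; first by rewrite big_ord0.
rewrite big_ord_recr /=; case: ifPn => [h|_]; last by rewrite addr0.
apply: le_trans h; rewrite -natr1 lerD2r.
rewrite -[n in leRHS]card_ord -sumr_const; apply: ler_sum => i _.
by case: ifP.
Qed.

(** First Borel-Cantelli lemma for the events g (theta^(n+1) w) >= n + 1, whose probabilities are
    computed by invariance. The shift by one fits [kap], which evaluates K one fibre ahead. *)
Lemma integrable_sublinear (g : Omega -> R) : measurable_fun setT g -> (forall w, 0 <= g w) ->
  (\int[P]_w (g w)%:E < +oo)%E ->
  {ae P, forall w, exists N, forall n, (N <= n)%N -> g (thn n.+1 w) < n.+1%:R}.
Proof.
move=> mg g0 gint; pose A n := g @^-1` `[n.+1%:R, +oo[; pose F n := thn n.+1 @^-1` A n.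
have mA n : measurable (A n) by rewrite -[X in measurable X]setTI; exact: mg.
have mF n : measurable (F n) by exact: measurable_iter.
have L0 : P (lim_sup_set F) = 0%E.
  apply: lim_sup_set_cvg0 => //; apply: le_lt_trans gint.
  apply: lime_le; first exact: is_cvg_nneseries.
  apply: nearW => n; rewrite big_mkord.
  rewrite (eq_bigr (fun i : 'I_n => \int[P]_w (\1_(A i) w)%:E)%E); last first.
    by move=> i _; rewrite integral_indic// setIT; exact: (iter_pres mtheta theta_pres i.+1).
  rewrite -(@big_mkord _ _ _ n xpredT (fun i => \int[P]_w (\1_(A i) w)%:E)%E).
  rewrite -ge0_integral_sum//; last first.
    by move=> i; apply/measurable_EFinP; exact: measurable_indic.
  apply: ge0_le_integral => //.
  - by move=> w _; apply: sume_ge0 => i _; rewrite lee_fin.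
  - by apply: emeasurable_sum => i; apply/measurable_EFinP; exact: measurable_indic.
  - exact/measurable_EFinP.
  move=> w _; rewrite sumEFin lee_fin big_mkord; apply: le_trans (sum_indicator_le n (g0 w)).
  apply: ler_sum => i _; rewrite indicE; case: ifPn => h; first by case: (_ \in _).
  by rewrite memNset// /A /= in_itv /= andbT; exact/negP.
exists (lim_sup_set F); split => //.
  by apply: bigcap_measurable => // k _; exact: bigcup_measurable.
move=> w /= /forallNP nh m _.
have /existsNP[n /not_implyP[mn /negP]] := nh m; rewrite -leNgt => gn.
by exists n => //=; rewrite /F /A /= in_itv /= gn.
Qed.

(** From some random N on, |K|^p <= j + 1 <= n, that is K^2 <= n^(2/p); the finitely many earlier
    terms are absorbed in the random constant A. *)
Lemma inLp_orbit_growth (p : R) (K : Omega -> R) : 0 < p -> inLp P p K ->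
  {ae P, forall w, exists2 A : R, 0 <= A & forall n j, (j < n)%N ->
    K (thn j.+1 w) ^+ 2 <= A * n%:R `^ (2 / p)}.
Proof.
move=> p0 [mK intK].
have mg : measurable_fun setT (fun w => `|K w| `^ p).
  apply: (@measurableT_comp _ _ _ _ _ _ (fun x : R => x `^ p) _ (fun w => `|K w|)).
    exact: measurable_powR.
  exact: measurableT_comp.
have := integrable_sublinear mg (fun w => powR_ge0 _ _) intK.
apply: filterS => w [N hN]; exists (1 + \sum_(j < N) K (thn j.+1 w) ^+ 2).
  by rewrite addr_ge0// sumr_ge0// => j _; exact: sqr_ge0.
move=> n j jn; have n1 : 1 <= n%:R :> R by rewrite ler1n (leq_ltn_trans _ jn).
have S0 : 0 <= \sum_(j < N) K (thn j.+1 w) ^+ 2 by apply: sumr_ge0 => i _; exact: sqr_ge0.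
have np : 1 <= n%:R `^ (2 / p).
  apply: (@le_trans _ _ (n%:R `^ 0)); first by rewrite powRr0.
  by apply: ler_powR => //; rewrite divr_ge0// ltW.
have [jN|Nj] := ltnP j N.
  apply: (@le_trans _ _ (\sum_(j < N) K (thn j.+1 w) ^+ 2)); last first.
    apply: (@le_trans _ _ (1 + \sum_(j < N) K (thn j.+1 w) ^+ 2)); first by rewrite lerDr.
    by rewrite ler_peMr// addr_ge0.
  rewrite (bigD1 (Ordinal jN))//= lerDl; apply: sumr_ge0 => i _; exact: sqr_ge0.
apply: (@le_trans _ _ (n%:R `^ (2 / p))); last first.
  by rewrite ler_peMl ?powR_ge0// lerDl.
have h := ltW (hN j Nj); rewrite -real_normK ?num_real//.
have -> : `|K (thn j.+1 w)| ^+ 2 = (`|K (thn j.+1 w)| `^ p) `^ (2 / p).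
  by rewrite -powRrM mulrC divfK ?gt_eqF// powR_mulrn.
apply: ge0_ler_powR; rewrite ?nnegrE ?powR_ge0//; first by rewrite divr_ge0// ltW.
by apply: le_trans h _; rewrite ler_nat.
Qed.

End ergodic.

(** * Integrals against a bare nonnegative density *)

Section nonneg_density.
Context d {X : measurableType d} {R : realType} (mu : {measure set X -> \bar R}).

(* No measurability of h is needed, only the definition of the integral as a supremum over simple functions. *)
Lemma ge0_integralZr_nonmeas (D : set X) (h : X -> R) (c : R) : 0 <= c ->
  (forall x, 0 <= h x) ->
  (\int[mu]_(x in D) (h x * c)%:E = c%:E * \int[mu]_(x in D) (h x)%:E)%E.
Proof.
rewrite le_eqVlt => /predU1P[<-|c0] h0.
  by rewrite mul0e; apply: integral0_eq => x _; rewrite mulr0.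
have key (k : R) (g : X -> R) : 0 < k -> (forall x, 0 <= g x) ->
    (k%:E * \int[mu]_(x in D) (g x)%:E <= \int[mu]_(x in D) (g x * k)%:E)%E.
  move=> k0 g0; rewrite muleC -lee_pdivlMr//.
  rewrite [leLHS]ge0_integralE; last by move=> x _; rewrite lee_fin.
  apply: ge_ereal_sup => _ [s /= sle <-].
  rewrite lee_pdivlMr// muleC -sintegralrM ge0_integralE; last first.
    by move=> x _; rewrite lee_fin mulr_ge0// ltW.
  apply: ereal_sup_ubound; exists (scale_nnsfun s (ltW k0)) => //= x.
  have := sle x; rewrite /patch; case: ifPn => _; last first.
    by rewrite !lee_fin => sx; rewrite mulrC pmulr_lle0.
  by rewrite !lee_fin mulrC => sx; rewrite ler_wpM2r// ltW.
apply/eqP; rewrite eq_le key// andbT.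
rewrite muleC -lee_pdivrMr// muleC.
apply: le_trans (key c^-1 (fun x => h x * c) _ _) _; first by rewrite invr_gt0.
  by move=> x; rewrite mulr_ge0// ltW.
by under eq_integral do rewrite mulfK ?gt_eqF//.
Qed.

(** Covers infinite integrals too, since [fine] then gives 0 on both sides; [muint] can therefore be
    computed on fibrewise constants before h is known to be integrable. *)
Lemma fine_integralZr (D : set X) (h : X -> R) (c : R) : (forall x, 0 <= h x) ->
  fine (\int[mu]_(x in D) (h x * c)%:E) = c * fine (\int[mu]_(x in D) (h x)%:E).
Proof.
move=> h0; have I0 : (0 <= \int[mu]_(x in D) (h x)%:E)%E.
  by apply: integral_ge0 => x _; rewrite lee_fin.
have fM (r : R) (e : \bar R) : (0 <= e)%E -> fine (r%:E * e)%E = r * fine e.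
  case: e => [e _|_|//]; first by [].
  rewrite /= mulr0; have [r0|r0|->] := ltgtP r 0; last by rewrite mul0e.
    by rewrite lt0_muley ?lte_fin.
  by rewrite gt0_muley ?lte_fin.
have [c0|c0] := leP 0 c; first by rewrite ge0_integralZr_nonmeas// fM.
have -> : (\int[mu]_(x in D) (h x * c)%:E = - \int[mu]_(x in D) (h x * - c)%:E)%E.
  rewrite -integral_ge0N; last by move=> x _; rewrite lee_fin mulr_ge0// oppr_ge0 ltW.
  by apply: eq_integral => x _; rewrite -EFinN mulrN opprK.
rewrite ge0_integralZr_nonmeas ?oppr_ge0 ?(ltW c0)// fineN fM// mulNr opprK//.
Qed.

End nonneg_density.

(** * Non-degeneracy of the observable *)

Section constant_observable.
Context {R : realType} {dO dX : measure_display}.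
Context {Omega : measurableType dO} {X : measurableType dX}.
Variables (theta thetainv : Omega -> Omega).
Variables (E : Omega -> set X) (T : Omega -> X -> X) (phi u : Omega -> X -> R).
Variable nu : Omega -> {measure set X -> \bar R}.
Hypothesis TE : forall w x, E w x -> E (theta w) (T w x).
Local Notation hdens := (hdens theta thetainv E T phi nu).
Local Notation muint := (muint theta thetainv E T phi nu).
Local Notation sigma2n := (sigma2n theta thetainv E T phi nu u).
Local Notation ut := (ut theta thetainv E T phi nu u).
Local Notation thn := (thn theta).

Lemma Lop_ge0 w (g : X -> R) x : (forall y, 0 <= g y) -> 0 <= Lop E T phi w g x.
Proof.
move=> g0; rewrite /Lop [X in _ - fine X]esum1 ?subr0.
  by apply: fine_ge0; apply: esum_ge0 => y _; rewrite lee_fin le_max lexx orbT.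
move=> y _; congr (_%:E); apply/max_idPr.
by rewrite oppr_le0 mulr_ge0 ?expR_ge0.
Qed.

Lemma hdens_ge0 w x : 0 <= hdens w x.
Proof.
have L0 w' n y : 0 <= Ln theta E T phi w' n (@Defs.one R dX X) y.
  by elim: n y => [y|n ih y] /=; [exact: ler01 | exact: Lop_ge0].
have l0 w' : 0 <= lam theta E T phi nu w'.
  apply: fine_ge0; apply: integral_ge0 => y _; rewrite lee_fin Lop_ge0// => z; exact: ler01.
rewrite /Defs.hdens; set f := (fun n => _ / _).
have f0 n : 0 <= f n.
  by rewrite divr_ge0// /lamn prodr_ge0.
have [c|c] := pselect (cvgn f); first by apply: limr_ge => //; exact: nearW.
by rewrite dvgP.
Qed.

Lemma muint_cst w c f : (forall x, E w x -> f x = c) -> muint w f = c * muint w (fun=> 1).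
Proof.
move=> fc; rewrite /Defs.muint -fine_integralZr; last by move=> x; rewrite mulr1 hdens_ge0.
by congr (fine _); apply: eq_integral => x; rewrite inE => /fc ->; rewrite mulr1.
Qed.

(* A fibrewise constant observable has vanishing variance unless h is not a probability density, in which case centering forces it to vanish. *)
Lemma observable_not_constant w (sigma : R) : 0 < sigma ->
  (forall j, (fun n => sigma2n (thn j w) n / n%:R) @ \oo --> sigma ^+ 2) ->
  ~ (forall n x, E (thn n w) x -> ut (thn n w) x = 0).
Proof.
move=> s0 hs u0.
pose c j := muint (thn j w) (u (thn j w)); pose m j := muint (thn j w) (fun=> 1).
have uc j x : E (thn j w) x -> u (thn j w) x = c j by move=> /u0 /eqP; rewrite subr_eq0 => /eqP.
(* On a fibre where [ut] vanishes, u equals its own integral c; integrating this constant against h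
   gives c m, with m the total mass. *)
have cm j : c j = c j * m j by apply: muint_cst => x; exact: uc.
have thnA i j : thn i (thn j w) = thn (i + j) w by rewrite /Defs.thn iterD.
have Sc j n x : E (thn j w) x -> Sn theta T u (thn j w) n x = \sum_(i < n) c (i + j)%N.
  move=> Ex; apply: eq_bigr => i _.
  by have := Tn_E TE i Ex; rewrite thnA => /uc.
have sE j n : sigma2n (thn j w) n =
    (\sum_(i < n) c (i + j)%N * (1 - m j)) ^+ 2 * m j.
  rewrite /Defs.sigma2n; apply: muint_cst => x Ex.
  rewrite (muint_cst (c := \sum_(i < n) c (i + j)%N)); last by move=> z; exact: Sc.
  by rewrite Sc// -mulr_suml mulrBr mulr1.
have contra j : (forall n, sigma2n (thn j w) n = 0) -> False.
  move=> h; have := hs j.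
  have -> : (fun n => sigma2n (thn j w) n / n%:R) = fun=> 0.
    by apply/funext => n; rewrite h mul0r.
  move=> /(cvg_unique _ (cvg_cst 0)) e; have := exprn_gt0 2 s0.
  by rewrite -e ?ltxx.
have m1 j : m j != 1.
  apply/eqP => e; apply: (contra j) => n; rewrite sE e subrr.
  by rewrite big1 ?expr0n ?mul0r// => i _; rewrite mulr0.
have c0 j : c j = 0.
  have h : c j * (m j - 1) = 0 by rewrite mulrBr mulr1 -cm subrr.
  by move/eqP: h; rewrite mulf_eq0 subr_eq0 (negbTE (m1 j)) orbF => /eqP.
apply: (contra 0) => n; rewrite sE big1 ?expr0n ?mul0r// => i _.
by rewrite c0 mul0r.
Qed.

End constant_observable.

(** * Assembling the almost sure statement *)

Section cone_systems.
Context {R : realType} {dO dX : measure_display}.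
Context {Omega : measurableType dO} {X : measurableType dX}.
Variables (theta thetainv : Omega -> Omega) (dist : X -> X -> R) (alpha : R).
Variables (E : Omega -> set X) (T : Omega -> X -> X) (phi u : Omega -> X -> R).
Variable nu : Omega -> probability X R.
Local Notation nu' := (fun w => nu w : {measure set X -> \bar R}).
Local Notation L := (Lop E T phi).
Local Notation ut := (ut theta thetainv E T phi nu' u).
Local Notation supu := (supu theta thetainv E T phi nu' u).
Local Notation thn := (thn theta).
Local Notation thmn := (thmn thetainv).

(* Everything the argument uses about setting A or B, on a theta-invariant set gd of base points. *)
Record cone_system (gd : set Omega) (C : Omega -> set (X -> R)) (de CK cc kap : Omega -> R) : Prop := ConeSystem {
  cs_branches : forall w, gd w -> exists I y l H D,
    branches dist alpha (E w) (E (theta w)) (Defs.preim E T w) (phi w) I y l H D;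
  cs_add : forall w f g, gd w -> C w f -> C w g -> C w (fun x => f x + g x);
  cs_scale : forall w (c : R) f, gd w -> 0 <= c -> C w f -> C w (fun x => c * f x);
  cs_one : forall w, gd w -> C w (@Defs.one R dX X);
  cs_lim : forall w (f : nat -> X -> R) (g : X -> R), gd w -> (forall n, C w (f n)) ->
    (forall x, E w x -> f^~ x @ \oo --> g x) -> C w g;
  cs_ge0 : forall w f x, gd w -> C w f -> E w x -> 0 <= f x;
  cs_K : forall w f x y, gd w -> C w f -> E w x -> E w y -> f x <= CK w * f y;
  cs_holder : forall w f, gd w -> C w f -> holder_fun dist alpha (E w) f;
  cs_L : forall w f, gd w -> C w f -> C (theta w) (L w f);
  cs_de_gt0 : forall w, gd w -> 0 < de w;
  cs_de_le : forall w, gd w -> de w <= 1 / 2;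
  cs_contr : forall w f g, gd w -> C w f -> C w g ->
    nuI E nu (theta w) (L w g) <= nuI E nu (theta w) (L w f) ->
    C (theta w) (fun x => (1 - de w) * L w f x - de w * L w g x);
  cs_ut : forall w, gd w -> supu w <= cc w;
  cs_cc : forall w, gd w -> cc w <= kap w * de w;
  cs_pert1 : forall w (s : R) f, gd w -> s ^+ 2 = 1 -> C w f ->
    C (theta w) (L w (fun x => (cc w + s * ut w x) * f x));
  cs_pert2 : forall w (s s' : R) f, gd w -> s ^+ 2 = 1 -> s' ^+ 2 = 1 -> C w f ->
    C (theta w) (L w (fun x => (cc w + s * ut w x) * ((cc w + s' * ut w x) * f x)))
}.

Hypothesis dist_metric : is_metric dist.
Hypothesis dist_le1 : forall x y, dist x y <= 1.
Hypothesis borel : forall A : set X, measurable A <-> <<s dopen dist >> A.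
Hypothesis alpha_gt0 : 0 < alpha.
Hypothesis alpha_le1 : alpha <= 1.
Hypothesis mE : forall w, measurable (E w).
Hypothesis TE : forall w x, E w x -> E (theta w) (T w x).
Hypothesis mT : forall w, measurable_fun (E w) (T w).
Hypothesis u_holder : forall w, holder_fun dist alpha (E w) (u w).
Hypothesis thK : cancel theta thetainv.
Hypothesis thinvK : cancel thetainv theta.
Variables (p sigma : R) (a : nat -> R).
Hypothesis p_gt8 : 8 < p.
Hypothesis sigma_gt0 : 0 < sigma.
Hypothesis a_gt0 : forall n, 0 < a n.
Hypothesis a_large : (fun n => a n * n%:R `^ (- Num.max (6 / p) (1 / 2))) @ \oo --> +oo.
Hypothesis a_small : (fun n => a n / n%:R `^ (1 - 8 / p)) @ \oo --> 0.

Definition mdp_at w := forall G : set R, measurable G ->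
  let s := mdp_seq theta thetainv E T phi nu' u a G w in
  [/\ (- ereal_inf [set (x ^+ 2 / (2 * sigma ^+ 2))%:E | x in interior G] <= limn_einf s)%E,
      (limn_einf s <= limn_esup s)%E &
      (limn_esup s <= - ereal_inf [set (x ^+ 2 / (2 * sigma ^+ 2))%:E | x in closure G])%E].

Section fixed_system.
Variables (gd : set Omega) (C : Omega -> set (X -> R)) (de CK cc kap : Omega -> R).
Hypothesis cs : cone_system gd C de CK cc kap.
Hypothesis gd_theta : forall w, gd w -> gd (theta w).
Hypothesis gd_thetainv : forall w, gd w -> gd (thetainv w).
Hypothesis gd_conformal : forall w, gd w -> conformal_nu dist alpha theta E T phi nu' w.
Hypothesis gd_recurrent : forall w, gd w -> exists2 e : R, 0 < e &
  forall m, exists2 k, (m <= k)%N & e <= de (thmn k w).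
Hypothesis gd_sigma : forall w, gd w ->
  (fun n => sigma2n theta thetainv E T phi nu' u w n / n%:R) @ \oo --> sigma ^+ 2.
Hypothesis gd_growth : forall w, gd w -> exists2 A : R, 0 <= A &
  forall n j, (j < n)%N -> kap (thn j w) <= A * n%:R `^ (2 / p).

Let gd_nuE w : gd w -> nu w (E w) = 1%E. Proof. by case/gd_conformal. Qed.

Let ut_bmf w : bmf (E w) (ut w).
Proof.
exact: (holder_bmf dist_metric borel alpha_gt0 (mE w) (ut_holder theta thetainv T phi nu' dist_metric u_holder w)).
Qed.

Let u_bmf w : bmf (E w) (u w).
Proof. exact: (holder_bmf dist_metric borel alpha_gt0 (mE w) (u_holder w)). Qed.

Let hdens_facts w : gd w ->
  nuI E nu w (hdens theta thetainv E T phi nu' w) = 1 /\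
  bmf (E w) (hdens theta thetainv E T phi nu' w).
Proof.
case: cs => c1 c2 c3 c4 c5 c6 c7 c8 c9 c10 c11 c12 _ _ _ _ gw; split.
  exact: (nuI_hdens dist_metric dist_le1 borel alpha_gt0 alpha_le1 mE gd_theta c1 gd_nuE
    gd_conformal c2 c3 c4 c5 c6 c7 c8 c9 c10 c11 c12 thinvK gd_thetainv gd_recurrent gw).
exact: (hdens_bmf dist_metric dist_le1 borel alpha_gt0 alpha_le1 mE gd_theta c1 gd_nuE
    gd_conformal c2 c3 c4 c5 c6 c7 c8 c9 c10 c11 c12 thinvK gd_thetainv gd_recurrent gw).
Qed.

Let ut_int0 w : gd w -> nuI E nu w (fun x => hdens theta thetainv E T phi nu' w x * ut w x) = 0.
Proof.
move=> gw; have [h1 bh] := hdens_facts gw.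
set m := muint theta thetainv E T phi nu' w (u w).
rewrite (@eq_nuI _ _ _ _ _ E nu w _ (fun x => hdens theta thetainv E T phi nu' w x * u w x -
   m * hdens theta thetainv E T phi nu' w x)); last first.
  by move=> x _; rewrite /Defs.ut -/m; ring.
rewrite (nuI_B nu mE); [|exact: bmfM|exact: bmfZ].
by rewrite (nuI_Z nu mE)// h1 mulr1 subrr.
Qed.

Lemma cone_system_mdp w : gd w -> mdp_at w.
Proof.
move=> gw G mG s.
have ne : (limn_einf s <= limn_esup s)%E by exact: limn_einf_sup.
have [A A0 hA] := gd_growth gw.
have var := gd_sigma gw.
case: (cs) => c1 c2 c3 c4 c5 c6 c7 c8 c9 c10 c11 c12 c13 c14 c15 c16.
have ut_cc w' x : gd w' -> E w' x -> `|ut w' x| <= cc w'.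
  move=> gw' Ex; apply: le_trans (c13 _ gw').
  exact: (ut_le theta thetainv T phi nu' dist_metric u_holder Ex).
have uE : forall w x, u w x = ut w x + muint theta thetainv E T phi nu' w (u w).
  by move=> w' x; rewrite /Defs.ut subrK.
have en2 n := variance_en dist_metric dist_le1 borel alpha_gt0 alpha_le1 mE TE mT gd_theta c1 gd_nuE
    gd_conformal c2 c3 c4 c5 c6 c7 c8 c9 c10 c11 c12 thK thinvK gd_thetainv gd_recurrent
    (fun w' (gw' : gd w') => ut_bmf w') ut_int0 n gw uE.
have mdp := @moderate_deviations R dO dX Omega X theta thetainv dist alpha E T phi nu dist_metric dist_le1 borel alpha_gt0 alpha_le1 mE TE mT gd gd_theta c1 gd_nuE
    gd_conformal C de CK c2 c3 c4 c5 c6 c7 c8 c9 c10 c11 c12 thK thinvK gd_thetainv gd_recurrent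
    ut cc kap (fun w' (gw' : gd w') => ut_bmf w') ut_int0 ut_cc c14 c15 c16 w a
    (fun n => A * n%:R `^ (2 / p)) sigma gw.
have kn0 n : 0 <= A * n%:R `^ (2 / p) by rewrite mulr_ge0 ?powR_ge0.
have m2 := mdp kn0 hA a_gt0 sigma_gt0 (speed_cvg0 a_gt0 a_large)
  (growth_div_cvg0 p_gt8 a_gt0 a_large A0) (growth_mul_cvg0 p_gt8 a_gt0 a_small A0)
  (growth_cube_cvg0 p_gt8 a_gt0 a_small A0).
case: (m2 _ G mG) => [|lo up]; last by split.
apply: cvg_trans var; apply: near_eq_cvg; apply: nearW => n /=.
by rewrite -(en2 n).
Qed.

End fixed_system.

Section almost_sure.
Variable P : probability Omega R.
Hypothesis mtheta : measurable_fun setT theta.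
Hypothesis mthetainv : measurable_fun setT thetainv.
Hypothesis theta_pres : forall A, measurable A -> P (theta @^-1` A) = P A.
Hypothesis theta_erg : forall A, measurable A -> theta @^-1` A = A -> P A = 0%E \/ P A = 1%E.
Hypothesis ae_conformal : {ae P, forall w, conformal_nu dist alpha theta E T phi nu' w}.
Hypothesis ae_sigma : {ae P, forall w,
  (fun n => sigma2n theta thetainv E T phi nu' u w n / n%:R) @ \oo --> sigma ^+ 2}.
Variables (Q : set Omega) (K : Omega -> R) (M : R).
Hypothesis ae_Q : {ae P, forall w, Q w}.
Hypothesis K_Lp : inLp P p K.
Hypothesis msupu : measurable_fun setT supu.
Hypothesis M_gt0 : 0 < M.
Variables (C : Omega -> set (X -> R)) (de CK cc : Omega -> R).
Hypothesis sys : forall gd, gd `<=` Q -> (forall w, gd w -> gd (theta w)) ->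
  (forall w, gd w -> nu w (E w) = 1%E) ->
  cone_system gd C de CK cc (fun w => M * K (theta w) ^+ 2).

(** On A N the chain supu <= cc <= M K^2 de bounds de from below by 1 / (M (N+1)^3), so returns to A
    N provide the recurrence on which the density depends. *)
Let A N := [set w | N.+1%:R^-1 <= supu w /\ `|K (theta w)| <= N.+1%:R].

Let mA N : measurable (A N).
Proof.
have -> : A N = supu @^-1` `[N.+1%:R^-1, +oo[ `&` theta @^-1` (K @^-1` `[- N.+1%:R, N.+1%:R]).
  apply/seteqP; split=> w; rewrite /A /= !in_itv /= andbT -ler_norml.
    by move=> [-> ->].
  by move=> [-> ->].
apply: measurableI; first exact: measurable_preimT.
apply: measurable_preimT => //; apply: measurable_preimT => //.
by case: K_Lp.
Qed.

(* If supu vanished almost surely then S_n u would be constant on almost every fibre, against sigma > 0. *)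
Let A_charged : exists N, (0 < P (A N))%E.
Proof.
apply/not_existsP => h.
have nullA : {ae P, forall w, forall N, ~ A N w}.
  apply: ae_forall_nat => N; exists (A N); split => //.
    by apply/eqP; rewrite eq_le measure_ge0 andbT leNgt; apply/negP; exact: h.
  by move=> w /= /contrapT.
have ae1 := ae_orbit_set thK mtheta mthetainv theta_pres (ae_setI nullA ae_sigma).
have PF : ProperFilter (almost_everywhere P).
  have PT : (0 < P setT)%E by rewrite probability_setT.
  exact: (ae_properfilter_algebraOfSetsType PT).
have [w ow] := @filter_ex _ _ PF _ ae1.
apply: (observable_not_constant TE sigma_gt0 (fun j => (ow j).1.2)) => n x Ex.
have hu : `|ut (thn n w) x| <= supu (thn n w) by exact: (ut_le theta thetainv T phi nu' dist_metric u_holder Ex).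
apply/eqP; rewrite -normr_le0 leNgt; apply/negP => u0.
have s0 : 0 < supu (thn n w) by exact: lt_le_trans u0 hu.
pose N := (Num.truncn (supu (thn n w))^-1 + Num.truncn `|K (theta (thn n w))|)%N.
have [hN _] := (ow n).1; apply: (hN N); split.
  rewrite invf_ple ?posrE//; apply: le_trans (ltW (truncnS_gt _)) _.
  by rewrite ler_nat ltnS leq_addr.
apply: le_trans (ltW (truncnS_gt _)) _.
by rewrite ler_nat ltnS leq_addl.
Qed.

Lemma ae_mdp : {ae P, forall w, mdp_at w}.
Proof.
have p0 : 0 < p by rewrite (lt_trans _ p_gt8).
have [N PN] := A_charged.
have ae_rec := ergodic_recurrence thK mthetainv theta_pres theta_erg (mA N) PN.
have ae_gr := inLp_orbit_growth mtheta theta_pres p0 K_Lp.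
have := ae_orbit_set thK mtheta mthetainv theta_pres
  (ae_setI ae_Q (ae_setI ae_conformal (ae_setI ae_sigma (ae_setI ae_rec ae_gr)))).
apply: filterS => w; set gd0 := (X in orbit_set _ _ X) => gw.
pose gd := orbit_set theta thetainv gd0.
have gd_theta w' : gd w' -> gd (theta w') by exact: orbit_set_theta.
have gd_thetainv w' : gd w' -> gd (thetainv w') by exact: orbit_set_thetainv.
have gd_nuE w' : gd w' -> nu w' (E w') = 1%E by move=> /orbit_set_id[_ [[]]].
have gdQ : gd `<=` Q by move=> w' /orbit_set_id[].
have cs := sys gdQ gd_theta gd_nuE.
apply: (cone_system_mdp cs gd_theta gd_thetainv) => // w' gw'.
- by have [_ []] := orbit_set_id gw'.
- have [_ [_ [_ [rec _]]]] := orbit_set_id gw'.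
  exists (N.+1%:R^-1 / (M * N.+1%:R ^+ 2)) => [|m].
    by rewrite divr_gt0 ?invr_gt0// mulr_gt0// exprn_gt0.
  have [k mk [h1 h2]] := rec m; exists k => //.
  have gk : gd (thmn k w') by elim: k {mk h1 h2} => [//|k ih]; exact: gd_thetainv.
  rewrite ler_pdivrMr ?mulr_gt0 ?exprn_gt0//.
  apply: le_trans h1 _; apply: le_trans (cs_ut cs gk) _; apply: le_trans (cs_cc cs gk) _.
  rewrite mulrC ler_wpM2l ?(ltW (cs_de_gt0 cs gk))// ler_wpM2l ?(ltW M_gt0)//.
  by rewrite -real_normK ?num_real// !expr2 ler_pM.
- by have [_ [_ [h _]]] := orbit_set_id gw'.
have [_ [_ [_ [_ [B B0 hB]]]]] := orbit_set_id gw'.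
exists (M * B) => [|n j jn]; first by rewrite mulr_ge0 ?(ltW M_gt0).
by rewrite -mulrA ler_wpM2l ?(ltW M_gt0)//; exact: hB.
Qed.

End almost_sure.
End cone_systems.

Lemma ess_sup_lty_ae (R : realType) d (T : measurableType d) (mu : {measure set T -> \bar R})
  (f : T -> \bar R) : (ess_sup mu f < +oo)%E ->
  exists2 M : R, 1 <= M & {ae mu, forall w, (f w <= M%:E)%E}.
Proof.
move=> /ereal_inf_lt[y /= fy yoo]; exists (Num.max 1 (fine y)).
  by rewrite le_max lexx.
apply: filterS fy => w fw; apply: le_trans fw _.
by case: y yoo => [r|//|] _; rewrite ?leNye// lee_fin le_max lexx orbT.
Qed.

(** * Measurability of fibres and fibre maps *)

Section random_maps.
Context {R : realType} {dO dX : measure_display}.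
Context {Omega : measurableType dO} {X : measurableType dX}.
Variables (E : Omega -> set X) (T : Omega -> X -> X).
Hypothesis mEE : (dO, dX).-prod.-measurable [set z : Omega * X | E z.1 z.2].

Lemma fibre_measurable w : measurable (E w).
Proof.
have := measurable_xsection w mEE; congr (measurable _).
by apply/seteqP; split=> x; rewrite /xsection /= inE.
Qed.

Lemma fibre_map_measurable w :
  measurable_fun [set z : Omega * X | E z.1 z.2] (fun z => T z.1 z.2) ->
  measurable_fun (E w) (T w).
Proof.
move=> mT; apply: (@measurable_comp _ _ _ _ _ _ [set z : Omega * X | E z.1 z.2]
  (fun z => T z.1 z.2) (E w) (fun x => (w, x)) mEE) => //.
  by move=> _ [x Ex <-].
by apply: measurable_funTS; exact: measurable_pair1.
Qed.

End random_maps.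

(** * Verification of the cone axioms in the two settings *)

Section settings.
Context {R : realType} {dO dX : measure_display}.
Context {Omega : measurableType dO} {X : measurableType dX}.
Variables (theta thetainv : Omega -> Omega) (dist : X -> X -> R) (alpha : R).
Variables (E : Omega -> set X) (T : Omega -> X -> X) (phi u : Omega -> X -> R).
Variable nu : Omega -> probability X R.
Local Notation nu' := (fun w => nu w : {measure set X -> \bar R}).
Hypothesis dist_metric : is_metric dist.
Hypothesis dist_le1 : forall x y, dist x y <= 1.
Hypothesis borel : forall A : set X, measurable A <-> <<s dopen dist >> A.
Hypothesis alpha_gt0 : 0 < alpha.
Hypothesis mE : forall w, measurable (E w).
Hypothesis u_holder : forall w, holder_fun dist alpha (E w) (u w).
Variable P : probability Omega R.

Lemma cone_system_A (gam HA DA : Omega -> R) (p : R) :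
  settingA dist alpha theta E T phi P gam HA DA ->
  condA dist alpha theta thetainv E T phi nu' u P gam HA DA p ->
  exists Q C de CK cc M, [/\ {ae P, forall w, Q w}, 0 < M &
    forall gd : set Omega, gd `<=` Q -> (forall w, gd w -> gd (theta w)) ->
      (forall w, gd w -> nu w (E w) = 1%E) ->
      cone_system theta thetainv dist alpha E T phi u nu gd C de CK cc
        (fun w => M * KA alpha gam (theta w) ^+ 2)].
Proof.
move=> [_ _ _ raw] [/ess_sup_lty_ae[M M1 EM] _ _].
pose Q := [set w | fibreA theta dist alpha E T phi gam HA DA w] `&`
  [set w | (EA dist alpha theta thetainv E T phi nu' u gam HA w <= M%:E)%E].
have M0 : 0 <= M by rewrite (le_trans ler01).
exists Q, (CA dist alpha E gam), (deA theta alpha gam HA), (CKA alpha gam),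
  (ccA theta thetainv dist alpha E T phi u nu gam HA), (12 * M); split.
- exact: ae_setI raw EM.
- by rewrite mulr_gt0// (lt_le_trans ltr01).
move=> gd gdQ gd_theta gd_nuE.
have gd_raw w : gd w -> _ := fun gw => (gdQ w gw).1.
have gd_EA w : gd w -> _ := fun gw => (gdQ w gw).2.
have k0 w : 0 <= gam w `^ alpha by exact: powR_ge0.
split.
- by move=> w gw; have [I [y br]] := branchesA gd_raw gw; do 5!eexists; exact: br.
- by move=> w f g _; exact: lcone_add.
- by move=> w c f _; exact: lcone_scale.
- by move=> w _; exact: lcone_one.
- by move=> w f g _; exact: lcone_lim.
- by move=> w f x _ [h _]; exact: h.
- by move=> w f x y _; exact: lcone_K.
- by move=> w f _; exact: lcone_holder.
- exact: (CA_L' dist_metric dist_le1 borel alpha_gt0 mE gd_theta gd_raw gd_EA).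
- exact: (deA_gt0 gd_raw gd_EA).
- exact: (deA_le alpha_gt0 gd_theta gd_raw gd_EA).
- exact: (CA_contr dist_metric dist_le1 borel alpha_gt0 mE gd_theta gd_nuE gd_raw gd_EA).
- exact: (supu_le_ccA alpha_gt0 gd_theta gd_raw gd_EA).
- move=> w gw; apply: le_trans (ccA_le dist_metric alpha_gt0 u_holder M0 gd_theta gd_nuE gd_raw gd_EA gw) _.
  rewrite ler_wpM2r ?(ltW (deA_gt0 gd_raw gd_EA gw))// ler_peMr ?mulr_ge0//.
  (* As K >= 1, the constant bound of [ccA_le] may be multiplied by K^2 to fit the common form of
     [kap]. *)
  have K1 : 1 <= KA alpha gam (theta w).
    by rewrite /KA mulr_ege1 ?lerDl//; apply: le_trans (expR_ge1Dx _); rewrite lerDl.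
  exact: exprn_ege1.
- exact: (CA_pert1 dist_metric dist_le1 borel alpha_gt0 mE u_holder gd_theta gd_raw gd_EA).
- exact: (CA_pert2 dist_metric dist_le1 borel alpha_gt0 mE u_holder gd_theta gd_raw gd_EA).
Qed.

Hypothesis phi_bounded : forall w, exists M : R, forall x, E w x -> `|phi w x| <= M.

Lemma cone_system_B (l sig : Omega -> R) (qB dB : Omega -> nat) (yB : Omega -> nat -> X -> X) (p : R) :
  settingB dist alpha theta E T phi P l sig qB dB yB ->
  condB dist alpha theta thetainv E T phi nu' u P l sig qB dB yB p ->
  exists Q C de CK cc M, [/\ {ae P, forall w, Q w}, 0 < M &
    forall gd : set Omega, gd `<=` Q -> (forall w, gd w -> gd (theta w)) ->
      (forall w, gd w -> nu w (E w) = 1%E) ->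
      cone_system theta thetainv dist alpha E T phi u nu gd C de CK cc
        (fun w => M * KB alpha E phi l sig qB dB (theta w) ^+ 2)].
Proof.
move=> [_ _ _ _ raw] [/ess_sup_lty_ae[M M1 EM] _ _ _ _].
pose Q := [set w | fibreB theta dist alpha E T phi l sig qB dB yB w] `&`
  [set w | (EB dist alpha theta thetainv E T phi nu' u l sig qB dB yB w <= M%:E)%E].
have M0 : 0 <= M by rewrite (le_trans ler01).
exists Q, (CB dist alpha E phi l sig qB dB), (deB theta dist alpha E phi l sig qB dB yB), (CKB alpha E phi l sig qB dB),
  (ccB theta thetainv dist alpha E T phi u nu l sig qB dB yB), (8 * M); split.
- exact: ae_setI raw EM.
- by rewrite mulr_gt0// (lt_le_trans ltr01).
move=> gd gdQ gd_theta gd_nuE.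
have gd_raw w : gd w -> _ := fun gw => (gdQ w gw).1.
have gd_EB w : gd w -> _ := fun gw => (gdQ w gw).2.
pose s w := sB alpha E phi l sig qB dB w.
have s_gt0 w : gd w -> 0 < s w by move=> gw; exact: (sB_gt0 gd_raw gw).
have k0 w : gd w -> 0 <= (s w)^-1 by move=> gw; rewrite invr_ge0 ltW// s_gt0.
split.
- move=> w gw; have [D br] := branchesB dist_metric phi_bounded gd_raw gw.
  by do 5!eexists; exact: br.
- by move=> w f g _; exact: hcone_add.
- by move=> w c f _; exact: hcone_scale.
- by move=> w gw; exact: (hcone_one _ _ _ (k0 w gw)).
- by move=> w f g _; exact: hcone_lim.
- by move=> w f x _ [h _]; exact: h.
- by move=> w f x y gw; exact: (hcone_K dist_metric dist_le1 alpha_gt0 (k0 w gw)).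
- by move=> w f gw; exact: (hcone_holder dist_metric dist_le1 alpha_gt0 (k0 w gw)).
- exact: (CB_L' dist_metric dist_le1 alpha_gt0 phi_bounded gd_theta gd_nuE gd_raw gd_EB).
- exact: (deB_gt0 gd_theta gd_raw gd_EB).
- exact: (deB_le gd_theta gd_raw gd_EB).
- exact: (CB_contr dist_metric dist_le1 borel alpha_gt0 mE phi_bounded gd_theta gd_nuE gd_raw gd_EB).
- exact: (supu_le_ccB dist_metric u_holder gd_theta gd_nuE gd_raw gd_EB).
- move=> w gw; apply: le_trans (ccB_le dist_metric u_holder phi_bounded M0 gd_theta gd_nuE gd_raw gd_EB gw) _.
  rewrite ler_wpM2r ?(ltW (deB_gt0 gd_theta gd_raw gd_EB gw))// ler_wpM2l ?mulr_ge0//.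
  (* Here K^2 absorbs the factor s(theta w)^-2 of [ccB_le], as 1 / s <= 1 + 2 / s. *)
  have h := k0 _ (gd_theta w gw); rewrite ler_pXn2r ?nnegrE//.
    by rewrite /KB -/(s (theta w)); lra.
  by rewrite /KB addr_ge0// mulr_ge0.
- exact: (CB_pert1 dist_metric dist_le1 alpha_gt0 u_holder phi_bounded gd_theta gd_nuE gd_raw gd_EB).
- exact: (CB_pert2 dist_metric dist_le1 alpha_gt0 u_holder phi_bounded gd_theta gd_nuE gd_raw gd_EB).
Qed.

End settings.

Unset Implicit Arguments.

Theorem mainTheorem6
  (R : realType) (dO dX : measure_display)
  (Omega : measurableType dO) (X : measurableType dX)
  (P : probability Omega R)
  (theta thetainv : Omega -> Omega)
  (dist : X -> X -> R) (alpha : R)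
  (E : Omega -> set X) (T : Omega -> X -> X) (phi u : Omega -> X -> R)
  (nu : Omega -> probability X R)
  (gam HA DA : Omega -> R)
  (l sig : Omega -> R) (qB dB : Omega -> nat) (yB : Omega -> nat -> X -> X)
  (p sigma : R) (a : nat -> R) :
  (* theta: invertible, bimeasurable, P-preserving, ergodic *)
  cancel theta thetainv -> cancel thetainv theta ->
  measurable_fun setT theta -> measurable_fun setT thetainv ->
  (forall A, measurable A -> P (theta @^-1` A) = P A) ->
  (forall A, measurable A -> theta @^-1` A = A -> P A = 0%E \/ P A = 1%E) ->
  (* X: compact metric space of diameter <= 1, with its Borel sigma-algebra *)
  is_metric dist -> (forall x y, dist x y <= 1) -> dcompact dist setT ->
  (forall A : set X, measurable A <-> <<s dopen dist >> A) ->
  0 < alpha <= 1 ->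
  (* the random compact set E, the maps T, the potential phi, observable u *)
  (dO, dX).-prod.-measurable [set z : Omega * X | E z.1 z.2] ->
  (forall w, dcompact dist (E w)) ->
  (forall w x, E w x -> E (theta w) (T w x)) ->
  measurable_fun [set z : Omega * X | E z.1 z.2] (fun z => T z.1 z.2) ->
  measurable_fun [set z : Omega * X | E z.1 z.2] (fun z => phi z.1 z.2) ->
  (forall w, exists M : R, forall x, E w x -> `|phi w x| <= M) ->
  measurable_fun [set z : Omega * X | E z.1 z.2] (fun z => u z.1 z.2) ->
  (forall w, holder_fun dist alpha (E w) (u w)) ->
  (* nu is the random conformal (Gibbs) measure *)
  {ae P, forall w, conformal_nu dist alpha theta E T phi
                     (fun w => nu w : {measure set X -> \bar R}) w} ->
  (* Setting A with (a)-(c), or Setting B with (a),(c) *)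
  ((settingA dist alpha theta E T phi P gam HA DA /\
    condA dist alpha theta thetainv E T phi
      (fun w => nu w : {measure set X -> \bar R}) u P gam HA DA p) \/
   (settingB dist alpha theta E T phi P l sig qB dB yB /\
    condB dist alpha theta thetainv E T phi
      (fun w => nu w : {measure set X -> \bar R}) u P l sig qB dB yB p)) ->
  8 < p ->
  (* (d) *)
  0 < sigma ->
  {ae P, forall w,
    (fun n => sigma2n theta thetainv E T phi
                (fun w => nu w : {measure set X -> \bar R}) u w n / n%:R)
      @ \oo --> sigma ^+ 2} ->
  (* the sequence a_n *)
  (forall n, 0 < a n) ->
  (fun n => a n * (n%:R) `^ (- Num.max (6 / p) (1 / 2))) @ \oo --> +oo ->
  (fun n => a n / (n%:R) `^ (1 - 8 / p)) @ \oo --> 0 ->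
  {ae P, forall w, forall G : set R, measurable G ->
    let s := mdp_seq theta thetainv E T phi
               (fun w => nu w : {measure set X -> \bar R}) u a G w in
    [/\ (- ereal_inf [set (x ^+ 2 / (2 * sigma ^+ 2))%:E | x in interior G]
           <= limn_einf s)%E,
        (limn_einf s <= limn_esup s)%E &
        (limn_esup s <= - ereal_inf [set (x ^+ 2 / (2 * sigma ^+ 2))%:E
                                     | x in closure G])%E]}.

Proof.
move=> thK thinvK mtheta mthetainv theta_pres theta_erg dist_metric dist_le1 _ borel
  /andP[alpha_gt0 alpha_le1] mEE _ TE mT _ phi_bounded _ u_holder ae_conformal
  settings p_gt8 sigma_gt0 ae_sigma a_gt0 a_large a_small.
have mE := fibre_measurable mEE.
have mTw w : measurable_fun (E w) (T w) by exact: fibre_map_measurable.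
case: settings => -[set cond].
  have [Q [C [de [CK [cc [M [aeQ M0 sys]]]]]]] :=
    cone_system_A dist_metric dist_le1 borel alpha_gt0 mE u_holder set cond.
  case: cond => _ _ [_ KLp _ [msupu _]].
  exact: (ae_mdp dist_metric dist_le1 borel alpha_gt0 alpha_le1 mE TE mTw u_holder thK thinvK
    p_gt8 sigma_gt0 a_gt0 a_large a_small mtheta mthetainv theta_pres theta_erg
    ae_conformal ae_sigma aeQ KLp msupu M0 sys).
have [Q [C [de [CK [cc [M [aeQ M0 sys]]]]]]] :=
  cone_system_B dist_metric dist_le1 borel alpha_gt0 mE u_holder phi_bounded set cond.
case: cond => _ _ KLp _ [msupu _].
exact: (ae_mdp dist_metric dist_le1 borel alpha_gt0 alpha_le1 mE TE mTw u_holder thK thinvK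
  p_gt8 sigma_gt0 a_gt0 a_large a_small mtheta mthetainv theta_pres theta_erg
  ae_conformal ae_sigma aeQ KLp msupu M0 sys).
Qed.
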